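(* Let $a\in\{0,1\}$. Then for any complex sequences $\{\lambda_{n,\alpha}\}_{n\ge0}$, $\alpha=0,1$, of the form $$ \lambda_{2k,\alpha}=(2k+\alpha)^2\pi^2+\varkappa_{k,\alpha},\quad k\ge0,\quad \{\varkappa_{k,\alpha}\}_{k\ge0}\in l_2,\qquad \lambda_{2k-1,\alpha}=(2k-\alpha)^2\pi^2,\quad k\ge1,\qquad \alpha=0,1, $$ there exists a unique complex-valued function $q\in L_2(0,1)$ such that, for $\alpha=0,1$, the sequence $\{\lambda_{n,\alpha}\}_{n\ge0}$ is the spectrum of the boundary value problem $\mathcal L_\alpha(q(x),a)$.
   Context: For a complex-valued $q\in L_2(0,1)$, $a\in[0,1]$ and $\gamma\in\mathbb C\setminus\{0\}$, $\mathcal L(q(x),a,\gamma)$ denotes the boundary value problem $$-y''(x)+q(x)y(a)=\lambda y(x),\quad 0<x<1,\qquad y^{(\nu)}(0)=\gamma y^{(\nu)}(1),\quad \nu=0,1,$$ for $y\in W_2^2[0,1]$, with spectral parameter $\lambda\in\mathbb C$. For $\alpha\in\{0,1\}$, $\mathcal L_\alpha(q(x),a):=\mathcal L(q(x),a,(-1)^\alpha)$ (periodic problem for $\alpha=0$, antiperiodic for $\alpha=1$). Let $C(x,\lambda)$, $S(x,\lambda)$ be the solutions of the equation with $C(a,\lambda)=S'(a,\lambda)=1$, $S(a,\lambda)=C'(a,\lambda)=0$; with $\rho^2=\lambda$, $$C(x,\lambda)=\cos\rho(x-a)+\int_a^x\frac{\sin\rho(x-t)}{\rho}q(t)\,dt,\qquad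 S(x,\lambda)=\frac{\sin\rho(x-a)}{\rho}.$$ The eigenvalues of $\mathcal L(q(x),a,\gamma)$ are the zeros of the characteristic function $$\Delta(\lambda)=\begin{vmatrix} C(0,\lambda)-\gamma C(1,\lambda) & S(0,\lambda)-\gamma S(1,\lambda)\\ C'(0,\lambda)-\gamma C'(1,\lambda) & S'(0,\lambda)-\gamma S'(1,\lambda)\end{vmatrix},$$ and the spectrum is the collection of zeros of $\Delta$ counted with multiplicity (a multiset). Functions in $L_2(0,1)$ are identified when equal a.e. *)

(* Defs.v *)
From HB Require Import structures.
From mathcomp Require Import all_boot all_order all_algebra.
From mathcomp Require Import complex.
From mathcomp Require Import all_classical all_reals all_analysis.
Set Implicit Arguments.
Unset Strict Implicit.
Unset Printing Implicit Defensive.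
Import Order.TTheory GRing.Theory Num.Theory.
Import numFieldNormedType.Exports.
Local Open Scope classical_set_scope.
Local Open Scope complex_scope.
Local Open Scope ring_scope.

Notation normc := ComplexField.Normc.normc.

Section ComplexFunctions.
Variable R : realType.
Implicit Types (z w : R[i]) (q f : R -> R[i]).

Definition cexp z : R[i] :=
  (expR (complex.Re z) * cos (complex.Im z))
  +i* (expR (complex.Re z) * sin (complex.Im z)).

Definition ccos z : R[i] := (cexp ('i%C * z) + cexp (- ('i%C * z))) / 2.

Definition csin z : R[i] := (cexp ('i%C * z) - cexp (- ('i%C * z))) / (2 * 'i%C).

Definition cintegral (A : set R) f : R[i] :=
  (\int[lebesgue_measure]_(t in A) complex.Re (f t))
  +i* (\int[lebesgue_measure]_(t in A) complex.Im (f t)).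

(* The integral of f from a to b with orientation, where f is only given on
   ]0, 1[ and is extended by 0 elsewhere. *)
Definition ointegral (a b : R) f : R[i] :=
  if a <= b then cintegral (`[a, b] `&` `]0, 1[) f
  else - cintegral (`[b, a] `&` `]0, 1[) f.

Definition cderive f (x : R) : R[i] :=
  derive1 (fun t => complex.Re (f t)) x
  +i* derive1 (fun t => complex.Im (f t)) x.

(* An element of L_2(0, 1) is represented by a function on the whole line, of
   which only the restriction to ]0, 1[ is used. *)
Definition in_L2 q : Prop :=
  [/\ measurable_fun (`]0, 1[ : set R) (fun x => complex.Re (q x)),
      measurable_fun (`]0, 1[ : set R) (fun x => complex.Im (q x)) &
      (\int[lebesgue_measure]_(x in (`]0%R, 1%R[ : set R))
         (normc (q x) ^+ 2)%:E < +oo)%E].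

Definition in_l2 (u : nat -> R[i]) : Prop :=
  (\sum_(0 <= k <oo) (normc (u k) ^+ 2)%:E < +oo)%E.

(* m is the multiplicity of z as a zero of F (m = 0 if F z != 0): near z,
   F w = (w - z) ^ m G w with G holomorphic and G z != 0. The regular module
   R[i]^o carries the topology of the complex plane. *)
Definition zero_mult (F : R[i] -> R[i]) z (m : nat) : Prop :=
  exists G : R[i]^o -> R[i]^o,
    [/\ G z != 0,
        \forall w \near (z : R[i]^o), derivable G w 1 &
        \forall w \near (z : R[i]^o), F w = (w - z) ^+ m * G w].

(* The sequence s enumerates the zeros of F as a multiset. *)
Definition zeros_with_mult (F : R[i] -> R[i]) (s : nat -> R[i]) : Prop :=
  forall z, exists2 m, zero_mult F z m & ([set n | s n = z] #= `I_m)%card.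

End ComplexFunctions.

(* The problem - y'' + q(x) y(a) = lam y on (0, 1), y^(nu)(0) = gamma y^(nu)(1)
   for nu = 0, 1. *)
Section NonlocalProblem.
Variables (R : realType) (q : R -> R[i]) (a : R).
Implicit Types (lam gamma : R[i]) (x : R).

(* sin (rho x) / rho with rho ^ 2 = lam, continued by x at lam = 0; this and
   cos (rho x) are even in rho, so the choice of the root is immaterial. *)
Definition sin_div lam x : R[i] :=
  if lam == 0 then x%:C else csin (sqrtC lam * x%:C) / sqrtC lam.

(* The solution with C(a) = 1, C'(a) = 0, written by variation of constants
   (its value y(a) = 1 multiplies q). As q is extended by 0 outside ]0, 1[,
   it is continuously differentiable on the whole line, so that its two-sided
   derivatives at 0 and 1 are the one-sided derivatives from [0, 1]. *)
Definition solC lam x : R[i] :=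
  ccos (sqrtC lam * (x - a)%:C)
  + ointegral a x (fun t => sin_div lam (x - t) * q t).

(* The solution with S(a) = 0, S'(a) = 1. *)
Definition solS lam x : R[i] := sin_div lam (x - a).

Definition char_fun gamma lam : R[i] :=
  let C := solC lam in let S := solS lam in
  (C 0 - gamma * C 1) * (cderive S 0 - gamma * cderive S 1)
  - (S 0 - gamma * S 1) * (cderive C 0 - gamma * cderive C 1).

Definition is_spectrum gamma (s : nat -> R[i]) : Prop :=
  zeros_with_mult (char_fun gamma) s.

End NonlocalProblem.

(* Main.v *)
Require Import Defs.
From HB Require Import structures.
From mathcomp Require Import all_boot all_order all_algebra.
From mathcomp Require Import complex.
From mathcomp Require Import all_classical all_reals all_analysis.
From mathcomp Require Import measurable_realfun.
From mathcomp Require Import ring lra zify.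
Set Implicit Arguments.
Unset Strict Implicit.
Unset Printing Implicit Defensive.
Import Order.TTheory GRing.Theory Num.Theory.
Import numFieldNormedType.Exports.
Local Open Scope classical_set_scope.
Local Open Scope complex_scope.
Local Open Scope ring_scope.

(* For a in {0, 1} the characteristic function of L_alpha is
   2 (1 - (-1)^alpha cos rho) (1 - sum_k b_k / (lambda - mu_k)), where
   mu_k = ((2 k + alpha) pi)^2 and where the b_k are, up to a sign and a
   factor 1 or 2, the cosine coefficients of q of index 2 k + alpha; so the two
   problems see complementary halves of the cosine coefficients of q. The
   first factor accounts for the unperturbed half of the spectrum, and the
   zeros mu_k + kappa_k of the second one are prescribed by taking for the b_k
   the residues of the product of the (lambda - mu_k - kappa_k) / (lambda - mu_k),
   which are square summable with the kappa_k. Riesz-Fischer then yields q.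
   Conversely, the difference of two such sequences b gives a bounded sequence d
   for which sum_k d_k / (lambda - mu_k) vanishes at all the mu_k + kappa_k.
   Moving the finitely many large kappa_k to 0 one at a time, by multiplying the
   sum with (lambda - mu_k) / (lambda - mu_k - kappa_k), one may assume that the
   kappa_k are small; the values at the points mu_k + kappa_k then bound
   sup |d| by half of itself, whence d = 0. *)

(** * Complex functions of a complex variable *)

(** For a in {0, 1} the determinant integrates q against one solution of the unperturbed equation on
    the whole of ]0, 1[, even or odd about 1/2, so its cosine coefficients are explicit and half of
    them vanish. The factor 1 - (-1)^alpha cos rho has a double zero in lambda at every node except
    0, where the zero is simple; the pole of the second factor at a node consumes one order, and
    what remains is the fixed eigenvalue (2 k - alpha)^2 pi^2, k >= 1.

    Zeros are handled by explicit factorisations, with multiplicities as exponents. The engine is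
    the quadratic gap between nodes: the sums of 1 / |mu_j - mu_k| over j <> k are at most 4. This
    bounds the product at the nodes independently of the node, so that the residues inherit square
    summability, and it gives the threshold 1/16 for a small kappa_k, from (1/16) 2 4 = 1/2. Since
    division by 0 yields 0, a product or a sum evaluated at a node skips its singular factor or
    term; this is how residues are written. *)

Section ComplexNorm.
Variable R : realType.
Implicit Types (z w : R[i]).

Lemma normcE z : `|z| = (normc z)%:C. Proof. by []. Qed.

Lemma normc_ge0 z : 0 <= normc z.
Proof. by case: z => a b; rewrite /= sqrtr_ge0. Qed.

Lemma normc_eq0 z : (normc z == 0) = (z == 0).
Proof.
apply/eqP/eqP => [/ComplexField.Normc.eq0_normc //|->].
exact: ComplexField.Normc.normc0.
Qed.

Lemma normc_gt0 z : (0 < normc z) = (z != 0).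
Proof. by rewrite lt_def normc_eq0 normc_ge0 andbT. Qed.

Lemma normcM z w : normc (z * w) = normc z * normc w.
Proof. exact: ComplexField.Normc.normcM. Qed.

Lemma normcV z : normc z^-1 = (normc z)^-1.
Proof. exact: ComplexField.Normc.normcV. Qed.

Lemma normcX z n : normc (z ^+ n) = normc z ^+ n.
Proof.
by elim: n => [|n IH]; rewrite ?expr0 ?ComplexField.Normc.normc1// !exprS normcM IH.
Qed.

Lemma normc_le_add z w : normc (z + w) <= normc z + normc w.
Proof. by have := ler_normD z w; rewrite !normcE -rmorphD lecR. Qed.

Lemma normcN z : normc (- z) = normc z.
Proof. by case: z => a b /=; rewrite !sqrrN. Qed.

Lemma normcB z w : normc (z - w) = normc (w - z).
Proof. by rewrite -normcN opprB. Qed.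

Lemma normc_le_sub z w : normc (z - w) <= normc z + normc w.
Proof. by rewrite -(normcN w) normc_le_add. Qed.

Lemma normc_dist_add (z w t : R[i]) : normc (z - t) <= normc (z - w) + normc (w - t).
Proof. by rewrite (le_trans _ (normc_le_add _ _))// addrA subrK. Qed.

Lemma normc_ge_sub z w : normc z - normc w <= normc (z - w).
Proof. by rewrite lerBlDr -{1}(subrK w z) normc_le_add. Qed.

Lemma normc_real (x : R) : normc x%:C = `|x|.
Proof. by rewrite /= expr0n addr0 sqrtr_sqr. Qed.

Lemma normc0 : normc (0 : R[i]) = 0. Proof. exact: ComplexField.Normc.normc0. Qed.
Lemma normc1 : normc (1 : R[i]) = 1. Proof. exact: ComplexField.Normc.normc1. Qed.

Lemma normc_nat n : normc (n%:R : R[i]) = n%:R.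
Proof. by rewrite -(rmorph_nat (real_complex R)) normc_real ger0_norm ?ler0n. Qed.

Lemma Re_le_normc z : `|complex.Re z| <= normc z.
Proof.
case: z => a b /=; rewrite -sqrtr_sqr ler_wsqrtr// lerDl; exact: sqr_ge0.
Qed.

Lemma Im_le_normc z : `|complex.Im z| <= normc z.
Proof.
case: z => a b /=; rewrite -sqrtr_sqr ler_wsqrtr// lerDr; exact: sqr_ge0.
Qed.

Lemma normc_le_ReIm z : normc z <= `|complex.Re z| + `|complex.Im z|.
Proof.
case: z => a b /=; rewrite -(ger0_norm (addr_ge0 (normr_ge0 a) (normr_ge0 b))).
rewrite -sqrtr_sqr ler_wsqrtr// sqrrD !real_normK ?num_real//.
by rewrite addrAC lerDl mulrn_wge0// mulr_ge0.
Qed.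

Lemma normc_sum (I : Type) (r : seq I) (P : pred I) (F : I -> R[i]) :
  normc (\sum_(i <- r | P i) F i) <= \sum_(i <- r | P i) normc (F i).
Proof.
elim/big_rec2: _ => [|i y x _ H]; first by rewrite normc0.
by rewrite (le_trans (normc_le_add _ _))// lerD2l.
Qed.

Lemma normc_prod (I : Type) (r : seq I) (P : pred I) (F : I -> R[i]) :
  normc (\prod_(i <- r | P i) F i) = \prod_(i <- r | P i) normc (F i).
Proof.
by elim/big_rec2: _ => [|i y x _ H]; rewrite ?normc1// normcM H.
Qed.

End ComplexNorm.

(** * Continuity and complex differentiability at a point *)

Section ComplexContinuity.
Variable R : realType.
Implicit Types (z w : R[i]) (f g : R[i] -> R[i]) (P Q : R[i] -> Prop).

(** Balls of [R[i]^o] have radii in [R[i]]; real radii keep all estimates in [R], and [cnear_nbhs]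
    translates where library notions occur. *)
Definition cnear w P := exists2 d : R, 0 < d & forall x, normc (x - w) < d -> P x.

Lemma cnear_self w P : cnear w P -> P w.
Proof. by move=> [d d0 /(_ w)]; rewrite subrr normc0 => /(_ d0). Qed.

Lemma cnearS w P Q : (forall x, P x -> Q x) -> cnear w P -> cnear w Q.
Proof. by move=> PQ [d d0 H]; exists d => // x /H/PQ. Qed.

Lemma cnearI w P Q : cnear w P -> cnear w Q -> cnear w (fun x => P x /\ Q x).
Proof.
move=> [d d0 H] [e e0 K]; exists (Num.min d e) => [|x]; first by rewrite lt_min d0.
by rewrite lt_min => /andP[/H ? /K].
Qed.

Lemma cnearT w P : (forall x, P x) -> cnear w P.
Proof. by move=> h; exists 1. Qed.

Lemma cnear_nbhs w P : (\forall x \near (w : R[i]^o), P x) <-> cnear w P.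
Proof.
split => [/nbhs_ballP[[d d'] /= d0 H]|[d d0 H]].
  (* A positive element of [R[i]] is real, so the radius of the given ball has imaginary part 0. *)
  have /andP[/= /eqP ? d0'] : (d' == 0) && (0 < d) by rewrite ltcE in d0.
  subst d'.
  exists d => // x xw; apply: H => /=.
  rewrite /ball /= -normrN opprB normcE ltcE /= eqxx /=; exact: xw.
apply/nbhs_ballP; exists d%:C; first by rewrite /= ltcE /= eqxx.
move=> x; rewrite /ball /= -normrN opprB normcE ltcE /= => /andP[_ xw]; exact: H.
Qed.

Lemma cnear_neq w z : w != z -> cnear w (fun x => x != z).
Proof.
move=> wz; exists (normc (w - z)); first by rewrite normc_gt0 subr_eq0.
by move=> x; apply: contraTneq => ->; rewrite normcB ltxx.
Qed.

Definition ccont f w :=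
  forall e : R, 0 < e -> cnear w (fun x => normc (f x - f w) < e).

Lemma ccont_near f g w : cnear w (fun x => f x = g x) -> ccont f w -> ccont g w.
Proof.
move=> fg cf e e0; have := cnearI fg (cf e e0).
by apply: cnearS => x [<-]; rewrite (cnear_self fg).
Qed.

Lemma ccont_cst (c : R[i]) w : ccont (fun=> c) w.
Proof. by move=> e e0; apply: cnearT => x; rewrite subrr normc0. Qed.

Lemma ccont_id w : ccont id w. Proof. by move=> e e0; exists e. Qed.

Lemma ccontD f g w : ccont f w -> ccont g w -> ccont (fun x => f x + g x) w.
Proof.
move=> cf cg e e0; have e2 : 0 < e / 2 by rewrite divr_gt0.
have := cnearI (cf _ e2) (cg _ e2); apply: cnearS => x [H K].
rewrite [ltRHS]splitr opprD addrACA (le_lt_trans (normc_le_add _ _))//.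
exact: ltrD.
Qed.

Lemma ccontN f w : ccont f w -> ccont (fun x => - f x) w.
Proof.
by move=> cf e e0; apply: cnearS (cf _ e0) => x; rewrite -opprD normcN.
Qed.

Lemma ccontB f g w : ccont f w -> ccont g w -> ccont (fun x => f x - g x) w.
Proof. by move=> cf cg; exact: ccontD (ccontN cg). Qed.

Lemma ccont_bounded f w : ccont f w ->
  cnear w (fun x => normc (f x) <= normc (f w) + 1).
Proof.
move=> /(_ 1 ltr01); apply: cnearS => x H.
by rewrite -(subrK (f w) (f x)) (le_trans (normc_le_add _ _))// addrC lerD2l ltW.
Qed.

Lemma ccontM f g w : ccont f w -> ccont g w -> ccont (fun x => f x * g x) w.
Proof.
move=> cf cg e e0.
pose A := normc (f w) + 1; pose B := normc (g w) + 1.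
have A0 : 0 < A by rewrite ltr_wpDl// normc_ge0.
have B0 : 0 < B by rewrite ltr_wpDl// normc_ge0.
have eA : 0 < e / 2 / A by rewrite !divr_gt0.
have eB : 0 < e / 2 / B by rewrite !divr_gt0.
have := cnearI (ccont_bounded cf) (cnearI (cf _ eB) (cg _ eA)).
apply: cnearS => x [fb [H K]].
have -> : f x * g x - f w * g w = f x * (g x - g w) + (f x - f w) * g w by ring.
rewrite [ltRHS]splitr (le_lt_trans (normc_le_add _ _))// !normcM ltr_leD//.
  rewrite (@le_lt_trans _ _ (A * normc (g x - g w)))//.
    by rewrite ler_wpM2r// normc_ge0.
  by rewrite mulrC -ltr_pdivlMr.
rewrite (@le_trans _ _ (normc (f x - f w) * B))//.
  by rewrite ler_wpM2l ?normc_ge0// /B lerDl.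
by rewrite -ler_pdivlMr// ltW.
Qed.

Lemma ccont_neq0 f w : ccont f w -> f w != 0 ->
  cnear w (fun x => normc (f w) / 2 <= normc (f x)).
Proof.
rewrite -normc_gt0 => cf fw0.
have f2 : 0 < normc (f w) / 2 by rewrite divr_gt0.
apply: cnearS (cf _ f2) => x H.
have := normc_ge_sub (f w) (f x); rewrite normcB in H; lra.
Qed.

Lemma ccontV f w : ccont f w -> f w != 0 -> ccont (fun x => (f x)^-1) w.
Proof.
move=> cf fw0 e e0; have fw0' := fw0; rewrite -normc_gt0 in fw0'.
set A := normc (f w) in fw0'.
have d0 : 0 < e * (A * (A / 2)) by rewrite !mulr_gt0.
have := cnearI (cf _ d0) (ccont_neq0 cf fw0); apply: cnearS => x [H K].
have fx0' : 0 < normc (f x) by rewrite (lt_le_trans _ K)// divr_gt0.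
have fx0 : f x != 0 by rewrite -normc_gt0.
have -> : (f x)^-1 - (f w)^-1 = - (f x - f w) * ((f w)^-1 * (f x)^-1) by field; apply/andP.
rewrite normcM normcN normcM !normcV -invfM ltr_pdivrMr ?mulr_gt0//.
by rewrite (lt_le_trans H)// ler_pM2l// ler_pM2l.
Qed.

Lemma ccont_comp f g w : ccont g w -> ccont f (g w) -> ccont (f \o g) w.
Proof. by move=> cg cf e /cf[d d0 H]; apply: cnearS (cg _ d0) => x /H. Qed.

Lemma ccontX f w n : ccont f w -> ccont (fun x => f x ^+ n) w.
Proof.
move=> cf; elim: n => [|n IH].
  by apply: (@ccont_near (fun=> 1)); [exact: cnearT|exact: ccont_cst].
apply: (@ccont_near (fun x => f x * f x ^+ n)); last exact: ccontM.
by apply: cnearT => x; rewrite exprS.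
Qed.

(** The point [w] is not isolated: a ball of radius d contains [w + d / 2]. This carries formulas
    proved off the nodes over to a node. *)
Lemma ccont_unique f g w : ccont f w -> ccont g w ->
  cnear w (fun x => x != w -> f x = g x) -> f w = g w.
Proof.
move=> cf cg fg; apply/eqP; rewrite -subr_eq0 -normc_eq0.
apply: contraT => h; have h0 : 0 < normc (f w - g w) by rewrite lt_def h normc_ge0.
have [d d0 H] := cnearI fg (ccontB cf cg h0).
have := H (w + (d / 2)%:C); rewrite addrC addKr normc_real.
rewrite ger0_norm ?divr_ge0// ?(ltW d0)//.
have d2 : d / 2 < d by rewrite ltr_pdivrMr// ltr_pMr// ltr1n.
move=> /(_ d2)[-> ]; first by rewrite subrr sub0r normcN ltxx.
rewrite -subr_eq0 addrAC subrr add0r -normc_eq0 normc_real normr_eq0.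
by rewrite gt_eqF// divr_gt0.
Qed.

(* Caratheodory's form of complex differentiability. *)
Definition cdiff f w := exists2 phi, ccont phi w &
  cnear w (fun x => f x - f w = (x - w) * phi x).

Lemma cdiff_cont f w : cdiff f w -> ccont f w.
Proof.
move=> [phi cphi H].
apply: (@ccont_near (fun x => f w + (x - w) * phi x)).
  by apply: cnearS H => x <-; rewrite addrC subrK.
apply: ccontD (ccont_cst _ _) _; apply: ccontM => //.
apply: ccontB (ccont_cst _ _); exact: ccont_id.
Qed.

Lemma cdiff_near f g w : cnear w (fun x => f x = g x) -> cdiff f w -> cdiff g w.
Proof.
move=> fg [phi cphi H]; exists phi => //.
by apply: cnearS (cnearI fg H) => x [<-]; rewrite (cnear_self fg).
Qed.

Lemma cdiff_cst (c : R[i]) w : cdiff (fun=> c) w.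
Proof.
by exists (fun=> 0); [exact: ccont_cst|apply: cnearT => x; rewrite mulr0 subrr].
Qed.

Lemma cdiff_id w : cdiff id w.
Proof. by exists (fun=> 1); [exact: ccont_cst|apply: cnearT => x; rewrite mulr1]. Qed.

Lemma cdiffD f g w : cdiff f w -> cdiff g w -> cdiff (fun x => f x + g x) w.
Proof.
move=> [p cp H] [q cq K]; exists (fun x => p x + q x); first exact: ccontD.
by apply: cnearS (cnearI H K) => x [Hx Kx]; rewrite mulrDr -Hx -Kx opprD addrACA.
Qed.

Lemma cdiffM f g w : cdiff f w -> cdiff g w -> cdiff (fun x => f x * g x) w.
Proof.
move=> df dg; have cg := cdiff_cont dg.
case: df dg => [p cp H] [q cq K].
exists (fun x => p x * g x + f w * q x).
  by apply: ccontD; apply: ccontM => //; exact: ccont_cst.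
apply: cnearS (cnearI H K) => x [Hx Kx].
rewrite mulrDr mulrA -Hx mulrCA -Kx; ring.
Qed.

Lemma cdiffN f w : cdiff f w -> cdiff (fun x => - f x) w.
Proof.
move=> df; apply: (@cdiff_near (fun x => -1 * f x)).
  by apply: cnearT => x; rewrite mulN1r.
by apply: cdiffM => //; exact: cdiff_cst.
Qed.

Lemma cdiffB f g w : cdiff f w -> cdiff g w -> cdiff (fun x => f x - g x) w.
Proof. by move=> df dg; exact: cdiffD (cdiffN dg). Qed.

Lemma cdiffV f w : cdiff f w -> f w != 0 -> cdiff (fun x => (f x)^-1) w.
Proof.
move=> df fw0; have cf := cdiff_cont df; case: df => [p cp H].
exists (fun x => - p x * ((f x)^-1 * (f w)^-1)).
  apply: ccontM; first exact: ccontN.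
  by apply: ccontM; [exact: ccontV|exact: ccont_cst].
apply: cnearS (cnearI H (ccont_neq0 cf fw0)) => x [Hx K].
have fx0 : f x != 0.
  by rewrite -normc_gt0 (lt_le_trans _ K)// divr_gt0// normc_gt0.
rewrite mulrA mulrN -Hx; field; exact/andP.
Qed.

Lemma cdiff_comp f g w : cdiff g w -> cdiff f (g w) -> cdiff (f \o g) w.
Proof.
move=> dg; have cg := cdiff_cont dg; case: dg => [p cp H] [q cq [d d0 K]].
exists (fun x => p x * q (g x)); first by apply: ccontM => //; exact: ccont_comp.
apply: cnearS (cnearI H (cg _ d0)) => x [Hx Kx] /=.
by rewrite K// Hx mulrA.
Qed.

Lemma cdiffX f w n : cdiff f w -> cdiff (fun x => f x ^+ n) w.
Proof.
move=> df; elim: n => [|n IH].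
  by apply: (@cdiff_near (fun=> 1)); [exact: cnearT|exact: cdiff_cst].
apply: (@cdiff_near (fun x => f x * f x ^+ n)); last exact: cdiffM.
by apply: cnearT => x; rewrite exprS.
Qed.

(** The bridge to [derivable], which [zero_mult] demands of the cofactor. *)
Lemma cdiff_derivable f w : cdiff f w -> derivable (f : R[i]^o -> R[i]^o) w 1.
Proof.
move=> [p cp [d d0 H]]; apply/cvg_ex; exists (p w).
apply/cvgrPdist_lt => -[e e']; rewrite ltcE /= => /andP[/eqP ? e0]; subst e'.
have [r r0 K] := cp _ e0.
rewrite near_withinE; apply/cnear_nbhs; exists (Num.min d r).
  by rewrite lt_min d0.
move=> h; rewrite subr0 lt_min => /andP[hd hr] h0.
have E : h *: (1 : R[i]^o) + w = h + w by rewrite /GRing.scale/= mulr1.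
rewrite /= E H ?addrK// -normrN opprB normcE ltcE /= eqxx /=.
rewrite /GRing.scale /= mulKf//; apply: K.
by rewrite addrK.
Qed.

End ComplexContinuity.

(** * Series *)

Section RealSums.
Variable R : realType.
Implicit Types (u v : nat -> R).

Lemma sum_le_widen v (n m : nat) : (forall k, 0 <= v k) -> (n <= m)%N ->
  \sum_(k < n) v k <= \sum_(k < m) v k.
Proof.
move=> v0 nm; rewrite -!(big_mkord xpredT v) (big_cat_nat (n := n) (leq0n n) nm) /=.
by rewrite lerDl sumr_ge0.
Qed.

(** The partial sums increase to their supremum. Smallness is expressed on finite blocks, the form
    in which tails are estimated later. *)
Lemma bounded_sum_tail v (B : R) : (forall k, 0 <= v k) ->
  (forall n, \sum_(k < n) v k <= B) ->
  forall e, 0 < e -> exists N, forall n, \sum_(N <= k < n) v k < e.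
Proof.
move=> v0 vB e e0.
pose s n := \sum_(k < n) v k.
have sn : nondecreasing_seq s by move=> n m nm; exact: sum_le_widen.
have ub : has_ubound (range s) by exists B => _ [n _ <-]; exact: vB.
have cs := nondecreasing_cvgn sn ub.
have /cvgrPdist_lt/(_ _ e0)[N _ HN] := cs.
exists N => n; have [nN|Nn] := leqP n N; first by rewrite big_geq.
have su : s n <= sup (range s).
  by rewrite -(cvg_lim _ cs)//; apply: nondecreasing_cvgn_le => //; apply/cvg_ex; eexists; exact: cs.
have := HN N (leqnn N); rewrite /= => H.
have /(le_lt_trans (ler_norm _)) {}H : `|sup (range s) - s N| < e by [].
have E : s n = s N + \sum_(N <= k < n) v k.
  by rewrite /s -!(big_mkord xpredT v) (big_cat_nat (n := N) (leq0n N) (ltnW Nn)).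
lra.
Qed.

Definition inv_sq (n : nat) : R := if n is 0%N then 0 else (n%:R ^+ 2)^-1.

Lemma inv_sq_ge0 n : 0 <= inv_sq n.
Proof. by case: n => //= n; rewrite invr_ge0 sqr_ge0. Qed.

Lemma inv_sq_sum n : \sum_(k < n) inv_sq k <= 2.
Proof.
(* The sharper bound makes the induction pass: 1 / x^2 <= 2 / x - 2 / (x + 1) for x >= 1. *)
suff H : forall m, \sum_(k < m.+1) inv_sq k <= 2 - 2 / m.+1%:R.
  case: n => [|n]; first by rewrite big_ord0.
  by rewrite (le_trans (H n))// gerBl divr_ge0.
elim=> [|m IH]; first by rewrite big_ord_recr big_ord0 /=; lra.
rewrite big_ord_recr /= (le_trans (lerD IH (lexx _)))//.
rewrite -addrA lerD2l -(natr1 m.+1).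
have x0 : (1 : R) <= m.+1%:R by rewrite ler1n.
move: (m.+1%:R : R) x0 => x x0.
have x1 : x != 0 by rewrite gt_eqF//; lra.
have x2 : x + 1 != 0 by rewrite gt_eqF//; lra.
rewrite -subr_le0.
have -> : - (2 / x) + (x ^+ 2)^-1 - - (2 / (x + 1)) = (1 - x) / (x ^+ 2 * (x + 1)).
  by field; apply/andP.
by rewrite pmulr_lle0 ?invr_gt0 ?mulr_gt0 ?exprn_gt0//; lra.
Qed.

(** The sum of the two truncated differences is |j - k|; the value 0 of [inv_sq] at 0 removes the
    diagonal. *)
Definition dist2 (j k : nat) : R := inv_sq (j - k + (k - j)).

(** Each side of [k] contributes at most 2, so the bound is uniform in [k] and [n]. The range is
    first widened to [k + n] to be split at [k]. *)
Lemma dist2_sum k n : \sum_(j < n) dist2 j k <= 4.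
Proof.
have d0 j : 0 <= dist2 j k by exact: inv_sq_ge0.
apply: le_trans (sum_le_widen d0 (leq_addl k n)) _.
rewrite big_split_ord /= (_ : 4 = 2 + 2 :> R); last by lra.
apply: lerD; last first.
  rewrite (le_trans _ (inv_sq_sum n))// ler_sum// => j _.
  by rewrite /dist2 addKn subnDA subnn sub0n addn0.
(* After reversal the j-th term of the left half is the one at distance j + 1 from [k]. *)
rewrite (reindex_inj rev_ord_inj) /= (le_trans _ (inv_sq_sum k.+1))//.
rewrite big_ord_recl /= add0r ler_sum// => j _.
rewrite /dist2 (_ : (k - j.+1 - k + (k - (k - j.+1)) = j.+1)%N) //.
by have := ltn_ord j; lia.
Qed.

End RealSums.

Section ComplexSums.
Variable R : realType.
Implicit Types (u f g : nat -> R[i]) (l : R[i]) (v : nat -> R).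

Definition ccvg u l := forall e : R, 0 < e ->
  exists N, forall n, (N <= n)%N -> normc (u n - l) < e.

Lemma ccvg_unique u l l' : ccvg u l -> ccvg u l' -> l = l'.
Proof.
move=> h h'; apply/eqP; rewrite -subr_eq0 -normc_eq0; apply: contraT => n0.
have e0 : 0 < normc (l - l') / 2 by rewrite divr_gt0// lt_def n0 normc_ge0.
have [N H] := h _ e0; have [M K] := h' _ e0.
have := H _ (leq_maxl N M); have := K _ (leq_maxr N M) => a b.
have := normc_dist_add l (u (maxn N M)) l'; rewrite (normcB l (u _)); lra.
Qed.

Lemma ccvg_cst l : ccvg (fun=> l) l.
Proof. by move=> e e0; exists 0%N => n _; rewrite subrr normc0. Qed.

Lemma ccvg_ext u u' l : (forall n, u n = u' n) -> ccvg u l -> ccvg u' l.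
Proof. by move=> E H e /H[N K]; exists N => n; rewrite -E; exact: K. Qed.

Lemma ccvg_shift u l m : ccvg u l -> ccvg (fun n => u (n + m)%N) l.
Proof.
by move=> H e /H[N K]; exists N => n Nn; apply: K; rewrite (leq_trans Nn)// leq_addr.
Qed.

Lemma ccvgD u u' l l' : ccvg u l -> ccvg u' l' -> ccvg (fun n => u n + u' n) (l + l').
Proof.
move=> h h' e e0; have e2 : 0 < e / 2 by rewrite divr_gt0.
have [N H] := h _ e2; have [M K] := h' _ e2.
exists (maxn N M) => n; rewrite geq_max => /andP[Nn Mn].
rewrite opprD addrACA [ltRHS]splitr (le_lt_trans (normc_le_add _ _))//.
by apply: ltrD; [exact: H|exact: K].
Qed.

Lemma ccvgZ u l c : ccvg u l -> ccvg (fun n => c * u n) (c * l).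
Proof.
move=> h e e0; have c0 : 0 < normc c + 1 by rewrite ltr_wpDl// normc_ge0.
have [N H] := h (e / (normc c + 1)) (divr_gt0 e0 c0); exists N => n /H.
rewrite ltr_pdivlMr// -mulrBr normcM => K; apply: le_lt_trans K.
by rewrite mulrC ler_wpM2l ?normc_ge0// lerDl.
Qed.

Lemma ccvg_le u l (B : R) : ccvg u l -> (forall n, normc (u n) <= B) -> normc l <= B.
Proof.
move=> h uB; rewrite leNgt; apply/negP => Bl.
have [N /(_ _ (leqnn N)) H] : exists N, forall n, (N <= n)%N -> normc (u n - l) < normc l - B.
  by apply: h; rewrite subr_gt0.
have := normc_ge_sub l (u N); rewrite normcB; have := uB N; lra.
Qed.

Lemma ccvg_ge u l (B : R) : ccvg u l -> (forall n, B <= normc (u n)) -> B <= normc l.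
Proof.
move=> h uB; rewrite leNgt; apply/negP => Bl.
have [N /(_ _ (leqnn N)) H] : exists N, forall n, (N <= n)%N -> normc (u n - l) < B - normc l.
  by apply: h; rewrite subr_gt0.
have := normc_ge_sub (u N) l; have := uB N; lra.
Qed.

Definition csum u l := ccvg (fun n => \sum_(k < n) u k) l.
Definition cser u : R[i] := xget 0 [set l | csum u l].
(** The hypothesis of the Weierstrass M-test; [B] is recorded because it also bounds the modulus of
    the sum. *)
Definition dominated u v (B : R) :=
  (forall k, normc (u k) <= v k) /\ (forall n, \sum_(k < n) v k <= B).

Lemma csum_cser u l : csum u l -> cser u = l.
Proof.
by move=> h; rewrite /cser; case: xgetP => [x _ h'|/(_ l)//]; exact: ccvg_unique h' h.
Qed.

Lemma Re_sum (I : Type) (r : seq I) (F : I -> R[i]) :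
  complex.Re (\sum_(i <- r) F i) = \sum_(i <- r) complex.Re (F i).
Proof.
by elim: r => [|i r IH]; rewrite ?big_nil// !big_cons -IH; case: (F i) => a b; case: (\sum_(_ <- _) _).
Qed.

Lemma Im_sum (I : Type) (r : seq I) (F : I -> R[i]) :
  complex.Im (\sum_(i <- r) F i) = \sum_(i <- r) complex.Im (F i).
Proof.
by elim: r => [|i r IH]; rewrite ?big_nil// !big_cons -IH; case: (F i) => a b; case: (\sum_(_ <- _) _).
Qed.

Lemma real_sum_cvg (a v : nat -> R) (B : R) : (forall k, `|a k| <= v k) ->
  (forall n, \sum_(k < n) v k <= B) -> cvgn (series a).
Proof.
move=> av vB; apply: normed_cvg; apply: (@series_le_cvg _ _ v).
- by move=> n; rewrite /= normr_ge0.
- by move=> n; rewrite (le_trans _ (av n)).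
- by move=> n; exact: av.
apply: nondecreasing_is_cvgn.
  by apply: nondecreasing_series => k _ _; rewrite (le_trans _ (av k)).
by exists B => _ [n _ <-]; rewrite seriesEord; exact: vB.
Qed.

Lemma dominated_csum u v B : dominated u v B -> csum u (cser u).
Proof.
move=> [uv vB]; suff [l h] : exists l, csum u l by rewrite (csum_cser h).
have ca : cvgn (series (fun k => complex.Re (u k))).
  by apply: real_sum_cvg vB => k; rewrite (le_trans (Re_le_normc _)).
have cb : cvgn (series (fun k => complex.Im (u k))).
  by apply: real_sum_cvg vB => k; rewrite (le_trans (Im_le_normc _)).
move/cvg_ex: ca => [a ca]; move/cvg_ex: cb => [b cb].
exists (a +i* b) => e e0; have e2 : 0 < e / 2 by rewrite divr_gt0.
have /cvgrPdist_lt/(_ _ e2)[N _ H] := ca.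
have /cvgrPdist_lt/(_ _ e2)[M _ K] := cb.
exists (maxn N M) => n; rewrite geq_max => /andP[/H /= Hn /K /= Kn].
rewrite normcB (le_lt_trans (normc_le_ReIm _))// [ltRHS]splitr.
rewrite !seriesEord in Hn Kn.
have -> : complex.Re (a +i* b - \sum_(k < n) u k) = a - \sum_(k < n) complex.Re (u k).
  by rewrite -Re_sum; case: (\sum_(_ < _) _).
have -> : complex.Im (a +i* b - \sum_(k < n) u k) = b - \sum_(k < n) complex.Im (u k).
  by rewrite -Im_sum; case: (\sum_(_ < _) _).
exact: ltrD.
Qed.

Lemma dominated_cser_le u v B : dominated u v B -> normc (cser u) <= B.
Proof.
move=> h; apply: ccvg_le (dominated_csum h) _ => n.
apply: le_trans (normc_sum _ _ _) _; apply: le_trans (h.2 n).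
by apply: ler_sum => k _; exact: h.1.
Qed.

Lemma csumD u u' l l' : csum u l -> csum u' l' -> csum (fun k => u k + u' k) (l + l').
Proof.
move=> h h'; apply: ccvg_ext (ccvgD h h') => n.
by rewrite big_split.
Qed.

Lemma csumZ u l c : csum u l -> csum (fun k => c * u k) (c * l).
Proof. by move=> h; apply: ccvg_ext (ccvgZ c h) => n; rewrite mulr_sumr. Qed.

Lemma csum_ext u u' l : (forall k, u k = u' k) -> csum u l -> csum u' l.
Proof. by move=> E; apply: ccvg_ext => n; apply: eq_bigr => k _. Qed.

Lemma csum_unique u l l' : csum u l -> csum u l' -> l = l'.
Proof. exact: ccvg_unique. Qed.

Lemma csum_delta (m : nat) (c : R[i]) : csum (fun k => if k == m then c else 0) c.
Proof.
move=> e e0; exists m.+1 => n mn.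
by rewrite -big_mkcond /= (big_ord1_eq _ (fun=> c)) mn subrr normc0.
Qed.

(** Dominated convergence for sums whose length grows with n, as for a product of n factors expanded
    into n fractions. The heads converge termwise, both tails are below e / 4. *)
Lemma tannery (f : nat -> nat -> R[i]) g v B :
  (forall n k, normc (f n k) <= v k) -> (forall n, \sum_(k < n) v k <= B) ->
  (forall k, ccvg (f^~ k) (g k)) ->
  csum g (cser g) /\ ccvg (fun n => \sum_(k < n) f n k) (cser g).
Proof.
move=> fv vB fg.
have gv k : normc (g k) <= v k by apply: ccvg_le (fg k) _.
have hg := dominated_csum (conj gv vB).
split=> // e e0; have e4 : 0 < e / 4 by rewrite divr_gt0.
have v0 k : 0 <= v k by rewrite (le_trans _ (gv k))// normc_ge0.
have [N HN] := bounded_sum_tail v0 vB e4.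
have [M HM] := hg _ e4.
have fin m : ccvg (fun n => \sum_(k < m) f n k) (\sum_(k < m) g k).
  elim: m => [|m IH].
    by apply: ccvg_ext (ccvg_cst _) => n; rewrite !big_ord0.
  rewrite big_ord_recr /=.
  by apply: ccvg_ext (ccvgD IH (fg m)) => n; rewrite big_ord_recr.
have [P HP] := fin N _ e4.
exists (maxn N (maxn M P)) => n; rewrite !geq_max => /and3P[Nn /HM Mn /HP Pn].
have tail (h : nat -> R[i]) : (forall k, normc (h k) <= v k) ->
    normc (\sum_(k < n) h k - \sum_(k < N) h k) < e / 4.
  move=> hv; rewrite -!(big_mkord xpredT h) (big_cat_nat (n := N) (leq0n N) Nn) /=.
  rewrite addrAC subrr add0r (le_lt_trans _ (HN n))// (le_trans (normc_sum _ _ _))//.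
  by apply: ler_sum.
have T1 := tail _ (fv n); have T2 := tail _ gv.
have := normc_dist_add (\sum_(k < n) f n k) (\sum_(k < N) f n k) (cser g).
have := normc_dist_add (\sum_(k < N) f n k) (\sum_(k < N) g k) (cser g).
have := normc_dist_add (\sum_(k < N) g k) (\sum_(k < n) g k) (cser g).
by rewrite (normcB (\sum_(k < N) g k) (\sum_(k < n) g k)); lra.
Qed.

(** The common majorant makes all tails uniformly small near [z], and the finite heads are
    continuous. *)
Lemma cser_ccont (f : nat -> R[i] -> R[i]) v B z :
  cnear z (fun w => forall k, normc (f k w) <= v k) ->
  (forall n, \sum_(k < n) v k <= B) ->
  (forall k, ccont (f k) z) ->
  ccont (fun w => cser (f^~ w)) z.
Proof.
move=> fv vB fc e e0; have e4 : 0 < e / 4 by rewrite divr_gt0.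
have v0 k : 0 <= v k.
  by rewrite (le_trans _ (cnear_self fv k))// normc_ge0.
have [N HN] := bounded_sum_tail v0 vB e4.
have tail w : (forall k, normc (f k w) <= v k) ->
    normc (cser (f^~ w) - \sum_(k < N) f k w) <= e / 4.
  move=> fw; have h := dominated_csum (conj fw vB).
  have h2 := ccvgD (ccvg_shift N h) (ccvg_cst (- \sum_(k < N) f k w)).
  apply: ccvg_le h2 _ => n /=.
  rewrite -!(big_mkord xpredT (f^~ w)) (big_cat_nat (n := N) (leq0n N) (leq_addl n N)) /=.
  rewrite addrAC subrr add0r ltW// (le_lt_trans _ (HN (n + N)%N))//.
  rewrite (le_trans (normc_sum _ _ _))//.
  by apply: ler_sum.
have fin : ccont (fun w => \sum_(k < N) f k w) z.
  elim: N {HN tail} => [|N IH].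
    apply: (@ccont_near _ (fun=> 0)); last exact: ccont_cst.
    by apply: cnearT => w; rewrite big_ord0.
  apply: (@ccont_near _ (fun w => \sum_(k < N) f k w + f N w)).
    by apply: cnearT => w; rewrite big_ord_recr.
  exact: ccontD.
apply: cnearS (cnearI fv (fin _ e4)) => w [/tail Tw Fw].
have Tz := tail z (cnear_self fv).
have := normc_dist_add (cser (f^~ w)) (\sum_(k < N) f k w) (cser (f^~ z)).
have := normc_dist_add (\sum_(k < N) f k w) (\sum_(k < N) f k z) (cser (f^~ z)).
by rewrite (normcB (\sum_(k < N) f k z) (cser _)); lra.
Qed.

End ComplexSums.

(** * Counting *)

(** Turns the cardinal in [zeros_with_mult] into a sum of booleans, which can be split by the parity
    of the index. *)
Lemma card_eq_count (P : pred nat) M : (forall n, (M <= n)%N -> ~~ P n) ->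
  ([set n | P n] #= `I_(\sum_(n < M) P n)%N)%card.
Proof.
elim: M P => [|M IH] P hP.
  rewrite big_ord0 (_ : [set n | P n] = set0) ?II0 ?card_eq00//.
  by apply/seteqP; split => n //= Pn; have := hP n (leq0n n); rewrite Pn.
rewrite big_ord_recr /=; have [PM|PM] := boolP (P M); last first.
  rewrite addn0; apply: IH => n; rewrite leq_eqVlt => /predU1P[<-//|]; exact: hP.
rewrite addn1; apply/eq_cardSP; exists M => //.
rewrite (_ : _ `\ M = [set n | P n && (n != M)]).
  rewrite (eq_bigr (fun n : 'I_M => (P n && (n != M :> nat)) : nat)); last first.
    by move=> n _; rewrite (ltn_eqF (ltn_ord n)) andbT.
  apply: (IH (fun n => P n && (n != M))) => n; rewrite leq_eqVlt => /predU1P[<-|Mn].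
    by rewrite eqxx andbF.
  by rewrite negb_and hP.
by apply/seteqP; split => n /= => [[Pn /eqP nM]|/andP[Pn /eqP nM]]; rewrite ?Pn.
Qed.

Lemma count_inj (T : eqType) (f : nat -> T) z M : injective f ->
  (forall j, (M <= j)%N -> f j != z) ->
  (\sum_(j < M) (f j == z) = `[< exists j, f j = z >])%N.
Proof.
move=> fi hM; case: asboolP => [[k fk]|nf]; last first.
  by rewrite big1// => j _; case: eqP => // E; case: nf; exists j.
have kM : (k < M)%N by rewrite ltnNge; apply/negP => /hM; rewrite fk eqxx.
rewrite (bigD1 (Ordinal kM))//= fk eqxx big1 // => j /eqP jk.
case: eqP => // E; case: jk; apply: val_inj => /=; apply: fi; by rewrite fk.
Qed.

Lemma big_even_odd (T : Type) (idx : T) (op : Monoid.com_law idx) (h : nat -> T) N :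
  \big[op/idx]_(n < 2 * N) h n =
  op (\big[op/idx]_(k < N) h (2 * k)%N) (\big[op/idx]_(k < N) h (2 * k).+1).
Proof.
elim: N => [|N IH]; first by rewrite !big_ord0 Monoid.mulm1.
by rewrite mulnS addnC addn2 !big_ord_recr /= IH -Monoid.mulmA Monoid.mulmACA !Monoid.mulmA.
Qed.

Lemma uniq_size_count (T : eqType) (f : nat -> T) z M (s : seq nat) : uniq s ->
  (forall j, (M <= j)%N -> f j != z) -> (forall j, j \in s -> f j = z) ->
  (size s <= \sum_(j < M) (f j == z))%N.
Proof.
move=> us hM hs.
have -> : (\sum_(j < M) (f j == z) = size [seq j <- iota 0 M | f j == z])%N.
  by rewrite size_filter -sum1_count [RHS]big_mkcond /=
    -(big_mkord xpredT (fun j => f j == z : nat)) /index_iota subn0;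
    apply: eq_bigr => j _; case: eqP.
apply: uniq_leq_size => // j js; rewrite mem_filter hs// eqxx mem_iota /= add0n ltnNge.
by apply/negP => /hM; rewrite hs// eqxx.
Qed.

(** * Partial fractions *)

Section PartialFractions.
Variables (R : realType) (mu : nat -> R[i]).
(** Quadratic gaps, as between the numbers (n pi)^2: the reciprocal distances to a given node are
    summable, with a bound common to all nodes. *)
Hypothesis mu_sep : forall j k, ((j - k + (k - j)) ^ 2)%N%:R <= normc (mu j - mu k).
Implicit Types (b d : nat -> R[i]) (z w : R[i]).

Lemma mu_inj j k : mu j = mu k -> j = k.
Proof.
move=> E; have := mu_sep j k; rewrite E subrr normc0 (_ : 0 = 0%N%:R)// ler_nat leqn0.
by rewrite expn_eq0 /= addn_eq0 !subn_eq0 andbT => H; apply/eqP; rewrite eqn_leq.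
Qed.

(** Far nodes recede from [z] quadratically by their separation from [mu 0], and finitely many
    remain for a minimum. One constant serves both as radius and as coefficient. *)
Lemma pole_distance z : exists2 c : R, 0 < c & forall k w, mu k != z ->
  normc (w - z) < c -> c * (k.+1)%:R ^+ 2 <= normc (w - mu k).
Proof.
suff [c c0 H] : exists2 c : R, 0 < c & forall k, mu k != z ->
    c * (k.+1)%:R ^+ 2 <= normc (z - mu k).
  (* Passing from [z] to [w] costs less than c / 2, which half of c (k + 1)^2 absorbs. *)
  exists (c / 2) => [|k w kz wz]; first by rewrite divr_gt0.
  have := normc_dist_add z w (mu k); have := H k kz; rewrite (normcB z w).
  have : 1 <= (k.+1)%:R ^+ 2 :> R by rewrite expr_ge1// ler1n.
  move: ((k.+1)%:R ^+ 2) => x; move: wz.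
  move: (normc (w - z)) (normc (w - mu k)) (normc (z - mu k)) => p q r; nra.
pose A := normc (mu 0%N - z).
(* For k >= 1 and k >= 2 A, k^2 - A >= k^2 / 2 >= (k + 1)^2 / 8; the index 0 falls below [N]. *)
have far k : A * 2 <= k%:R -> (k.+1)%:R ^+ 2 / 8 <= normc (z - mu k) \/ k = 0%N.
  case: k => [|k] kA; [by right|left].
  have k1 : 1 <= k.+1%:R :> R by rewrite ler1n.
  have := normc_dist_add (mu 0%N) z (mu k.+1); have := mu_sep 0%N k.+1.
  rewrite sub0n add0n subn0 natrX -(natr1 k.+1) -/A.
  move: kA k1; move: (k.+1%:R : R) (normc (mu 0%N - _)) (normc (z - _)) => x y t.
  nra.
have A0 : 0 <= A by exact: normc_ge0.
pose N := (Num.trunc (A * 2)).+1.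
have NA k : (N <= k)%N -> A * 2 <= k%:R.
  move=> Nk; apply: le_trans (ltW (truncnS_gt _)) _.
  by rewrite ler_nat.
have [c c0 Hc] : exists2 c : R, 0 < c & forall k, (k < N)%N -> mu k != z ->
    c * (k.+1)%:R ^+ 2 <= normc (z - mu k).
  elim: N {NA} => [|n [c c0 IH]]; first by exists 1.
  have n0 : 0 < n.+1%:R ^+ 2 :> R by rewrite exprn_gt0.
  have [E|E] := eqVneq (mu n) z.
    exists c => // k; rewrite ltnS leq_eqVlt => /predU1P[->|kn]; last exact: IH.
    by rewrite E eqxx.
  have m0 : 0 < normc (z - mu n) by rewrite normc_gt0 subr_eq0 eq_sym.
  exists (Num.min c (normc (z - mu n) / n.+1%:R ^+ 2)).
    by rewrite lt_min c0 divr_gt0.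
  move=> k; rewrite ltnS leq_eqVlt => /predU1P[-> _|kn kz].
    by rewrite -ler_pdivlMr// ge_min lexx orbT.
  by apply: le_trans (IH _ kn kz); rewrite ler_wpM2r ?exprn_ge0 ?ge_min ?lexx.
exists (Num.min c 8^-1) => [|k kz]; first by rewrite lt_min c0 invr_gt0 ltr0n.
have [kN|Nk] := ltnP k N.
  by apply: le_trans (Hc _ kN kz); rewrite ler_wpM2r ?exprn_ge0 ?ge_min ?lexx.
have [H|k0] := far k (NA _ Nk); last by move: Nk; rewrite k0.
by apply: le_trans H; rewrite mulrC ler_wpM2l ?exprn_ge0 ?ge_min ?lexx ?orbT.
Qed.

Lemma pole_isolated z : cnear z (fun w => w != z -> forall k, mu k != w).
Proof.
have [c c0 H] := pole_distance z; exists c => // w wz wz' k.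
have [->|kz] := eqVneq (mu k) z; first by rewrite eq_sym.
apply/negP => /eqP E; have := H k w kz wz; rewrite E subrr normc0 leNgt.
by rewrite mulr_gt0// exprn_gt0.
Qed.

Definition pf_weight (B c : R) k := B / c * inv_sq R k.+1.

Lemma pf_weight_sum B c : 0 <= B -> 0 < c -> forall n,
  \sum_(k < n) pf_weight B c k <= B / c * 2.
Proof.
move=> B0 c0 n; rewrite -mulr_sumr ler_wpM2l ?divr_ge0// ?(ltW c0)//.
by apply: le_trans (inv_sq_sum R n.+1); rewrite big_ord_recl /= add0r.
Qed.

Lemma pf_term_le (B c x : R) k : 0 <= B -> 0 < c ->
  c * (k.+1)%:R ^+ 2 <= x -> B / x <= pf_weight B c k.
Proof.
move=> B0 c0 cx; rewrite /pf_weight /= -mulrA -invfM ler_wpM2l// lef_pV2//.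
  by rewrite posrE (lt_le_trans _ cx)// mulr_gt0// exprn_gt0.
by rewrite posrE mulr_gt0// exprn_gt0.
Qed.

(** At [w = mu m] the m-th term is 0 by the convention on division, so the value at a node is the
    sum of the other terms. *)
Definition pf b w : R[i] := cser (fun k => b k / (w - mu k)).

Definition bounded_seq b := exists B : R, forall k, normc (b k) <= B.

Lemma bounded_seq_ge0 b : bounded_seq b ->
  exists2 B : R, 0 <= B & forall k, normc (b k) <= B.
Proof.
by move=> [B H]; exists B => //; rewrite (le_trans _ (H 0%N))// normc_ge0.
Qed.

(** One majorant for all [w] near [z]. A node at [z] does no harm if its coefficient is 0, or if
    [w = z], where its term is 0 by convention. *)
Lemma pf_dominated b z : bounded_seq b -> exists c B B' : R, [/\ 0 < c, 0 <= B,
  (forall k, normc (b k) <= B) &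
  forall w, normc (w - z) < c -> (forall k, mu k = z -> b k = 0 \/ w = z) ->
    dominated (fun k => b k / (w - mu k)) (pf_weight B c) B'].
Proof.
move=> /bounded_seq_ge0[B B0 bB]; have [c c0 H] := pole_distance z.
exists c, B, (B / c * 2); split => // w wz hz; split; last exact: pf_weight_sum.
move=> k; have [E|kz] := eqVneq (mu k) z.
  suff -> : b k / (w - mu k) = 0.
    by rewrite normc0 /pf_weight mulr_ge0 ?inv_sq_ge0// divr_ge0// ltW.
  by have [->|->] := hz k E; rewrite ?mul0r// E subrr invr0 mulr0.
rewrite normcM normcV; apply: le_trans (pf_term_le B0 c0 (H k w kz wz)).
by rewrite ler_wpM2r// invr_ge0 normc_ge0.
Qed.

Lemma pf_csum b w : bounded_seq b -> csum (fun k => b k / (w - mu k)) (pf b w).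
Proof.
move=> /(pf_dominated w)[c [B [B' [c0 B0 bB H]]]].
have ww : normc (w - w) < c by rewrite subrr normc0.
exact: dominated_csum (H w ww (fun _ _ => or_intror erefl)).
Qed.

Lemma pfD b d w : bounded_seq b -> bounded_seq d ->
  pf (fun k => b k + d k) w = pf b w + pf d w.
Proof.
move=> hb hd; apply: csum_cser.
apply: csum_ext (csumD (pf_csum w hb) (pf_csum w hd)) => k.
by rewrite mulrDl.
Qed.

Lemma pfZ b c w : bounded_seq b -> pf (fun k => c * b k) w = c * pf b w.
Proof.
move=> hb; apply: csum_cser; apply: csum_ext (csumZ c (pf_csum w hb)) => k.
by rewrite mulrA.
Qed.

Lemma bounded_seqD b d : bounded_seq b -> bounded_seq d ->
  bounded_seq (fun k => b k + d k).
Proof.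
move=> [B bB] [D dD]; exists (B + D) => k.
by rewrite (le_trans (normc_le_add _ _))// lerD.
Qed.

Lemma bounded_seqZ b c : bounded_seq b -> bounded_seq (fun k => c * b k).
Proof.
by move=> [B bB]; exists (normc c * B) => k; rewrite normcM ler_wpM2l ?normc_ge0.
Qed.

Definition drop_at b m k := if k == m then 0 else b k.

Lemma bounded_drop b m : bounded_seq b -> bounded_seq (drop_at b m).
Proof.
move=> /bounded_seq_ge0[B B0 bB]; exists B => k; rewrite /drop_at.
by case: eqP => // _; rewrite normc0.
Qed.

Lemma pf_drop b m w : bounded_seq b -> pf b w = b m / (w - mu m) + pf (drop_at b m) w.
Proof.
move=> hb; apply: csum_cser.
have := csumD (csum_delta m (b m / (w - mu m))) (pf_csum w (bounded_drop m hb)).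
apply: csum_ext => k; rewrite /drop_at; case: eqP => [->|_].
  by rewrite mul0r addr0.
by rewrite add0r.
Qed.

(** The difference quotient of the k-th term is [t k w], that is - b_k / ((z - mu_k) (w - mu_k)). As
    |z - mu_k| >= e off the node at [z], the majorant of [pf] divided by e makes the sum of these
    quotients continuous at [z]. *)
Lemma pf_cdiff b z : bounded_seq b -> (forall k, mu k = z -> b k = 0) -> cdiff (pf b) z.
Proof.
move=> hb bz; have [c [B [B' [c0 B0 bB H]]]] := pf_dominated z hb.
have [e e0 He] := pole_distance z.
pose t k w := - (b k / (z - mu k)) / (w - mu k).
have tE w : normc (w - z) < c -> csum (t^~ w) (cser (t^~ w)).
  move=> wc; apply: (@dominated_csum _ _ (fun k => e^-1 * pf_weight B c k) (e^-1 * B')).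
  have [H1 H2] := H w wc (fun k E => or_introl (bz k E)).
  split=> [k|n]; last first.
    rewrite -mulr_sumr ler_wpM2l ?invr_ge0 ?(ltW e0)//; exact: H2.
  have -> : t k w = - (z - mu k)^-1 * (b k / (w - mu k)).
    by rewrite /t; ring.
  have [E|E] := eqVneq (mu k) z.
    by rewrite bz// mul0r mulr0 normc0 mulr_ge0 ?invr_ge0 ?(ltW e0)// mulr_ge0 ?inv_sq_ge0// divr_ge0// ltW.
  rewrite normcM; apply: ler_pM; rewrite ?normc_ge0//.
  rewrite normcN normcV lef_pV2 ?posrE ?normc_gt0 ?subr_eq0 1?eq_sym//.
  have := He k z E; rewrite subrr normc0 => /(_ e0); apply: le_trans.
  by rewrite ler_peMr ?(ltW e0)// expr_ge1// ler1n.
exists (fun w => cser (t^~ w)).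
  apply: (@cser_ccont _ t (fun k => e^-1 * pf_weight B c k) (e^-1 * B')).
  - exists c => // w wc k.
    have [H1 _] := H w wc (fun k E => or_introl (bz k E)).
    have -> : t k w = - (z - mu k)^-1 * (b k / (w - mu k)).
      by rewrite /t; ring.
    have [E|E] := eqVneq (mu k) z.
      by rewrite bz// mul0r mulr0 normc0 mulr_ge0 ?invr_ge0 ?(ltW e0)// mulr_ge0 ?inv_sq_ge0// divr_ge0// ltW.
    rewrite normcM; apply: ler_pM; rewrite ?normc_ge0//.
    rewrite normcN normcV lef_pV2 ?posrE ?normc_gt0 ?subr_eq0 1?eq_sym//.
    have := He k z E; rewrite subrr normc0 => /(_ e0); apply: le_trans.
    by rewrite ler_peMr ?(ltW e0)// expr_ge1// ler1n.
  - have zc : normc (z - z) < c by rewrite subrr normc0.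
    have [_ H2] := H z zc (fun _ _ => or_intror erefl).
    by move=> n; rewrite -mulr_sumr ler_wpM2l ?invr_ge0 ?(ltW e0)//; exact: H2.
  - move=> k; have [E|E] := eqVneq (mu k) z.
      apply: (@ccont_near _ (fun=> 0)); last exact: ccont_cst.
      by apply: cnearT => w; rewrite /t bz// !(mul0r, oppr0).
    apply: ccontM; first exact: ccont_cst.
    apply: ccontV; last by rewrite subr_eq0 eq_sym.
    by apply: ccontB; [exact: ccont_id|exact: ccont_cst].
have far : cnear z (fun w => forall k, mu k != z -> mu k != w).
  exists e => // w we k kz; have := He k w kz we; apply: contraTneq => ->.
  by rewrite subrr normc0 -ltNge mulr_gt0// exprn_gt0.
have close : cnear z (fun w => normc (w - z) < c) by exists c.
apply: cnearS (cnearI far close) => w [farw wc].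
have h1 := csumD (pf_csum w hb) (csumZ (-1) (pf_csum z hb)).
have h2 := csumZ (w - z) (tE w wc).
rewrite mulN1r in h1; apply: csum_unique h1 _.
apply: csum_ext h2 => k; rewrite /t.
have [E|E] := eqVneq (mu k) z; first by rewrite bz// !(mul0r, oppr0, mulr0, addr0).
have := farw k E; rewrite -subr_eq0 => E'; rewrite -subr_eq0 in E.
have z1 : z - mu k != 0 by rewrite -oppr_eq0 opprB.
have w1 : w - mu k != 0 by rewrite -oppr_eq0 opprB.
field; exact/andP.
Qed.

End PartialFractions.

(** * Infinite products with factors 1 - x_j *)

Section InfiniteProducts.
Variable R : realType.
Implicit Types (x : nat -> R[i]) (v : nat -> R).

Lemma prod_1B_le x v (B : R) n : dominated x v B ->
  normc (\prod_(j < n) (1 - x j)) <= expR B.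
Proof.
move=> h; rewrite normc_prod; have [xv vB] := h.
apply: (@le_trans _ _ (expR (\sum_(j < n) v j))); last by rewrite ler_expR.
rewrite expR_sum ler_prod// => j _; rewrite normc_ge0 /=.
apply: le_trans (normc_le_sub _ _) _; rewrite normc1.
by apply: le_trans (expR_ge1Dx _); rewrite lerD2l.
Qed.

(** Weierstrass's product inequality; it will show that the tail of an infinite product does not
    vanish. *)
Lemma prod_1B_ge x v n : (forall j, normc (x j) <= v j) ->
  \sum_(j < n) v j <= 1 -> 1 - \sum_(j < n) v j <= normc (\prod_(j < n) (1 - x j)).
Proof.
move=> xv; have v0 j : 0 <= v j by rewrite (le_trans _ (xv j))// normc_ge0.
elim: n => [|n IH]; first by rewrite !big_ord0 normc1 subr0.
rewrite !big_ord_recr /= => s1; have sn : 0 <= \sum_(j < n) v j by rewrite sumr_ge0.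
have := v0 n => vn.
have s2 : \sum_(j < n) v j <= 1 by apply: le_trans s1; rewrite lerDl.
have v1 : v n <= 1 by apply: le_trans s1; rewrite lerDr.
have := IH s2; rewrite normcM; have := normc_ge_sub 1 (x n); rewrite normc1.
have := xv n; have := normc_ge0 (1 - x n).
move: (normc (1 - x n)) (normc (x n)) (normc (\prod_(_ < _) _)) => a b c a0 b1 b2 b3.
have : (1 - \sum_(j < n) v j) * (1 - v n) <= c * a.
  apply: ler_pM; [|lra|exact: b3|lra].
  by rewrite subr_ge0; exact: s2.
apply: le_trans; have := mulr_ge0 sn vn; lra.
Qed.

(** Consecutive partial products differ by - p_k x_k, so the product is 1 minus a series, majorised
    by exp(B) v. *)
Lemma prod_1B_cvg x v (B : R) : dominated x v B ->
  exists l, ccvg (fun n => \prod_(j < n) (1 - x j)) l.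
Proof.
move=> h; have [xv vB] := h.
pose p n := \prod_(j < n) (1 - x j).
have pE n : p n = 1 - \sum_(k < n) p k * x k.
  elim: n => [|n IH]; first by rewrite /p !big_ord0 subr0.
  by rewrite big_ord_recr /= opprD addrA -IH /p big_ord_recr /= mulrBr mulr1.
have hs : dominated (fun k => p k * x k) (fun k => expR B * v k) (expR B * B).
  split=> [k|n]; last by rewrite -mulr_sumr ler_wpM2l// expR_ge0.
  by rewrite normcM; apply: ler_pM; rewrite ?normc_ge0//; exact: prod_1B_le h.
exists (1 + -1 * cser (fun k => p k * x k)).
apply: ccvg_ext (ccvgD (ccvg_cst 1) (ccvgZ (-1) (dominated_csum hs))) => n.
by rewrite mulN1r -pE.
Qed.

End InfiniteProducts.

(** * The product with prescribed zeros and its expansion into partial fractions *)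

Section PartialFractionProducts.
Variables (R : realType) (mu : nat -> R[i]).
Hypothesis mu_sep : forall j k, ((j - k + (k - j)) ^ 2)%N%:R <= normc (mu j - mu k).
Implicit Types (b d ka : nat -> R[i]) (z w : R[i]).

(* The factor of index j is (w - mu j - ka j) / (w - mu j); at w = mu j it is 1,
   since division by 0 gives 0. *)
Definition qprod ka w n : R[i] := \prod_(j < n) (1 - ka j / (w - mu j)).

(** The factor of index k is 1 at [mu k], so [- ka k * qprod ka (mu k) n] is the residue of the
    rational function at [mu k]. A node may be inserted for [w] only if its factor is trivial. *)
Lemma qprod_pf ka w n : (forall k, (k < n)%N -> mu k = w -> ka k = 0) ->
  qprod ka w n = 1 - \sum_(k < n) ka k * qprod ka (mu k) n / (w - mu k).
Proof.
elim: n w => [|n IH] w h; first by rewrite /qprod !big_ord0 subr0.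
have qS v : qprod ka v n.+1 = qprod ka v n * (1 - ka n / (v - mu n)).
  by rewrite /qprod big_ord_recr.
have hn k : (k < n)%N -> mu k = w -> ka k = 0 by move=> kn; apply: h; exact: ltnW.
rewrite qS big_ord_recr /=.
have qn : qprod ka (mu n) n.+1 = qprod ka (mu n) n.
  by rewrite qS subrr invr0 mulr0 subr0 mulr1.
(* Here the new factor is 1. Otherwise [w] differs from [mu n], and the new pole is genuine. *)
have [kn0|kn0] := eqVneq (ka n) 0.
  rewrite kn0 !mul0r subr0 mulr1 addr0 IH//; congr (_ - _).
  by apply: eq_bigr => k _; rewrite qS kn0 mul0r subr0 mulr1.
have wn : w != mu n by apply: contra_neq kn0 => E; exact: h.
have Hn := IH (mu n); rewrite qn Hn; last first.
  by move=> k kn /(mu_inj mu_sep) E; rewrite E ltnn in kn.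
rewrite IH//.
(* Termwise, 1 / ((w - mu_k) (w - mu_n)) is split into simple fractions; the last sum is the one in
   the expansion of [qprod ka (mu n) n]. *)
have : \sum_(k < n) ka k * qprod ka (mu k) n / (w - mu k) =
    \sum_(k < n) ka k * qprod ka (mu k) n.+1 / (w - mu k) +
    ka n / (w - mu n) * (\sum_(k < n) ka k * qprod ka (mu k) n / (w - mu k)) -
    ka n / (w - mu n) * (\sum_(k < n) ka k * qprod ka (mu k) n / (mu n - mu k)).
  rewrite !mulr_sumr -big_split /= -sumrB; apply: eq_bigr => k _; rewrite qS.
  have [E|E] := eqVneq (ka k) 0; first by rewrite E; ring.
  have wk : w - mu k != 0.
    by rewrite subr_eq0 eq_sym; apply: contra_neq E => ?; exact: hn.
  have kn : mu k - mu n != 0.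
    rewrite subr_eq0; apply/eqP => /(mu_inj mu_sep) kE.
    by have := ltn_ord k; rewrite kE ltnn.
  have nk : mu n - mu k != 0 by rewrite -oppr_eq0 opprB.
  have wn' : w - mu n != 0 by rewrite subr_eq0.
  by field; rewrite wk wn' nk kn.
set s := \sum_(k < n) _; set s1 := \sum_(k < n) _; set s2 := \sum_(k < n) _ => E.
rewrite mulrBr mulr1 {1}E; ring.
Qed.

Definition qlim ka w : R[i] := xget 0 [set l | ccvg (qprod ka w) l].

Lemma qlimP ka w : bounded_seq ka -> ccvg (qprod ka w) (qlim ka w).
Proof.
move=> /(pf_dominated mu_sep w)[c [B [B' [c0 B0 bB H]]]].
have ww : normc (w - w) < c by rewrite subrr normc0.
have [l hl] := prod_1B_cvg (H w ww (fun _ _ => or_intror erefl)).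
by rewrite /qlim; case: xgetP => [x _ //|/(_ l)/(_ hl)].
Qed.

Lemma dist2_le j k : j <> k -> (normc (mu j - mu k))^-1 <= dist2 R j k.
Proof.
move=> jk; have n0 : (0 < j - k + (k - j))%N by lia.
rewrite /dist2; case: (_ + _)%N n0 (mu_sep j k) => //= n _ H.
rewrite lef_pV2 ?posrE ?exprn_gt0//; first by rewrite -natrX.
by rewrite (lt_le_trans _ H)// ltr0n expn_gt0.
Qed.

(** The bound does not depend on the node, by [dist2_sum]; hence the residues are dominated by a
    constant multiple of [ka]. *)
Lemma qprod_pole_le ka (B : R) k n : 0 <= B -> (forall j, normc (ka j) <= B) ->
  normc (qprod ka (mu k) n) <= expR (B * 4).
Proof.
move=> B0 kB; apply: (@prod_1B_le _ (fun j => ka j / (mu k - mu j)) (fun j => B * dist2 R j k)).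
split=> [j|m]; last by rewrite -mulr_sumr ler_wpM2l// dist2_sum.
have [->|/eqP jk] := eqVneq j k.
  by rewrite subrr invr0 mulr0 normc0 mulr_ge0// inv_sq_ge0.
by rewrite normcM normcV normcB ler_pM ?normc_ge0 ?invr_ge0 ?normc_ge0// dist2_le.
Qed.

(** Minus the residue of the infinite product at [mu k], where the singular factor counts as 1. *)
Definition residues ka k := ka k * qlim ka (mu k).

Lemma residues_le ka (B : R) : (forall j, normc (ka j) <= B) ->
  forall k, normc (residues ka k) <= expR (B * 4) * normc (ka k).
Proof.
move=> kB k; have B0 : 0 <= B by rewrite (le_trans _ (kB 0%N))// normc_ge0.
rewrite /residues normcM mulrC ler_wpM2r ?normc_ge0//.
have hk : bounded_seq ka by exists B.
by apply: ccvg_le (qlimP (mu k) hk) _ => n; exact: qprod_pole_le.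
Qed.

Lemma bounded_residues ka : bounded_seq ka -> bounded_seq (residues ka).
Proof.
move=> /bounded_seq_ge0[B B0 kB]; exists (expR (B * 4) * B) => k.
by apply: le_trans (residues_le kB k) _; rewrite ler_wpM2l// expR_ge0.
Qed.

Lemma qlim_pf ka w : bounded_seq ka -> (forall k, mu k = w -> ka k = 0) ->
  qlim ka w = 1 - pf mu (residues ka) w.
Proof.
move=> hk hw; have [B B0 kB] := bounded_seq_ge0 hk.
(* The majorant for [tannery]: the partial products at the nodes are at most exp(4 B). *)
have hE : bounded_seq (fun k => (expR (B * 4))%:C * ka k) by exact: bounded_seqZ.
have [c [D [D' [c0 D0 bD H]]]] := pf_dominated mu_sep w hE.
have ww : normc (w - w) < c by rewrite subrr normc0.
have [H1 H2] := H w ww (fun _ _ => or_intror erefl).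
have := @tannery _ (fun n k => ka k * qprod ka (mu k) n / (w - mu k))
  (fun k => residues ka k / (w - mu k)) _ _ _ H2.
case=> [n k|k|_ h].
- apply: le_trans (H1 k); rewrite !normcM ler_wpM2r ?normc_ge0//.
  rewrite mulrC ler_wpM2r ?normc_ge0// normc_real ger0_norm ?expR_ge0//.
  exact: qprod_pole_le.
- have := ccvgZ (ka k / (w - mu k)) (qlimP (mu k) hk).
  rewrite /residues mulrAC; apply: ccvg_ext => n.
  by rewrite mulrAC.
- have h2 := ccvgD (ccvg_cst 1) (ccvgZ (-1) h).
  rewrite mulN1r in h2; apply: ccvg_unique (qlimP w hk) _.
  by apply: ccvg_ext h2 => n; rewrite mulN1r -qprod_pf// => k _; exact: hw.
Qed.

Definition tail_seq ka N j : R[i] := if (j < N)%N then 0 else ka j.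

Lemma bounded_tail ka N : bounded_seq ka -> bounded_seq (tail_seq ka N).
Proof.
move=> /bounded_seq_ge0[B B0 bB]; exists B => k; rewrite /tail_seq.
by case: ifP => // _; rewrite normc0.
Qed.

(** Splits off finitely many factors, which carry all zeros and poles at a given point, from a tail
    that is close to 1 there. *)
Lemma qlim_tail ka N w : bounded_seq ka ->
  qlim ka w = qprod ka w N * qlim (tail_seq ka N) w.
Proof.
move=> hk; have h := ccvgZ (qprod ka w N) (qlimP w (bounded_tail N hk)).
apply: ccvg_unique (ccvg_shift N (qlimP w hk)) _.
apply: ccvg_ext (ccvg_shift N h) => n.
rewrite /qprod -!(big_mkord xpredT (fun j => 1 - _ j / (w - mu j))).
rewrite [in RHS](big_cat_nat (n := N)) ?leq_addl//=; congr (_ * _).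
rewrite (big_cat_nat (n := N)) ?leq_addl//= big_nat_cond big1 ?mul1r; last first.
  by move=> j /andP[/andP[_ jN] _]; rewrite /tail_seq jN mul0r subr0.
rewrite big_nat_cond [RHS]big_nat_cond; apply: eq_bigr => j /andP[/andP[Nj _] _].
by rewrite /tail_seq ltnNge Nj.
Qed.

Lemma cdiff_prod (I : Type) (r : seq I) (F : I -> R[i] -> R[i]) w :
  (forall i, cdiff (F i) w) -> cdiff (fun x => \prod_(i <- r) F i x) w.
Proof.
move=> H; elim: r => [|i r IH].
  apply: (@cdiff_near _ (fun=> 1)); last exact: cdiff_cst.
  by apply: cnearT => x; rewrite big_nil.
apply: (@cdiff_near _ (fun x => F i x * \prod_(i <- r) F i x)).
  by apply: cnearT => x; rewrite big_cons.
exact: cdiffM.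
Qed.

(* Both exponents are counts below N, so that poles and zeros at z cancel. *)
Lemma pf_zeros ka z : bounded_seq ka -> exists N0 : nat,
  (forall j, (N0 <= j)%N -> mu j != z /\ mu j + ka j != z) /\
  forall N, (N0 <= N)%N -> exists G : R[i] -> R[i],
  [/\ G z != 0, cnear z (cdiff G) & cnear z (fun w => w != z ->
    (w - z) ^+ (\sum_(j < N) (mu j == z))%N * (1 - pf mu (residues ka) w) =
    (w - z) ^+ (\sum_(j < N) ((mu j + ka j)%R == z))%N * G w)].
Proof.
move=> hk; have [c [B [B' [c0 B0 bB H]]]] := pf_dominated mu_sep z hk.
have v0 j : 0 <= pf_weight B c j by rewrite mulr_ge0 ?inv_sq_ge0// divr_ge0// ltW.
have [H1 H2] : dominated (fun k => ka k / (z - mu k)) (pf_weight B c) B'.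
  by apply: H; rewrite ?subrr ?normc0// => *; right.
(* Beyond [N1] the terms |ka_k / (z - mu_k)| sum to less than 1/2, so the tail product is at least
   1/2 in modulus at [z]. *)
have [N1 HN1] := bounded_sum_tail v0 H2 (e := 1 / 2) ltac:(lra).
have [N2 HN2] : exists N2, forall j, (N2 <= j)%N -> mu j != z.
  have [[m <-]|h] := pselect (exists m, mu m = z).
    by exists m.+1 => j mj; apply/eqP => /(mu_inj mu_sep) E; rewrite E ltnn in mj.
  by exists 0%N => j _; apply/eqP => E; apply: h; exists j.
exists (maxn N1 N2); split=> [j|N].
  rewrite geq_max => /andP[N1j N2j]; have jz := HN2 _ N2j; split=> //.
  apply/eqP => E; have := H1 j.
  (* A late factor vanishing at [z] would contribute a term of modulus 1 to a sum below 1/2. *)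
  have -> : ka j = z - mu j by rewrite -E addrAC subrr add0r.
  rewrite divff ?subr_eq0 1?eq_sym// normc1 => H3.
  have := HN1 j.+1; rewrite big_nat_recr//= => H4.
  have : 0 <= \sum_(N1 <= i < j) pf_weight B c i by rewrite sumr_ge0.
  lra.
rewrite geq_max => /andP[N1N N2N].
(* [A] and [D] collect the numerators and denominators of the first [N] factors, without those that
   are powers of w - z. *)
pose A w := \prod_(j < N) (if mu j + ka j == z then 1 else w - (mu j + ka j)).
pose D w := \prod_(j < N) (if mu j == z then 1 else (w - mu j)^-1).
pose b' := residues (tail_seq ka N).
have hk' := bounded_tail N hk; have hb' := bounded_residues hk'.
have kz k : mu k = z -> tail_seq ka N k = 0.
  by rewrite /tail_seq; case: ltnP => // Nk E; have := HN2 k (leq_trans N2N Nk); rewrite E eqxx.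
have bz k : mu k = z -> b' k = 0 by move=> E; rewrite /b' /residues kz// mul0r.
exists (fun w => A w * D w * (1 - pf mu b' w)); split.
- rewrite !mulf_neq0//.
  + by apply/prodf_neq0 => j _; case: ifPn => [_|?]; rewrite ?oner_eq0// subr_eq0 eq_sym.
  + by apply/prodf_neq0 => j _; case: ifPn => [_|?]; rewrite ?oner_eq0// invr_eq0 subr_eq0 eq_sym.
  rewrite /b' -qlim_pf// -normc_gt0; apply: (@lt_le_trans _ _ (1 / 2)); first by lra.
  apply: ccvg_ge (qlimP z hk') _ => n.
  pose v' j := if (j < N)%N then 0 else pf_weight B c j.
  have v'h n' : \sum_(j < n') v' j <= 1 / 2.
    apply: le_trans (ltW (HN1 n')); rewrite -(big_mkord xpredT v').
    have [nN|Nn] := leqP n' N.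
      by rewrite big_nat_cond big1 ?sumr_ge0// => j /andP[/andP[_ jn] _]; rewrite /v' (leq_trans jn nN).
    rewrite (big_cat_nat (n := N)) ?(ltnW Nn)//= big_nat_cond big1 ?add0r; last first.
      by move=> j /andP[/andP[_ jN] _]; rewrite /v' jN.
    rewrite [leRHS](big_cat_nat (n := N)) ?(ltnW Nn)//=.
    rewrite ler_wpDl ?sumr_ge0// big_nat_cond [leRHS]big_nat_cond ler_sum// => j /andP[/andP[Nj _] _].
    by rewrite /v' ltnNge Nj.
  have P : 1 - \sum_(j < n) v' j <= normc (qprod (tail_seq ka N) z n).
    apply: (@prod_1B_ge _ (fun j => tail_seq ka N j / (z - mu j)) v'); last by have := v'h n; lra.
    by move=> j; rewrite /v' /tail_seq; case: ifP => // _; rewrite mul0r normc0.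
  by have := v'h n; lra.
- have [e e0 He] := pole_isolated mu_sep z; exists e => // w we.
  apply: cdiffM; first apply: cdiffM.
  + apply: (@cdiff_prod _ _ (fun (j : 'I_N) w => if mu j + ka j == z then 1 else w - (mu j + ka j))) => j.
    case: (_ == z); first exact: cdiff_cst.
    by apply: cdiffB; [exact: cdiff_id|exact: cdiff_cst].
  + apply: (@cdiff_prod _ _ (fun (j : 'I_N) w => if mu j == z then 1 else (w - mu j)^-1)) => j.
    case: (eqVneq (mu j) z) => [_|jz]; first exact: cdiff_cst.
    apply: cdiffV; first by apply: cdiffB; [exact: cdiff_id|exact: cdiff_cst].
    have [->|wz] := eqVneq w z; first by rewrite subr_eq0 eq_sym.
    by rewrite subr_eq0 eq_sym He.
  + apply: cdiffB; first exact: cdiff_cst.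
    apply: pf_cdiff => // k; have [->|wz] := eqVneq w z; first exact: bz.
    by move/eqP; rewrite (negbTE (He w we wz k)).
- apply: cnearS (pole_isolated mu_sep z) => w hw wz; have {}hw := hw wz.
  have wz0 : w - z != 0 by rewrite subr_eq0.
  have nopole (k' : nat -> R[i]) k : mu k = w -> k' k = 0.
    by move/eqP; rewrite (negbTE (hw k)).
  rewrite -qlim_pf//; last exact: nopole.
  rewrite (qlim_tail N w hk) (qlim_pf hk'); last exact: nopole.
  rewrite !mulrA; congr (_ * _).
  (* The powers of w - z are distributed over the factors, so that each index is settled on its
     own. *)
  rewrite !expr_sum /qprod /A /D -!big_split /=; apply: eq_bigr => j _.
  have wj : w - mu j != 0 by rewrite subr_eq0 eq_sym hw.
  have -> : 1 - ka j / (w - mu j) = (w - (mu j + ka j)) / (w - mu j) by field.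
  case: (eqVneq (mu j) z) => [E|_]; case: (eqVneq (mu j + ka j) z) => [E'|_].
  + by rewrite E' E !expr1 divff// !mulr1.
  + by rewrite E !expr1 expr0 mul1r mulr1 mulrCA divff// mulr1.
  + by rewrite E' expr0 expr1 mul1r mulr1.
  + by rewrite /= !mul1r.
Qed.

End PartialFractionProducts.

(** * A sum of simple fractions is determined by its zeros *)

Section PartialFractionUniqueness.
Variables (R : realType) (mu : nat -> R[i]).
Hypothesis mu_sep : forall j k, ((j - k + (k - j)) ^ 2)%N%:R <= normc (mu j - mu k).
Implicit Types (b d la : nat -> R[i]) (z w : R[i]).

Definition is_pole z : bool := `[< exists k, mu k = z >].

Lemma is_poleP z : reflect (exists k, mu k = z) (is_pole z).
Proof. exact: asboolP. Qed.

(* For f of the form pf mu d, this says that f times a simple pole factor at the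
   nodes vanishes at z to order at least l. *)
Definition vanishes f z (l : nat) := exists B : R, cnear z (fun w => w != z ->
  normc (f w) * normc (w - z) ^+ is_pole z <= B * normc (w - z) ^+ l).

Lemma ccont_vanish f z (B : R) : ccont f z ->
  cnear z (fun w => w != z -> normc (f w) <= B * normc (w - z)) -> f z = 0.
Proof.
move=> cf H; apply/eqP; rewrite -normc_eq0; apply: contraT => f0.
have {}f0 : 0 < normc (f z) by rewrite lt_def f0 normc_ge0.
have B0 : 0 < `|B| + 1 by rewrite ltr_wpDl.
have e0 : 0 < normc (f z) / 2 by rewrite divr_gt0.
have d1 : 0 < normc (f z) / 2 / (`|B| + 1) by rewrite divr_gt0.
have [d d0 K] := cnearI H (cf _ e0).
pose r := Num.min (d / 2) (normc (f z) / 2 / (`|B| + 1)).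
have r0 : 0 < r by rewrite lt_min divr_gt0.
have rd : r < d.
  by rewrite (@le_lt_trans _ _ (d / 2)) ?ge_min ?lexx// ltr_pdivrMr// ltr_pMr// ltr1n.
have zr : (z + r%:C) - z = r%:C by rewrite addrC addKr.
have zr' : z + r%:C != z by rewrite -subr_eq0 zr -normc_eq0 normc_real normr_eq0 gt_eqF.
have := K (z + r%:C); rewrite zr normc_real ger0_norm ?(ltW r0)// => /(_ rd)[/(_ zr') H1 H2].
have : B * r <= normc (f z) / 2.
  apply: (@le_trans _ _ ((`|B| + 1) * r)).
    by rewrite ler_wpM2r ?(ltW r0)// (le_trans (ler_norm _))// lerDl.
  by rewrite mulrC -ler_pdivlMr// ge_min lexx orbT.
have := normc_ge_sub (f z) (f (z + r%:C)); rewrite normcB in H2; lra.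
Qed.

(** Multiplied by w - mu_m, the sum extends continuously to [mu m] with value [d m], while the
    hypothesis makes it O(|w - mu_m|). *)
Lemma vanish_pole d m : bounded_seq d -> vanishes (pf mu d) (mu m) 1 -> d m = 0.
Proof.
move=> hd [B H].
have pm : is_pole (mu m) by apply/is_poleP; exists m.
pose f w := d m + (w - mu m) * pf mu (drop_at d m) w.
have cf : ccont f (mu m).
  apply: ccontD; first exact: ccont_cst.
  apply: ccontM; first by apply: ccontB; [exact: ccont_id|exact: ccont_cst].
  apply/cdiff_cont/pf_cdiff => //; first exact: bounded_drop.
  by move=> k /(mu_inj mu_sep) ->; rewrite /drop_at eqxx.
have := @ccont_vanish f (mu m) B cf; rewrite {2}/f subrr mul0r addr0; apply.
apply: cnearS H => w H wm; have := H wm; rewrite pm expr1 -normcM.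
have wm0 : w - mu m != 0 by rewrite subr_eq0.
by rewrite (pf_drop mu_sep m w) // mulrDl mulfVK// [_ * (w - _)]mulrC.
Qed.

Lemma vanish_nonpole d z : bounded_seq d -> ~~ is_pole z -> vanishes (pf mu d) z 1 ->
  pf mu d z = 0.
Proof.
move=> hd pz [B H]; apply: (@ccont_vanish _ z B).
  apply/cdiff_cont/pf_cdiff => // k kz.
  by move/negP: pz; case; apply/is_poleP; exists k.
by apply: cnearS H => w H wz; have := H wz; rewrite (negbTE pz) expr0 mulr1 expr1.
Qed.

(** A value taken several times by [la] must be a zero of at least that order; lists of distinct
    indices express this without counting occurrences. *)
Definition vanishes_on d la := forall z (s : seq nat), uniq s ->
  (forall j, j \in s -> la j = z) -> vanishes (pf mu d) z (size s).

Lemma vanish_close d la : bounded_seq d -> (forall j, normc (la j - mu j) <= 16^-1) ->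
  vanishes_on d la -> forall j, d j = 0.
Proof.
move=> hd hla van.
suff half (B : R) : (forall j, normc (d j) <= B) -> forall j, normc (d j) <= B / 2.
  have [B B0 dB] := bounded_seq_ge0 hd.
  have Hn n : forall j, normc (d j) <= B / 2 ^+ n.
    elim: n => [|n IH] j; first by rewrite expr0 divr1.
    by rewrite exprSr invfM mulrA; exact: half.
  move=> j; apply/eqP; rewrite -normc_eq0; apply: contraT => dj.
  have {}dj : 0 < normc (d j) by rewrite lt_def dj normc_ge0.
  pose n := (Num.trunc (B / normc (d j))).+1.
  have : B / normc (d j) < n%:R by exact: truncnS_gt.
  have := Hn n j; rewrite ler_pdivlMr ?exprn_gt0// ltr_pdivrMr//.
  have : n%:R <= 2 ^+ n :> R by rewrite -natrX ler_nat ltnW// ltn_expl.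
  nra.
move=> dB j; have B0 : 0 <= B by rewrite (le_trans _ (dB 0%N))// normc_ge0.
have vj : vanishes (pf mu d) (la j) 1.
  by apply: (van _ [:: j]) => // i; rewrite inE => /eqP ->.
have [E|E] := eqVneq (la j) (mu j).
  by rewrite E in vj; rewrite (vanish_pole hd vj) normc0 divr_ge0.
(* Moving from [mu j] to [la j] costs at most 1/16, which at worst halves a distance between
   distinct nodes. *)
have far k : k != j -> (normc (la j - mu k))^-1 <= 2 * dist2 R k j.
  move=> kj; have n0 : (0 < k - j + (j - k))%N by move/eqP: kj; lia.
  rewrite /dist2; case: (_ + _)%N n0 (mu_sep k j) => //= n _ H.
  rewrite -[2]invrK -invfM lef_pV2 ?posrE ?mulr_gt0 ?invr_gt0 ?exprn_gt0//.
    have := normc_dist_add (mu k) (la j) (mu j); have := hla j.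
    rewrite (normcB (mu k) (la j)); rewrite natrX in H.
    have : 1 <= n.+1%:R ^+ 2 :> R by rewrite expr_ge1// ler1n.
    lra.
  have := normc_dist_add (mu k) (la j) (mu j); have := hla j.
  rewrite (normcB (mu k) (la j)); rewrite natrX in H.
  have : 1 <= n.+1%:R ^+ 2 :> R by rewrite expr_ge1// ler1n.
  lra.
have np : ~~ is_pole (la j).
  apply/is_poleP => -[k kE]; have [kj|kj] := eqVneq k j.
    by move: E; rewrite -kE kj eqxx.
  have n0 : (0 < k - j + (j - k))%N by move/eqP: kj; lia.
  have := hla j; rewrite -kE; have := mu_sep k j.
  move: n0; rewrite -(ltr0n R) => _ H.
  have : 1 <= ((k - j + (j - k)) ^ 2)%N%:R :> R.
    by rewrite ler1n expn_gt0; move/eqP: kj; lia.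
  lra.
(* The vanishing at [la j] expresses [d j] as - (la j - mu j) times the sum over the other nodes.
   That sum is at most 2 * 4 * B, and the factor 1/16 leaves B / 2. *)
have := vanish_nonpole hd np vj.
rewrite (pf_drop mu_sep j _) // => /eqP; rewrite addr_eq0 => /eqP dE.
have lj : la j - mu j != 0 by rewrite subr_eq0.
have -> : d j = - (la j - mu j) * pf mu (drop_at d j) (la j).
  by rewrite mulNr -mulrN -dE mulrC mulfVK.
rewrite normcM normcN.
have Q : normc (pf mu (drop_at d j) (la j)) <= B * 2 * 4.
  apply: (@dominated_cser_le _ _ (fun k => B * 2 * dist2 R k j)).
  split=> [k|n]; last by rewrite -mulr_sumr ler_wpM2l ?mulr_ge0// dist2_sum.
  rewrite /drop_at; have [->|kj] := eqVneq k j.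
    by rewrite mul0r normc0 !mulr_ge0// inv_sq_ge0.
  by rewrite normcM normcV -mulrA ler_pM ?normc_ge0 ?invr_ge0 ?normc_ge0// far.
have := ler_pM (normc_ge0 _) (normc_ge0 _) (hla j) Q.
move/le_trans; apply; lra.
Qed.

Lemma vanishesW f z l l' : (l <= l')%N -> vanishes f z l' -> vanishes f z l.
Proof.
move=> ll [B H]; exists (`|B|).
have one : cnear z (fun w => normc (w - z) < 1) by exists 1.
apply: cnearS (cnearI one H) => w [w1 H'] wz; apply: le_trans (H' wz) _.
have n0 := normc_ge0 (w - z).
apply: (@le_trans _ _ (`|B| * normc (w - z) ^+ l')).
  by rewrite ler_wpM2r ?exprn_ge0// ler_norm.
by rewrite ler_wpM2l//; apply: ler_wiXn2l => //; exact: ltW.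
Qed.

(** The coefficients of the quotient of [pf mu d w] by z - w, for a sum that vanishes at [z]. If [z]
    is a node, its own coefficient in [d] is 0 and the value of the sum at [z] creates a new residue
    there. *)
Definition pf_quot d z k : R[i] :=
  if mu k == z then - pf mu d z else d k / (z - mu k).

Lemma bounded_quot d z : bounded_seq d -> bounded_seq (pf_quot d z).
Proof.
move=> /bounded_seq_ge0[B B0 dB]; have [c c0 H] := pole_distance mu_sep z.
exists (Num.max (normc (pf mu d z)) (B / c)) => k; rewrite /pf_quot le_max.
have [_|kz] := eqVneq; first by rewrite normcN lexx.
rewrite normcM normcV ler_pM ?normc_ge0 ?invr_ge0 ?normc_ge0 ?orbT//.
have := H k z kz; rewrite subrr normc0 => /(_ c0) H2.
rewrite lef_pV2 ?posrE// ?normc_gt0 ?subr_eq0 1?eq_sym//.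
by apply: le_trans H2; rewrite ler_peMr ?(ltW c0)// expr_ge1// ler1n.
Qed.

Lemma pf_quotE d z w : bounded_seq d -> vanishes (pf mu d) z 1 ->
  (forall k, mu k != w) -> w != z -> pf mu d w = - (w - z) * pf mu (pf_quot d z) w.
Proof.
move=> hd vz nw wz.
have h1 := csumD (pf_csum mu_sep w hd) (csumZ (-1) (pf_csum mu_sep z hd)).
have h2 := csumZ (- (w - z)) (pf_csum mu_sep w (bounded_quot z hd)).
have [/is_poleP[m mz]|np] := boolP (is_pole z).
  subst z; have dm := vanish_pole hd vz.
  have h3 := csumD h1 (csum_delta m (pf mu d (mu m))).
  rewrite mulN1r subrK in h3; apply: csum_unique h3 _; apply: csum_ext h2 => k.
  rewrite /pf_quot (inj_eq (mu_inj mu_sep)).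
  have wk : w - mu k != 0 by rewrite subr_eq0 eq_sym.
  case: eqVneq => [->|km]; first by rewrite dm subrr invr0; field; rewrite subr_eq0 eq_sym.
  have mk : mu m - mu k != 0.
    by rewrite subr_eq0 eq_sym; apply: contra_neq km => /(mu_inj mu_sep).
  by field; rewrite wk mk.
rewrite (vanish_nonpole hd np vz) mulr0 addr0 in h1.
apply: csum_unique h1 _; apply: csum_ext h2 => k.
have wk : w - mu k != 0 by rewrite subr_eq0 eq_sym.
rewrite /pf_quot ifF; last by apply/negP => /eqP kz; move/negP: np; case; apply/is_poleP; exists k.
have mk : z - mu k != 0.
  by rewrite subr_eq0; apply/negP => /eqP kz; move/negP: np; case; apply/is_poleP; exists k.
by field; rewrite wk mk.
Qed.

Lemma vanishes_mul f g h z l l' : vanishes f z l ->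
  (exists C : R, cnear z (fun w => w != z ->
     normc (g w) * normc (w - z) ^+ l <= C * normc (w - z) ^+ l')) ->
  cnear z (fun w => w != z -> h w = f w * g w) -> vanishes h z l'.
Proof.
move=> [B HB] [C HC] fgh; exists (`|B| * C).
apply: cnearS (cnearI HB (cnearI HC fgh)) => w [{}HB [{}HC {}fgh]] wz.
rewrite fgh// normcM mulrAC.
apply: le_trans (ler_wpM2r (normc_ge0 _) (HB wz)) _.
rewrite -!mulrA; apply: (@le_trans _ _ (`|B| * (normc (w - z) ^+ l * normc (g w)))).
  by rewrite ler_wpM2r ?mulr_ge0 ?exprn_ge0 ?normc_ge0// ler_norm.
by rewrite ler_wpM2l// mulrC HC.
Qed.

Lemma pf_unique d la N : bounded_seq d ->
  (forall j, (N <= j)%N -> normc (la j - mu j) <= 16^-1) ->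
  vanishes_on d la -> forall j, d j = 0.
Proof.
elim: N d la => [|N IH] d la hd hla van.
  by apply: (vanish_close hd) van => j; exact: hla.
(* The zero [z] is moved to the node [mu N], which leaves one index fewer with a possibly large
   shift. *)
pose z := la N; pose la' j := if j == N then mu N else la j.
have hla' j : (N <= j)%N -> normc (la' j - mu j) <= 16^-1.
  rewrite /la' leq_eqVlt => /predU1P[<-|Nj].
    by rewrite eqxx subrr normc0 invr_ge0.
  by rewrite gtn_eqF//; exact: hla.
have [zN|zN] := eqVneq z (mu N).
  apply: (IH d la') => // w s us sw; apply: van => // j js.
  by rewrite -(sw j js) /la'; case: eqP => // ->.
have vz : vanishes (pf mu d) z 1.
  by apply: (van _ [:: N]) => // i; rewrite inE => /eqP ->.
pose nu := mu N.
(* These are the coefficients of the sum multiplied by (w - nu) / (w - z) = 1 + (z - nu) / (w -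
   z). *)
pose d' k := d k + (- (z - nu)) * pf_quot d z k.
have hq := bounded_quot z hd.
have hd' : bounded_seq d' by apply: bounded_seqD => //; exact: bounded_seqZ.
have d'E w : (forall k, mu k != w) -> w != z -> pf mu d' w = pf mu d w * ((w - nu) / (w - z)).
  move=> nw wz; have wz0 : w - z != 0 by rewrite subr_eq0.
  rewrite (pfD mu_sep)//; last exact: bounded_seqZ.
  by rewrite (pfZ mu_sep)// (pf_quotE hd vz nw wz); field.
have d'0 : forall j, d' j = 0.
  apply: (IH d' la') => // z' s us sz'.
  have one : cnear z' (fun w => normc (w - z') < 1) by exists 1.
  have bnd w : normc (w - z') < 1 -> normc (w - nu) <= 1 + normc (z' - nu).
    by move=> w1; have := normc_dist_add w z' nu; lra.
  (* At [z] the multiplier costs one order, but [N] is no longer attached to [z], so the list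
     extended by [N] provides one order more. *)
  have [bd|bd] := eqVneq z' z.
    subst z'; have Ns : N \notin s.
      by apply/negP => /sz'; rewrite /la' eqxx => E; rewrite E eqxx in zN.
    have {}van : vanishes (pf mu d) z (size s).+1.
      apply: (van z (N :: s)) => /= [|j]; first by rewrite Ns.
      rewrite inE => /predU1P[->//|js]; rewrite -(sz' j js) /la'.
      by case: eqP js Ns => // -> ->.
    apply: (vanishes_mul van (g := fun w => (w - nu) / (w - z))).
      exists (1 + normc (z - nu)); apply: cnearS one => w w1 wz.
      rewrite normcM normcV exprS mulrA divfK ?normc_eq0 ?subr_eq0//.
      by rewrite ler_wpM2r ?exprn_ge0 ?normc_ge0// bnd.
    by apply: cnearS (pole_isolated mu_sep z) => w nw wz; apply: d'E => //; exact: nw.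
  have far : cnear z' (fun w => w != z /\ (normc (w - z))^-1 <= (normc (z' - z) / 2)^-1).
    have c0 : 0 < normc (z' - z) by rewrite normc_gt0 subr_eq0.
    have cB : ccont (fun w => w - z) z' by apply: ccontB; [exact: ccont_id|exact: ccont_cst].
    have zz0 : z' - z != 0 by rewrite subr_eq0.
    apply: cnearS (ccont_neq0 cB zz0) => w H.
    have wz0 : 0 < normc (w - z) by apply: lt_le_trans H; rewrite divr_gt0.
    split; first by rewrite -subr_eq0 -normc_gt0.
    by rewrite lef_pV2// posrE divr_gt0.
  have d'E' : cnear z' (fun w => w != z' -> pf mu d' w = pf mu d w * ((w - nu) / (w - z))).
    apply: cnearS (cnearI far (pole_isolated mu_sep z')) => w [[wz _] nw] wz'.
    by apply: d'E => //; exact: nw.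
  (* Away from [z] the multiplier is bounded. If [N] is in the list then [z'] is [nu], and the
     factor w - nu supplies the order that the removal of [N] costs. *)
  have [Ns|Ns] := boolP (N \in s); last first.
    have {}van : vanishes (pf mu d) z' (size s).
      by apply: van => // j js; rewrite -(sz' j js) /la'; case: eqP js Ns => // -> ->.
    apply: (vanishes_mul van _ d'E').
    exists ((1 + normc (z' - nu)) * (normc (z' - z) / 2)^-1).
    apply: cnearS (cnearI one far) => w [/bnd w1 [wz wz']] _.
    rewrite ler_wpM2r ?exprn_ge0 ?normc_ge0// normcM normcV.
    by rewrite ler_pM ?invr_ge0 ?normc_ge0.
  have z'N : z' = nu by rewrite -(sz' N Ns) /la' eqxx.
  have {}van : vanishes (pf mu d) z' (size s).-1.
    rewrite -(size_rem Ns); apply: van; first exact: rem_uniq.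
    move=> j; rewrite mem_rem_uniq// inE => /andP[jN js].
    by rewrite -(sz' j js) /la' (negbTE jN).
  apply: (vanishes_mul van _ d'E'); exists (normc (z' - z) / 2)^-1.
  apply: cnearS far => w [wz wz'] _.
  rewrite -[in leRHS](prednK (n := size s)); last by case: (s) Ns.
  rewrite -z'N normcM normcV exprS [leRHS]mulrA [leRHS]mulrC -[leLHS]mulrC.
  rewrite ler_wpM2l ?exprn_ge0 ?normc_ge0// mulrC ler_wpM2r ?normc_ge0//.
(* With [d'] equal to 0, the original sum is 0 at all points near [mu k] other than [mu k] itself
   and [z]. *)
move=> k; apply: (vanish_pole hd); exists 0.
have wz : cnear (mu k) (fun w => w != mu k -> w != z).
  have [->|kz] := eqVneq (mu k) z; first exact: cnearT.
  by apply: cnearS (cnear_neq kz).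
apply: cnearS (cnearI wz (pole_isolated mu_sep (mu k))) => w [{}wz nw] wk.
have := d'E w (nw wk) (wz wk).
have -> : pf mu d' w = 0.
  apply: csum_cser; apply: csum_ext (csum_delta 0 0) => j.
  by rewrite d'0 mul0r; case: eqP.
move/esym/eqP; rewrite !mulf_eq0 invr_eq0 !subr_eq0 (negbTE (wz wk)) orbF.
rewrite [w == nu]eq_sym (negbTE (nw wk N)) orbF => /eqP ->.
by rewrite normc0 !mul0r.
Qed.

End PartialFractionUniqueness.

(** * The complex cosine *)

Section ComplexExponential.
Variable R : realType.
Implicit Types (z w : R[i]) (t x : R).

Lemma cexpD z w : cexp (z + w) = cexp z * cexp w.
Proof.
case: z w => [a b] [c d]; apply/eqP; rewrite eq_complex /= expRD sinD cosD.
by apply/andP; split; apply/eqP; ring.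
Qed.

Lemma cexp0 : cexp (0 : R[i]) = 1.
Proof. by rewrite /cexp /= expR0 cos0 sin0 mulr1 mulr0. Qed.

Lemma cexpN z : cexp z * cexp (- z) = 1.
Proof. by rewrite -cexpD subrr cexp0. Qed.

Lemma normc_cexp z : normc (cexp z) = expR (complex.Re z).
Proof.
case: z => a b; rewrite /cexp /= !exprMn -mulrDr cos2Dsin2 mulr1 sqrtr_sqr.
by rewrite ger0_norm// expR_ge0.
Qed.

Lemma mulii : 'i%C * 'i%C = -1 :> R[i].
Proof. by rewrite -expr2 complex.sqr_i. Qed.

Lemma i_neq0 : 'i%C != 0 :> R[i].
Proof. by apply/eqP => H; have := mulii; rewrite H mul0r => /esym/eqP; rewrite oppr_eq0 oner_eq0. Qed.

Lemma ccosN z : ccos (- z) = ccos z.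
Proof. by rewrite /ccos mulrN opprK addrC. Qed.

Lemma csinN z : csin (- z) = - csin z.
Proof. by rewrite /csin mulrN opprK -[RHS]mulNr opprB. Qed.

Lemma ccosE z : cexp ('i%C * z) = ccos z + 'i%C * csin z.
Proof. by rewrite /ccos /csin; have i0 := i_neq0; field. Qed.

Lemma ccosNE z : cexp (- ('i%C * z)) = ccos z - 'i%C * csin z.
Proof. by rewrite -mulrN ccosE ccosN csinN mulrN. Qed.

Lemma ccosD z w : ccos (z + w) = ccos z * ccos w - csin z * csin w.
Proof.
rewrite {1}/ccos mulrDr opprD !cexpD !ccosE !ccosNE.
have -> : csin z * csin w = - ('i%C * 'i%C) * (csin z * csin w) by rewrite mulii opprK mul1r.
by field.
Qed.

Lemma csinD z w : csin (z + w) = csin z * ccos w + ccos z * csin w.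
Proof. by rewrite {1}/csin mulrDr opprD !cexpD !ccosE !ccosNE; have i0 := i_neq0; field. Qed.

Lemma ccos2Dsin2 z : ccos z ^+ 2 + csin z ^+ 2 = 1.
Proof.
have -> : ccos z ^+ 2 + csin z ^+ 2 =
  (ccos z + 'i%C * csin z) * (ccos z - 'i%C * csin z) + ('i%C * 'i%C + 1) * csin z ^+ 2 by ring.
by rewrite -ccosE -ccosNE cexpN mulii addNr mul0r addr0.
Qed.

Lemma ccos0 : ccos (0 : R[i]) = 1.
Proof. by rewrite /ccos mulr0 oppr0 cexp0 -mulr2n -[_ *+ 2]mulr_natr mul1r divff. Qed.

Lemma csin0 : csin (0 : R[i]) = 0.
Proof. by rewrite /csin mulr0 oppr0 subrr mul0r. Qed.

Lemma cexp_real x : cexp ('i%C * x%:C) = cos x +i* sin x.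
Proof. by rewrite /cexp /= !(mul0r, mulr0, mul1r, subrr, addr0, add0r, oppr0) expR0 !mul1r. Qed.

Lemma cexp_realN x : cexp (- ('i%C * x%:C)) = cos x +i* - sin x.
Proof. by rewrite -mulrN -rmorphN cexp_real cosN sinN. Qed.

Lemma ccos_real x : ccos x%:C = (cos x)%:C.
Proof.
rewrite /ccos cexp_real cexp_realN; apply: (mulIf (x := 2)); first by rewrite pnatr_eq0.
by rewrite divfK ?pnatr_eq0//; apply/eqP; rewrite eq_complex /=; apply/andP; split; apply/eqP; ring.
Qed.

Lemma csin_real x : csin x%:C = (sin x)%:C.
Proof.
rewrite /csin cexp_real cexp_realN; apply: (mulIf (x := 2 * 'i%C)).
  by rewrite mulf_neq0 ?pnatr_eq0 ?i_neq0.
rewrite divfK ?mulf_neq0 ?pnatr_eq0 ?i_neq0//.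
by apply/eqP; rewrite eq_complex /=; apply/andP; split; apply/eqP; ring.
Qed.

Definition cder (f : R -> R[i]) t (l : R[i]) :=
  is_derive t (1 : R) (fun s => complex.Re (f s)) (complex.Re l) /\
  is_derive t (1 : R) (fun s => complex.Im (f s)) (complex.Im l).

Lemma cder_ext f g t l : (forall s, f s = g s) -> cder f t l -> cder g t l.
Proof. by move=> /funext ->. Qed.

Lemma cder_cst c t : cder (fun=> c) t 0.
Proof. by split; exact: is_derive_cst. Qed.

Lemma cder_real t : cder (fun s => s%:C) t 1.
Proof. by split; [exact: is_derive_id|exact: is_derive_cst]. Qed.

Lemma cderD f g t l m : cder f t l -> cder g t m -> cder (fun s => f s + g s) t (l + m).
Proof.
move=> [f1 f2] [g1 g2]; split.
- have E : (fun s => complex.Re (f s + g s)) =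
    (fun s => complex.Re (f s)) \+ (fun s => complex.Re (g s)).
    by apply/funext => s /=; case: (f s) (g s) => [? ?] [].
  rewrite E; apply: is_derive_eq; by case: (l) (m) => [? ?] [].
- have E : (fun s => complex.Im (f s + g s)) =
    (fun s => complex.Im (f s)) \+ (fun s => complex.Im (g s)).
    by apply/funext => s /=; case: (f s) (g s) => [? ?] [].
  rewrite E; apply: is_derive_eq; by case: (l) (m) => [? ?] [].
Qed.

Lemma cderM f g t l m : cder f t l -> cder g t m ->
  cder (fun s => f s * g s) t (l * g t + f t * m).
Proof.
move=> [f1 f2] [g1 g2]; split.
- have E : (fun s => complex.Re (f s * g s)) =
    (fun s => complex.Re (f s) * complex.Re (g s) - complex.Im (f s) * complex.Im (g s)).
    by apply/funext => s /=; case: (f s) (g s) => [? ?] [].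
  rewrite E; apply: is_derive_eq.
  case: (f t) (g t) (l) (m) => [a b] [c d] [e h] [p q] /=; rewrite /GRing.scale/=; ring.
- have E : (fun s => complex.Im (f s * g s)) =
    (fun s => complex.Re (f s) * complex.Im (g s) + complex.Im (f s) * complex.Re (g s)).
    by apply/funext => s /=; case: (f s) (g s) => [? ?] [].
  rewrite E; apply: is_derive_eq.
  case: (f t) (g t) (l) (m) => [a b] [c d] [e h] [p q] /=; rewrite /GRing.scale/=; ring.
Qed.

Lemma cderZ c f t l : cder f t l -> cder (fun s => c * f s) t (c * l).
Proof. by move=> h; have := cderM (cder_cst c t) h; rewrite mul0r add0r. Qed.

Lemma cderN f t l : cder f t l -> cder (fun s => - f s) t (- l).
Proof.
move=> /(cderZ (-1)); rewrite mulN1r; apply: cder_ext => s.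
by rewrite mulN1r.
Qed.

Lemma cderB f g t l m : cder f t l -> cder g t m -> cder (fun s => f s - g s) t (l - m).
Proof. by move=> hf hg; apply: cderD => //; exact: cderN. Qed.

Lemma cder_cexp z t : cder (fun s => cexp (z * s%:C)) t (z * cexp (z * t%:C)).
Proof.
case: z => a b; split.
- have -> : (fun s => complex.Re (cexp ((a +i* b) * s%:C))) =
      (fun s => expR (a * s) * cos (b * s)).
    by apply/funext => s; rewrite /cexp /= !mulr0 subr0 add0r.
  apply: is_derive_eq; rewrite /GRing.scale /= !mulr0 subr0 add0r !mulr1; ring.
- have -> : (fun s => complex.Im (cexp ((a +i* b) * s%:C))) =
      (fun s => expR (a * s) * sin (b * s)).
    by apply/funext => s; rewrite /cexp /= !mulr0 subr0 add0r.
  apply: is_derive_eq; rewrite /GRing.scale /= !mulr0 subr0 add0r !mulr1; ring.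
Qed.

Lemma cder_ccos z t : cder (fun s => ccos (z * s%:C)) t (- z * csin (z * t%:C)).
Proof.
have h1 := cder_cexp ('i%C * z) t; have h2 := cder_cexp (- ('i%C * z)) t.
have := cderZ 2^-1 (cderD h1 h2); have i0 := i_neq0.
have -> : 2^-1 * ('i%C * z * cexp ('i%C * z * t%:C) +
   - ('i%C * z) * cexp (- ('i%C * z) * t%:C)) = - z * csin (z * t%:C).
  rewrite /csin !mulrA !mulNr; move: (cexp _) (cexp _) => q p.
  transitivity ('i%C * 'i%C * (z * (p - q)) / (2 * 'i%C)); first by field.
  by rewrite mulii; field.
by apply: cder_ext => s; rewrite /ccos mulrC mulNr -!mulrA.
Qed.

Lemma cder_csin z t : cder (fun s => csin (z * s%:C)) t (z * ccos (z * t%:C)).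
Proof.
have h1 := cder_cexp ('i%C * z) t; have h2 := cder_cexp (- ('i%C * z)) t.
have i0 := i_neq0.
have := cderZ (2 * 'i%C)^-1 (cderB h1 h2).
have -> : (2 * 'i%C)^-1 * ('i%C * z * cexp ('i%C * z * t%:C) -
   - ('i%C * z) * cexp (- ('i%C * z) * t%:C)) = z * ccos (z * t%:C).
  by rewrite /ccos !mulrA !mulNr; field.
by apply: cder_ext => s; rewrite /csin mulrC mulNr -!mulrA.
Qed.

Lemma is_derive_continuous (f df : R -> R) : (forall x, is_derive x (1:R) f (df x)) ->
  continuous f.
Proof. by move=> h x; apply: differentiable_continuous; apply/derivable1_diffP; have [] := h x. Qed.

Lemma MVT_le (f df : R -> R) (a b M : R) : (forall x, is_derive x (1:R) f (df x)) ->
  (forall x, Num.min a b <= x <= Num.max a b -> `|df x| <= M) ->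
  `|f b - f a| <= M * `|b - a|.
Proof.
move=> hf; wlog ab : a b / a <= b => [H|].
  have /orP[ab|ba] := le_total a b; first exact: H.
  by rewrite minC maxC => hM; rewrite distrC (distrC b); apply: H.
rewrite (min_idPl ab) (max_idPr ab) => hM.
have cf := is_derive_continuous hf.
have [c] := @MVT_segment R f df a b ab (fun x _ => hf x) (continuous_subspaceT cf).
rewrite in_itv /= => /hM dc ->; rewrite normrM ler_wpM2r//.
Qed.

(** The factor 2 comes from treating the real and imaginary parts separately. *)
Lemma cder_MVT (f df : R -> R[i]) (a b M : R) : (forall x, cder f x (df x)) ->
  (forall x, Num.min a b <= x <= Num.max a b -> normc (df x) <= M) ->
  normc (f b - f a) <= 2 * M * `|b - a|.
Proof.
move=> hf hM; apply: le_trans (normc_le_ReIm _) _.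
have -> : complex.Re (f b - f a) = complex.Re (f b) - complex.Re (f a) by case: (f b) (f a) => [? ?] [].
have -> : complex.Im (f b - f a) = complex.Im (f b) - complex.Im (f a) by case: (f b) (f a) => [? ?] [].
have -> : 2 * M * `|b - a| = M * `|b - a| + M * `|b - a| by ring.
apply: lerD.
  apply: (@MVT_le (fun s => complex.Re (f s)) (fun s => complex.Re (df s))) => x.
    by case: (hf x).
  by move=> /hM; apply: le_trans; exact: Re_le_normc.
apply: (@MVT_le (fun s => complex.Im (f s)) (fun s => complex.Im (df s))) => x.
  by case: (hf x).
by move=> /hM; apply: le_trans; exact: Im_le_normc.
Qed.

Lemma is_derive_monomial (n : nat) (c t : R) :
  is_derive t (1 : R) (fun s => c * s ^+ n.+1) (c * (n.+1%:R * t ^+ n)).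
Proof.
have h := is_deriveZ c (is_deriveX n.+1 (is_derive_id t (1 : R))).
have E : (fun s => c * s ^+ n.+1) = c \*: ((@id R : R -> R) ^+ n.+1).
  by apply/funext => s; rewrite /= exprfctE.
rewrite E; apply: (is_derive_eq h).
by rewrite /GRing.scale /= mulr1.
Qed.

Definition exp_poly n z t : R[i] := \sum_(k < n) z ^+ k * (t ^+ k / k`!%:R)%:C.

Lemma cder_exp_poly n z t : cder (exp_poly n.+1 z) t (z * exp_poly n z t).
Proof.
elim: n => [|n IH].
  rewrite /exp_poly big_ord0 mulr0; apply: cder_ext (cder_cst 1 t) => s.
  by rewrite big_ord1 !expr0 fact0 divr1 mulr1.
have E m s : exp_poly m.+1 z s = exp_poly m z s + z ^+ m * (s ^+ m / m`!%:R)%:C.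
  by rewrite /exp_poly big_ord_recr.
apply: (@cder_ext (fun s => exp_poly n.+1 z s + z ^+ n.+1 * (s ^+ n.+1 / n.+1`!%:R)%:C)).
  by move=> s; rewrite [RHS]E.
rewrite E mulrDr; apply: cderD => //.
rewrite mulrA -exprS; apply: cderZ; split; last exact: is_derive_cst.
have -> : (fun s : R => complex.Re (s ^+ n.+1 / n.+1`!%:R)%:C) =
  (fun s => (n.+1`!%:R)^-1 * s ^+ n.+1) by apply/funext => s; rewrite mulrC.
apply: is_derive_eq (is_derive_monomial n _ t) _.
rewrite /= factS natrM; field.
by rewrite addrC natr1 !pnatr_eq0 -lt0n fact_gt0.
Qed.

(** The derivative of a remainder in t is z times the preceding remainder; each use of [cder_MVT]
    costs a factor 2, hence the power of 2 |z|. *)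
Lemma cexp_taylor n z t : 0 <= t <= 1 ->
  normc (cexp (z * t%:C) - exp_poly n z t) <= (2 * normc z) ^+ n * expR (normc z).
Proof.
elim: n t => [|n IH] t t01.
  rewrite /exp_poly big_ord0 subr0 expr0 mul1r normc_cexp ler_expR.
  have /andP[t0 t1] := t01.
  apply: le_trans (ler_norm _) _; apply: le_trans (Re_le_normc _) _.
  by rewrite normcM normc_real ger0_norm// ler_piMr// normc_ge0.
have /andP[t0 t1] := t01.
pose f s := cexp (z * s%:C) - exp_poly n.+1 z s.
have hf s : cder f s (z * (cexp (z * s%:C) - exp_poly n z s)).
  by rewrite mulrBr; apply: cderB; [exact: cder_cexp|exact: cder_exp_poly].
have f0 : f 0 = 0.
  rewrite /f mulr0 cexp0 /exp_poly big_ord_recl /= !expr0 fact0 divr1 mulr1 big1 ?addr0 ?subrr//.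
  by move=> i _; rewrite expr0n /= mul0r mulr0.
have := @cder_MVT f _ 0 t (normc z * ((2 * normc z) ^+ n * expR (normc z))) hf.
rewrite f0 !subr0 (min_idPl t0) (max_idPr t0) => H.
apply: le_trans (H _) _.
  move=> x /andP[x0 xt]; rewrite normcM ler_wpM2l ?normc_ge0// IH// x0 /=.
  exact: le_trans xt t1.
rewrite (ger0_norm t0) exprS; set E := _ ^+ n * _.
have E0 : 0 <= E by rewrite mulr_ge0 ?expR_ge0// exprn_ge0// mulr_ge0// normc_ge0.
rewrite -[leRHS]mulrA -/E (mulrA 2) ler_piMr//; apply: mulr_ge0 => //.
by apply: mulr_ge0 => //; exact: normc_ge0.
Qed.

End ComplexExponential.

(** * The entire function cos sqrt(lambda) and its extremal points *)

Section CosSqrt.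
Variable R : realType.
Implicit Types (z w la : R[i]).

Lemma cos_natpi n : cos (n%:R * pi) = (-1) ^+ n :> R.
Proof.
elim: n => [|n IH]; first by rewrite mul0r cos0 expr0.
by rewrite -natr1 mulrDl mul1r cosDpi IH exprS mulN1r.
Qed.

Lemma sin_natpi n : sin (n%:R * pi) = 0 :> R.
Proof.
elim: n => [|n IH]; first by rewrite mul0r sin0.
by rewrite -natr1 mulrDl mul1r sinDpi IH oppr0.
Qed.

Lemma sin_eq0_ge0 (x : R) : 0 <= x -> sin x = 0 -> exists n : nat, x = n%:R * pi.
Proof.
move=> x0 sx; have p0 := pi_gt0 R; exists (Num.trunc (x / pi)).
set n := Num.trunc _.
have /andP[n1 n2] : n%:R <= x / pi < n.+1%:R by apply: trunc_itv; rewrite divr_ge0// ltW.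
rewrite ler_pdivlMr// in n1; rewrite ltr_pdivrMr// -natr1 mulrDl mul1r in n2.
have s0 : sin (x - n%:R * pi) = 0.
  by rewrite sinB sx sin_natpi mul0r mulr0 subrr.
apply/eqP; rewrite eq_le n1 andbT leNgt; apply/negP => nx.
have := @sin_gt0_pi R (x - n%:R * pi); rewrite s0 ltxx => H.
suff : false by [].
by apply: H; rewrite subr_gt0 nx /= ltrBlDl.
Qed.

Lemma cexp_near0 : ccont (fun h : R[i] => if h == 0 then 1 else (cexp h - 1) / h) 0.
Proof.
move=> e e0; have E0 : 0 < 4 * expR 1 :> R by rewrite mulr_gt0// expR_gt0.
exists (Num.min 1 (e / (4 * expR 1))); first by rewrite lt_min ltr01 divr_gt0.
move=> h; rewrite subr0 lt_min eqxx => /andP[h1 he].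
have [_|hn0] := eqVneq h 0; first by rewrite subrr normc0.
have -> : (cexp h - 1) / h - 1 = (cexp h - 1 - h) / h by field.
have hp : 0 < normc h by rewrite normc_gt0.
rewrite normcM normcV ltr_pdivrMr//.
have := @cexp_taylor R 2 h 1; rewrite ler01 lexx => /(_ isT).
rewrite mulr1 /exp_poly !big_ord_recr big_ord0 /= !expr0 !expr1 !fact0 factS fact0.
rewrite mul1n !divr1 !mulr1 add0r opprD addrA => H; apply: le_lt_trans H _.
apply: (@le_lt_trans _ _ ((2 * normc h) ^+ 2 * expR 1)).
  by rewrite ler_wpM2l ?exprn_ge0 ?mulr_ge0 ?normc_ge0// ler_expR ltW.
rewrite ltr_pdivlMr// in he; rewrite exprMn.
have -> : 2 ^+ 2 * normc h ^+ 2 * expR 1 = normc h * (4 * expR 1) * normc h by ring.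
by rewrite ltr_pM2r.
Qed.

Lemma cexp_cdiff z : cdiff (@cexp R) z.
Proof.
pose p h : R[i] := if h == 0 then 1 else (cexp h - 1) / h.
exists (fun x => cexp z * p (x - z)).
  apply: ccontM; first exact: ccont_cst.
  apply: (@ccont_comp _ p (fun x => x - z)).
    by apply: ccontB; [exact: ccont_id|exact: ccont_cst].
  by rewrite subrr; exact: cexp_near0.
apply: cnearT => x; rewrite /p; case: eqVneq => [/eqP|xz].
  by rewrite subr_eq0 => /eqP ->; rewrite !subrr mul0r.
by rewrite mulrCA [(x - z) * _]mulrC divfK// mulrBr mulr1 -cexpD (addrC z) subrK.
Qed.

Lemma ccos_cdiff z : cdiff (@ccos R) z.
Proof.
have h1 : cdiff (fun x : R[i] => 'i%C * x) z by apply: cdiffM; [exact: cdiff_cst|exact: cdiff_id].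
apply: cdiffM; last exact: cdiff_cst.
apply: cdiffD; first exact: cdiff_comp h1 (cexp_cdiff _).
exact: cdiff_comp (cdiffN h1) (cexp_cdiff _).
Qed.

(** The square root of [w] with the sign that brings it nearest to [r0]: a branch that is continuous
    around r0^2 when r0 <> 0, whatever the jumps of [sqrtC]. *)
Definition near_sqrt (r0 w : R[i]) :=
  if normc (sqrtC w - r0) <= normc (sqrtC w + r0) then sqrtC w else - sqrtC w.

Lemma near_sqrtK r0 w : near_sqrt r0 w ^+ 2 = w.
Proof. by rewrite /near_sqrt; case: ifP; rewrite ?sqrrN sqrtCK. Qed.

Lemma near_sqrt_le r0 w :
  normc (near_sqrt r0 w - r0) <= normc (near_sqrt r0 w + r0).
Proof.
rewrite /near_sqrt; case: ifPn => //; rewrite -ltNge => /ltW H.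
by rewrite -normcN opprD !opprK -(normcN (- _ + _)) opprD opprK.
Qed.

(** Since 2 r0 = (r + r0) - (r - r0) and the second term is the smaller one. It allows division by r
    + r0 in (r - r0) (r + r0) = w - r0^2. *)
Lemma near_sqrt_far r0 w : normc r0 <= normc (near_sqrt r0 w + r0).
Proof.
have := normc_le_sub (near_sqrt r0 w + r0) (near_sqrt r0 w - r0).
have -> : near_sqrt r0 w + r0 - (near_sqrt r0 w - r0) = 2 * r0 by ring.
rewrite normcM normc_nat; have := near_sqrt_le r0 w; lra.
Qed.

Lemma sub_near_sqrt r0 r w : (near_sqrt r0 w - r) * (near_sqrt r0 w + r) = w - r ^+ 2.
Proof. by rewrite -subr_sqr near_sqrtK. Qed.

Lemma near_sqrt_cont r0 : r0 != 0 -> ccont (near_sqrt r0) (r0 ^+ 2) /\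
  near_sqrt r0 (r0 ^+ 2) = r0.
Proof.
rewrite -normc_gt0 => r00.
have H w : normc (near_sqrt r0 w - r0) * normc r0 <= normc (w - r0 ^+ 2).
  rewrite -(sub_near_sqrt r0) normcM ler_wpM2l ?normc_ge0//; exact: near_sqrt_far.
have E : near_sqrt r0 (r0 ^+ 2) = r0.
  apply/eqP; rewrite -subr_eq0 -normc_eq0 eq_le normc_ge0 andbT.
  by have := H (r0 ^+ 2); rewrite subrr normc0 pmulr_lle0.
split=> // e e0; exists (e * normc r0); first by rewrite mulr_gt0.
move=> w we; rewrite E; have := le_lt_trans (H w) we; by rewrite ltr_pM2r.
Qed.

(** The difference quotient between w and w1 is 1 / (r(w) + r(w1)), and the denominator stays away
    from 0 since both roots are within |r0| / 4 of r0. *)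
Lemma near_sqrt_cdiff r0 : r0 != 0 -> cnear (r0 ^+ 2) (cdiff (near_sqrt r0)).
Proof.
move=> r0n; have [cr rr] := near_sqrt_cont r0n.
have r00 : 0 < normc r0 by rewrite normc_gt0.
have r4 : 0 < normc r0 / 4 by rewrite divr_gt0.
have [d d0 Hd] := cr _ r4.
exists (d / 2) => [|w1 w1d]; first by rewrite divr_gt0.
have dd : d / 2 < d by rewrite ltr_pdivrMr// ltr_pMr// ltr1n.
set r := near_sqrt r0.
have close : cnear w1 (fun w => normc r0 <= normc (r w + r w1)).
  exists (d / 2) => [|w ww1]; first by rewrite divr_gt0.
  have w0 : normc (w - r0 ^+ 2) < d.
    by have := normc_dist_add w w1 (r0 ^+ 2); lra.
  have := Hd _ w0; have := Hd _ (lt_trans w1d dd); rewrite rr -/r => a b.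
  have := normc_ge_sub (2 * r0) (- (r w - r0) - (r w1 - r0)).
  have -> : 2 * r0 - (- (r w - r0) - (r w1 - r0)) = r w + r w1 by ring.
  have := normc_le_sub (- (r w - r0)) (r w1 - r0); rewrite normcN normcM normc_nat; lra.
have c1 : ccont r w1.
  move=> e e0; have er : 0 < e * normc r0 by rewrite mulr_gt0.
  have near : cnear w1 (fun w => normc (w - w1) < e * normc r0) by exists (e * normc r0).
  apply: cnearS (cnearI near close) => w [we H].
  have := sub_near_sqrt r0 (r w1) w; rewrite near_sqrtK -/r => E.
  rewrite -(ltr_pM2r r00); apply: le_lt_trans we; rewrite -E normcM.
  by rewrite ler_wpM2l// normc_ge0.
have s1 : r w1 + r w1 != 0 by rewrite -normc_gt0 (lt_le_trans r00)//; exact: cnear_self close.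
exists (fun w => (r w + r w1)^-1).
  by apply: ccontV => //; apply: ccontD => //; exact: ccont_cst.
apply: cnearS close => w H.
have := sub_near_sqrt r0 (r w1) w; rewrite near_sqrtK -/r => <-.
by rewrite mulfK// -normc_gt0 (lt_le_trans r00).
Qed.

Definition cos_sqrt la : R[i] := ccos (sqrtC la).

Lemma cos_sqrtE r la : r ^+ 2 = la -> ccos r = cos_sqrt la.
Proof.
move=> <-; rewrite /cos_sqrt; have /eqP := sqrtCK (r ^+ 2).
by rewrite eqf_sqr => /orP[/eqP ->//|/eqP ->]; rewrite ccosN.
Qed.

Lemma cos_sqrt_cdiff_neq0 la : la != 0 -> cdiff cos_sqrt la.
Proof.
move=> la0; have s0 : sqrtC la != 0 by rewrite sqrtC_eq0.
have h := cnear_self (near_sqrt_cdiff s0); rewrite sqrtCK in h.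
apply: cdiff_near (cdiff_comp h (ccos_cdiff _)).
by apply: cnearT => w; rewrite /= (cos_sqrtE (near_sqrtK _ w)).
Qed.

(** It makes the zero of 1 - cos sqrt(lambda) at 0 explicit and simple, and settles
    differentiability there, where the root has no differentiable branch. *)
Definition vers_div la : R[i] := if la == 0 then 1 / 2 else (1 - cos_sqrt la) / la.

Lemma vers_div0 : vers_div 0 = 1 / 2. Proof. by rewrite /vers_div eqxx. Qed.

Lemma vers_divE la : cos_sqrt la = 1 - la * vers_div la.
Proof.
rewrite /vers_div; case: eqVneq => [->|la0].
  by rewrite mul0r subr0 /cos_sqrt sqrtC0 ccos0.
by rewrite mulrC divfK// opprB addrC subrK.
Qed.

(** The term in r^4 is needed for the derivative of [vers_div] at 0; the odd terms of the two
    exponentials cancel. *)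
Lemma ccos_taylor (r : R[i]) : normc r <= 1 ->
  normc (ccos r - (1 - r ^+ 2 / 2 + r ^+ 4 / 24)) <= 32 * expR 1 * normc r ^+ 5.
Proof.
move=> r1.
pose P (s : R[i]) := exp_poly 5 s 1.
have B (s : R[i]) : normc s = normc r -> normc (cexp s - P s) <= 32 * expR 1 * normc r ^+ 5.
  move=> sr; have := @cexp_taylor R 5 s 1; rewrite ler01 lexx => /(_ isT).
  rewrite mulr1 sr => H; apply: le_trans H _.
  have -> : (2 * normc r) ^+ 5 = 32 * normc r ^+ 5 by ring.
  rewrite mulrAC ler_wpM2r ?exprn_ge0 ?normc_ge0// ler_wpM2l//.
  by rewrite ler_expR.
have PE : P ('i%C * r) + P (- ('i%C * r)) = 2 * (1 - r ^+ 2 / 2 + r ^+ 4 / 24).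
  rewrite /P /exp_poly !big_ord_recr !big_ord0 /=.
  have -> : (1 ^+ 2 / 2`!%:R)%:C = 1 / 2 :> R[i].
    by rewrite expr1n fmorph_div rmorph1 rmorph_nat.
  have -> : (1 ^+ 4 / 4`!%:R)%:C = 1 / 24 :> R[i].
    by rewrite expr1n fmorph_div rmorph1 rmorph_nat.
  have -> : (1 ^+ 0 / 0`!%:R)%:C = 1 :> R[i] by rewrite expr0 divr1.
  set y := (1 ^+ 3 / _)%:C; clearbody y.
  have E2 : ('i%C * r) ^+ 2 = - r ^+ 2.
    by rewrite exprMn [X in X * _]expr2 mulii mulN1r.
  have E4 : ('i%C * r) ^+ 4 = r ^+ 4.
    by rewrite (_ : 4 = 2 * 2)%N // !exprM E2 sqrrN.
  transitivity (2 * (1 + ('i%C * r) ^+ 2 / 2 + ('i%C * r) ^+ 4 / 24)); first by field.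
  by rewrite E2 E4; field.
have -> : ccos r - (1 - r ^+ 2 / 2 + r ^+ 4 / 24) =
  ((cexp ('i%C * r) - P ('i%C * r)) + (cexp (- ('i%C * r)) - P (- ('i%C * r)))) / 2.
  by rewrite addrACA -opprD PE /ccos; field.
have ni : normc ('i%C * r) = normc r.
  rewrite normcM (_ : normc 'i%C = 1) ?mul1r//=.
  by rewrite expr0n expr1n add0r sqrtr1.
rewrite normcM normcV normc_nat ler_pdivrMr//.
apply: le_trans (normc_le_add _ _) _.
rewrite mulr_natr mulr2n; apply: lerD; apply: B => //.
by rewrite normcN.
Qed.

Lemma vers_div_cdiff la : cdiff vers_div la.
Proof.
have [->|la0] := eqVneq la 0; last first.
  apply: (@cdiff_near _ (fun w => (1 - cos_sqrt w) * w^-1)).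
    by apply: cnearS (cnear_neq la0) => w; rewrite /vers_div => /negbTE ->.
  apply: cdiffM; last by apply: cdiffV => //; exact: cdiff_id.
  by apply: cdiffB; [exact: cdiff_cst|exact: cos_sqrt_cdiff_neq0].
(* The slope at 0 comes from (1 - cos r) / r^2 = 1/2 - r^2 / 24 + O(r^3), with r^2 = w. *)
pose p w : R[i] := if w == 0 then - (1 / 24) else (vers_div w - 1 / 2) / w.
exists p; last first.
  apply: cnearT => w; rewrite /p subr0; have [->|w0] := eqVneq w 0.
    by rewrite subrr mul0r.
  by rewrite vers_div0 [w * _]mulrC divfK.
move=> e e0; pose C : R := 32 * expR 1.
have C0 : 0 < C by rewrite mulr_gt0// expR_gt0.
exists (Num.min 1 ((e / C) ^+ 2)); first by rewrite lt_min ltr01 exprn_gt0// divr_gt0.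
move=> w; rewrite subr0 lt_min => /andP[w1 we].
rewrite /p eqxx; have [_|w0] := eqVneq w 0; first by rewrite subrr normc0.
pose r := sqrtC w; have rw : r ^+ 2 = w by rewrite sqrtCK.
have r0 : r != 0 by rewrite sqrtC_eq0.
have rp : 0 < normc r by rewrite normc_gt0.
have r1 : normc r <= 1.
  by rewrite -(@ler_pXn2r _ 2)// ?nnegrE ?normc_ge0// expr1n -normcX rw ltW.
have re : normc r < e / C.
  rewrite -(@ltr_pXn2r _ 2)// ?nnegrE ?normc_ge0//; first by rewrite -normcX rw.
  by rewrite divr_ge0// ltW.
have -> : (vers_div w - 1 / 2) / w - - (1 / 24) =
    - (ccos r - (1 - r ^+ 2 / 2 + r ^+ 4 / 24)) / r ^+ 4.
  rewrite /vers_div (negbTE w0) -(cos_sqrtE rw) -rw.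
  by field.
rewrite normcM normcN normcV normcX ltr_pdivrMr ?exprn_gt0//.
apply: le_lt_trans (ccos_taylor r1) _.
have -> : 32 * expR 1 * normc r ^+ 5 = normc r * C * normc r ^+ 4 by rewrite /C; ring.
by rewrite ltr_pM2r ?exprn_gt0// -ltr_pdivlMr.
Qed.

Lemma cos_sqrt_cdiff la : cdiff cos_sqrt la.
Proof.
apply: (@cdiff_near _ (fun w => 1 - w * vers_div w)).
  by apply: cnearT => w; rewrite vers_divE.
apply: cdiffB; first exact: cdiff_cst.
by apply: cdiffM; [exact: cdiff_id|exact: vers_div_cdiff].
Qed.

(** For the branch r of the root near n pi, the left side is 1 - cos (r - n pi), and r - n pi = (w -
    p) / (r + n pi); so the zero is exactly double. *)
Lemma cos_sqrt_pole n : (0 < n)%N -> let p : R[i] := ((n%:R * pi) ^+ 2)%:C in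
  exists H : R[i] -> R[i], [/\ H p != 0, cnear p (cdiff H) &
   cnear p (fun w => 1 - (-1) ^+ n * cos_sqrt w = (w - p) ^+ 2 * H w)].
Proof.
move=> n0 p; pose r0 : R[i] := (n%:R * pi)%:C.
have r00 : r0 != 0.
  by rewrite -normc_eq0 normc_real normr_eq0 mulf_neq0 ?pnatr_eq0 -?lt0n// gt_eqF// pi_gt0.
have pE : p = r0 ^+ 2 by rewrite /p /r0 rmorphXn.
pose r := near_sqrt r0.
have far w : r w + r0 != 0.
  by rewrite -normc_gt0 (lt_le_trans _ (near_sqrt_far r0 w))// normc_gt0.
exists (fun w => vers_div ((r w - r0) ^+ 2) * ((r w + r0) ^+ 2)^-1); split.
- rewrite pE /r (near_sqrt_cont r00).2 subrr expr0n /= vers_div0.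
  rewrite mulf_neq0 ?mulf_neq0 ?oner_eq0 ?invr_eq0 ?expf_neq0 ?pnatr_eq0//.
  by have := far (r0 ^+ 2); rewrite /r (near_sqrt_cont r00).2.
- rewrite pE; apply: cnearS (near_sqrt_cdiff r00) => w hr.
  apply: cdiffM.
    apply: (@cdiff_comp _ vers_div (fun w => (r w - r0) ^+ 2)); last exact: vers_div_cdiff.
    by apply: cdiffX; apply: cdiffB => //; exact: cdiff_cst.
  apply: cdiffV; last by rewrite expf_neq0.
  by apply: cdiffX; apply: cdiffD => //; exact: cdiff_cst.
- apply: cnearT => w; rewrite -(cos_sqrtE (near_sqrtK r0 w)) -/r.
  have -> : (-1) ^+ n * ccos (r w) = ccos (r w - r0).
    rewrite ccosD ccosN csinN ccos_real csin_real cos_natpi sin_natpi.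
    by rewrite rmorphXn rmorphN rmorph1 rmorph0 oppr0 mulr0 subr0 mulrC.
  rewrite (cos_sqrtE (erefl ((r w - r0) ^+ 2))) vers_divE opprB addrC subrK.
  have := sub_near_sqrt r0 r0 w; rewrite -/r -pE => <-.
by move: (far w); move: (r w) (r0) => x y xy; field.
Qed.

(** The sine of the root r is 0, so exp(i r) = cos r has modulus 1 and r is real; the root with
    nonnegative real part is then n pi, and the sign of the cosine gives the parity. *)
Lemma cos_sqrt_eq (al : nat) la : 1 - (-1) ^+ al * cos_sqrt la = 0 ->
  exists n : nat, la = ((n%:R * pi) ^+ 2)%:C /\ odd n = odd al.
Proof.
pose s := sqrtC la.
have [r rla r0] : exists2 r : R[i], r ^+ 2 = la & 0 <= complex.Re r.
  have [h|/ltW h] := leP 0 (complex.Re s); first by exists s => //; rewrite sqrtCK.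
  exists (- s); first by rewrite sqrrN sqrtCK.
  by move: h; case: (s) => a b /=; rewrite oppr_ge0.
rewrite -(cos_sqrtE rla) => /eqP; rewrite subr_eq0 eq_sym => /eqP E.
have cr : ccos r = (-1) ^+ al.
  by have := congr1 (fun x => (-1) ^+ al * x) E; rewrite mulrA -expr2 sqrr_sign mul1r mulr1.
have sr : csin r = 0.
  apply/eqP; rewrite -sqrf_eq0; have := ccos2Dsin2 r; rewrite cr sqrr_sign.
  by move/eqP; rewrite -subr_eq0 addrAC subrr add0r.
have := ccosE r; rewrite cr sr mulr0 addr0.
case: r {E cr sr} rla r0 => a b rla a0 E.
have b0 : b = 0.
  have := normc_cexp ('i%C * (a +i* b)); rewrite E normcX normcN normc1 expr1n /= mul0r sub0r mul1r.
  by rewrite -expR0 => /expR_inj /esym /eqP; rewrite oppr_eq0 => /eqP.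
rewrite b0 -[a +i* 0]/(a%:C) cexp_real in E rla.
have [Ec Es] : cos a = (-1) ^+ al /\ sin a = 0.
  have H : cos a +i* sin a = ((-1) ^+ al)%:C by rewrite E rmorphXn rmorphN rmorph1.
  by case: H.
rewrite /= in a0; have [n na] := sin_eq0_ge0 a0 Es; exists n; split; first by rewrite -rla na rmorphXn.
move: Ec; rewrite na cos_natpi -signr_odd -[in RHS]signr_odd.
case: (odd n); case: (odd al) => // /eqP; rewrite ?expr0 ?expr1.
  by rewrite eq_sym -subr_eq0 opprK -mulr2n pnatr_eq0.
by rewrite -subr_eq0 opprK -mulr2n pnatr_eq0.
Qed.

End CosSqrt.

(** * Cosine coefficients *)

Section UnitIntervalIntegral.
Variable R : realType.
Local Notation mu := (@lebesgue_measure R).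
Local Notation D := (`]0, 1[%classic : set R).
Implicit Types (f g h : R -> R).

Definition intg f := mu.-integrable D (EFin \o f).
Definition int01 f : R := \int[mu]_(x in D) f x.

Lemma measurable_D : measurable (D : set (measurableTypeR R)). Proof. exact: measurable_itv. Qed.
Hint Resolve measurable_D : core.

Lemma aeS (P Q : R -> Prop) : (forall x, P x -> Q x) ->
  {ae mu, forall x, P x} -> {ae mu, forall x, Q x}.
Proof. by move=> PQ; apply: (@filterS _ _ (ae_filter_ringOfSetsType mu)) => x; exact: PQ. Qed.

Lemma aeI (P Q : R -> Prop) : {ae mu, forall x, P x} -> {ae mu, forall x, Q x} ->
  {ae mu, forall x, P x /\ Q x}.
Proof. by move=> hP hQ; apply: (@filterI _ _ (ae_filter_ringOfSetsType mu)). Qed.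

Lemma aeT (P : R -> Prop) : (forall x, P x) -> {ae mu, forall x, P x}.
Proof. by move=> hP; apply: (@filterE _ _ (ae_filter_ringOfSetsType mu)). Qed.

Lemma mu_D : mu D = 1%E.
Proof. by rewrite lebesgue_measure_itv/= lte_fin ltr01 -EFinD subr0. Qed.

Lemma intg_measurable f : intg f -> measurable_fun D f.
Proof. by move=> /measurable_int/measurable_EFinP. Qed.

Lemma intg_le f g : measurable_fun D f -> (forall x, D x -> `|f x| <= g x) ->
  intg g -> intg f.
Proof.
move=> mf fg; apply: le_integrable => //; first exact/measurable_EFinP.
by move=> x Dx /=; rewrite lee_fin (le_trans (fg x Dx))// ler_norm.
Qed.

Lemma intg_cst (c : R) : intg (fun=> c).
Proof.
apply: measurable_bounded_integrable => //; last exact: bounded_cst.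
by have h : (mu D < +oo)%E by rewrite mu_D ltry.
Qed.

Lemma intg_bounded f M : measurable_fun D f -> (forall x, D x -> `|f x| <= M) -> intg f.
Proof. by move=> mf fM; apply: intg_le mf fM _; exact: intg_cst. Qed.

Lemma intgZ c f : intg f -> intg (fun x => c * f x).
Proof. exact: integrableZl. Qed.

Lemma intgD f g : intg f -> intg g -> intg (fun x => f x + g x).
Proof. by rewrite /intg => hf hg; apply: eq_integrable (integrableD measurable_D hf hg). Qed.

Lemma intgB f g : intg f -> intg g -> intg (fun x => f x - g x).
Proof. by rewrite /intg => hf hg; apply: eq_integrable (integrableB measurable_D hf hg). Qed.

Lemma intg_norm f : intg f -> intg (fun x => `|f x|).
Proof. exact: integrable_norm. Qed.

Lemma intgM f g M : intg f -> measurable_fun D g -> (forall x, D x -> `|g x| <= M) ->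
  intg (fun x => f x * g x).
Proof.
move=> hf mg gM.
apply: (@intg_le _ (fun x => M * `|f x|)); last by apply: intgZ; exact: intg_norm.
  by apply: measurable_funM => //; exact: intg_measurable.
by move=> x Dx; rewrite normrM mulrC ler_wpM2r// gM.
Qed.

Lemma int01D f g : intg f -> intg g -> int01 (fun x => f x + g x) = int01 f + int01 g.
Proof. exact: RintegralD. Qed.

Lemma int01B f g : intg f -> intg g -> int01 (fun x => f x - g x) = int01 f - int01 g.
Proof. exact: RintegralB. Qed.

Lemma int01Z c f : intg f -> int01 (fun x => c * f x) = c * int01 f.
Proof. exact: RintegralZl. Qed.

Lemma int01_le f g : intg f -> intg g -> (forall x, D x -> f x <= g x) -> int01 f <= int01 g.
Proof. exact: le_Rintegral. Qed.

Lemma int01_norm f : intg f -> `|int01 f| <= int01 (fun x => `|f x|).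
Proof. exact: le_normr_Rintegral. Qed.

Lemma int01_cst c : int01 (fun=> c) = c.
Proof. by have h : fine (mu D) = 1 by [rewrite mu_D]; rewrite /int01 Rintegral_cst// [fine _]h mulr1. Qed.

Lemma int01_eq f g : (forall x, D x -> f x = g x) -> int01 f = int01 g.
Proof. by move=> fg; apply: eq_Rintegral => x /set_mem /fg. Qed.

Lemma intg_eq f g : (forall x, D x -> f x = g x) -> intg f -> intg g.
Proof.
move=> fg; apply: eq_integrable => // x /set_mem Dx /=.
by rewrite fg.
Qed.

Lemma int01_fin f : intg f -> (int01 f)%:E = (\int[mu]_(x in D) (f x)%:E)%E.
Proof. by move=> hf; rewrite /int01 /Rintegral fineK//; exact: integrable_fin_num. Qed.

Lemma int01_ae_eq f g : intg f -> intg g ->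
  {ae mu, forall x, D x -> f x = g x} -> int01 f = int01 g.
Proof.
move=> hf hg fg; apply: EFin_inj; rewrite !int01_fin//.
apply: ae_eq_integral => //.
- by apply/measurable_EFinP; exact: intg_measurable.
- by apply/measurable_EFinP; exact: intg_measurable.
- by apply: aeS fg => x fg Dx; rewrite /= fg.
Qed.

(** The majorant may be infinite on a null set, as is a sum of absolute values in the Riesz-Fischer
    argument. *)
Lemma int01_dominated_ereal (f_ : nat -> R -> R) f (g : R -> \bar R) :
  (forall n, measurable_fun D (f_ n)) -> measurable_fun D f ->
  {ae mu, forall x, D x -> f_ ^~ x @ \oo --> f x} ->
  mu.-integrable D g -> (forall n x, D x -> (`|f_ n x|%:E <= g x)%E) ->
  intg f /\ (fun n => int01 (f_ n)) @ \oo --> int01 f.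
Proof.
move=> mf_ mf ff ig fg.
have mf_' n : measurable_fun D (EFin \o f_ n) by exact/measurable_EFinP.
have mf' : measurable_fun D (EFin \o f) by exact/measurable_EFinP.
have ff' : {ae mu, forall x, D x -> (fun n => (f_ n x)%:E) @ \oo --> (f x)%:E}.
  by apply: aeS ff => x H Dx; apply/cvg_EFin; [exact: nearW|exact: H].
have fg' : {ae mu, forall x, forall n, D x -> (`|(f_ n x)%:E| <= g x)%E}.
  by apply: aeT => x n Dx /=; exact: fg.
have [iff _ cv] := dominated_convergence measurable_D mf_' mf' ff' ig fg'.
split=> //.
have hn n : intg (f_ n).
  apply: le_integrable ig; [exact: measurable_D|exact: mf_'|].
  by move=> x Dx /=; rewrite (le_trans (fg n x Dx))// lee_abs.
move: cv; have <- := int01_fin iff => /fine_cvgP[_].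
exact.
Qed.

Lemma int01_dominated (f_ : nat -> R -> R) f g :
  (forall n, measurable_fun D (f_ n)) -> measurable_fun D f ->
  {ae mu, forall x, D x -> f_ ^~ x @ \oo --> f x} ->
  intg g -> (forall n x, D x -> `|f_ n x| <= g x) ->
  intg f /\ (fun n => int01 (f_ n)) @ \oo --> int01 f.
Proof.
move=> mf_ mf ff ig fg; apply: (int01_dominated_ereal mf_ mf ff ig) => n x Dx.
by rewrite lee_fin fg.
Qed.

End UnitIntervalIntegral.

Section KuhnPolynomials.
Variable R : realType.
Implicit Types (y u : R).

Lemma bernoulli_ge y n : 0 <= y -> 1 + n%:R * y <= (1 + y) ^+ n.
Proof.
move=> y0; elim: n => [|n IH]; first by rewrite mul0r addr0 expr0.
have n0 : 0 <= n%:R :> R by [].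
rewrite exprS -natr1; have := ler_wpM2l (_ : 0 <= 1 + y) IH; move/(_ ltac:(lra)).
have : 0 <= n%:R * y * y by rewrite !mulr_ge0.
lra.
Qed.

Lemma bernoulli_le y n : 0 <= y <= 1 -> 1 - n%:R * y <= (1 - y) ^+ n.
Proof.
move=> /andP[y0 y1]; elim: n => [|n IH]; first by rewrite mul0r subr0 expr0.
have n0 : 0 <= n%:R :> R by [].
rewrite exprS -natr1; have := ler_wpM2l (_ : 0 <= 1 - y) IH; move/(_ ltac:(lra)).
have : 0 <= n%:R * y * y by rewrite !mulr_ge0.
lra.
Qed.

(** Kuhn's polynomials from his proof of the Weierstrass theorem: they approach the step at 1/2,
    since (2 u)^n tends to 0 on one side and to infinity on the other. *)
Definition kuhn (n : nat) u : R := (1 - u ^+ n) ^+ (2 ^ n).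

Lemma kuhn_01 n u : 0 <= u <= 1 -> 0 <= kuhn n u <= 1.
Proof.
move=> /andP[u0 u1]; have un1 : u ^+ n <= 1 by rewrite exprn_ile1.
have un0 : 0 <= u ^+ n by rewrite exprn_ge0.
by rewrite /kuhn exprn_ge0 ?exprn_ile1; lra.
Qed.

Lemma kuhn_cvg1 u : 0 <= u < 1 / 2 -> (fun n => kuhn n u) @ \oo --> (1 : R).
Proof.
move=> /andP[u0 u2].
apply: (@squeeze_cvgr _ _ _ _ (fun n => 1 - (2 * u) ^+ n) (fun=> 1)).
- apply: nearW => n; have u01 : 0 <= u <= 1 by lra.
  have /andP[_ ->] := kuhn_01 n u01; rewrite andbT.
  rewrite exprMn -natrX; apply: bernoulli_le.
  by rewrite exprn_ge0 ?exprn_ile1; lra.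
- rewrite -[X in _ --> X]subr0; apply: cvgB; first exact: cvg_cst.
  by apply: cvg_expr; rewrite ger0_norm; lra.
- exact: cvg_cst.
Qed.

Lemma kuhn_cvg0 u : 1 / 2 < u <= 1 -> (fun n => kuhn n u) @ \oo --> (0 : R).
Proof.
move=> /andP[u0 u2].
apply: (@squeeze_cvgr _ _ _ _ (fun=> 0) (fun n => ((2 * u)^-1) ^+ n)); last first.
- apply: cvg_expr; rewrite ger0_norm ?invr_ge0; last lra.
  by rewrite invf_lt1; lra.
- exact: cvg_cst.
- apply: nearW => n; have u01 : 0 <= u <= 1 by lra.
  have /andP[-> _] /= := kuhn_01 n u01.
  have un : 0 <= u ^+ n by rewrite exprn_ge0; lra.
  have p : 0 < (2 * u) ^+ n by rewrite exprn_gt0; lra.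
  rewrite exprVn -[leRHS]mul1r ler_pdivlMr//.
  have k0 : 0 <= kuhn n u by have /andP[] := kuhn_01 n u01.
  (* By Bernoulli (1 + u^n)^(2^n) >= (2 u)^n, while its product with [kuhn n u] is (1 - u^(2
     n))^(2^n) <= 1. *)
  apply: (@le_trans _ _ (kuhn n u * (1 + u ^+ n) ^+ (2 ^ n))).
    rewrite ler_wpM2l//; apply: le_trans (bernoulli_ge _ un).
    by rewrite natrX exprMn lerDr.
  rewrite /kuhn -exprMn -subr_sqr expr1n exprn_ile1//.
    by rewrite subr_ge0 -exprM exprn_ile1//; lra.
  by rewrite gerBl sqr_ge0.
Qed.

End KuhnPolynomials.

(** * Completeness of the cosines for integrable functions *)

Section CosineCompleteness.
Variable R : realType.
Local Notation mu := (@lebesgue_measure R).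
Local Notation D := (`]0, 1[%classic : set R).
Implicit Types (f g : R -> R).

Definition cosn (n : nat) (t : R) := cos (n%:R * pi * t).

Lemma cosn_le1 n t : `|cosn n t| <= 1.
Proof. by rewrite ler_norml cos_geN1 cos_le1. Qed.

Lemma cosn_continuous n : continuous (cosn n).
Proof.
move=> t; apply: continuous_comp; last exact: continuous_cos.
by apply: cvgM; [exact: cvg_cst|exact: cvg_id].
Qed.

Lemma continuous_measurable_D g : continuous g -> measurable_fun D g.
Proof. by move=> cg; apply: measurable_funTS; exact: continuous_measurable_fun. Qed.

Lemma cosn_measurable n : measurable_fun D (cosn n).
Proof. by apply: continuous_measurable_D; exact: cosn_continuous. Qed.

Definition cos_coef f n := int01 (fun t => f t * cosn n t).

Lemma intg_cosn f n : intg f -> intg (fun t => f t * cosn n t).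
Proof. by move=> hf; apply: (intgM hf (cosn_measurable n)) => x _; exact: cosn_le1. Qed.

(* By the product formula this class of g is stable under multiplication by
   cosn n, hence by polynomials in cosn 1. *)
Definition annihilated f g := [/\ measurable_fun D g,
  exists M, forall t, `|g t| <= M & forall m, cos_coef (fun t => f t * g t) m = 0].

Lemma annihilated_intg f g : intg f -> annihilated f g -> intg (fun t => f t * g t).
Proof. by move=> hf [mg [M gM] _]; apply: (intgM hf mg) => x _; exact: gM. Qed.

Lemma annihilated_lin f g h (a b : R) : intg f -> annihilated f g -> annihilated f h ->
  annihilated f (fun t => a * g t + b * h t).
Proof.
move=> hf ag ah; have ig := annihilated_intg hf ag; have ih := annihilated_intg hf ah.
case: ag ah => mg [M gM] g0 [mh [N hN] h0]; split.
- by apply: measurable_funD; apply: measurable_funM.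
- exists (`|a| * M + `|b| * N) => t.
  by rewrite (le_trans (ler_normD _ _))// !normrM lerD// ler_wpM2l.
- move=> m; transitivity (a * cos_coef (fun t => f t * g t) m + b * cos_coef (fun t => f t * h t) m).
    rewrite /cos_coef -int01Z; last exact: intg_cosn.
    rewrite -[X in _ + X]int01Z; last exact: intg_cosn.
    rewrite -int01D; [|by apply: intgZ; exact: intg_cosn|by apply: intgZ; exact: intg_cosn].
    by apply: int01_eq => t _; ring.
  by rewrite g0 h0 !mulr0 addr0.
Qed.

Lemma annihilated_cos f g : intg f -> annihilated f g ->
  annihilated f (fun t => g t * cosn 1 t).
Proof.
move=> hf ag; have ig := annihilated_intg hf ag; case: ag => mg [M gM] g0; split.
- by apply: measurable_funM => //; exact: cosn_measurable.
- exists M => t; rewrite normrM -[M]mulr1 ler_pM//; exact: cosn_le1.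
(* The product formula would involve the index -1 for m = 0, where the claim is just the vanishing
   of the coefficient of index 1. *)
- move=> m; case: m => [|m].
    rewrite -[RHS](g0 1%N); apply: int01_eq => t _.
    by rewrite {2}/cosn !mul0r cos0 mulr1 mulrA.
  transitivity (2^-1 * (cos_coef (fun t => f t * g t) m.+2 + cos_coef (fun t => f t * g t) m)).
    rewrite /cos_coef -int01D; [|exact: intg_cosn|exact: intg_cosn].
    rewrite -int01Z; last by apply: intgD; exact: intg_cosn.
    apply: int01_eq => t _; rewrite /cosn -!natr1.
    have -> : (m%:R + 1 + 1) * pi * t = (m%:R + 1) * pi * t + (0%:R + 1) * pi * t by ring.
    have -> : m%:R * pi * t = (m%:R + 1) * pi * t - (0%:R + 1) * pi * t by ring.
    by rewrite cosD cosB; field.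
  by rewrite !g0 addr0 mulr0.
Qed.

Lemma annihilated_eq f g h : (forall t, g t = h t) -> annihilated f g -> annihilated f h.
Proof. by move=> /funext ->. Qed.

Lemma annihilated_poly f g (a b : R) n : intg f -> annihilated f g ->
  annihilated f (fun t => g t * (a + b * cosn 1 t) ^+ n).
Proof.
move=> hf; elim: n g => [|n IH] g ag.
  by apply: annihilated_eq ag => t; rewrite expr0 mulr1.
have := IH _ (annihilated_lin a b hf ag (annihilated_cos hf ag)).
by apply: annihilated_eq => t; rewrite exprS; ring.
Qed.

Lemma annihilated_kuhn f g (a b : R) n : intg f -> annihilated f g ->
  annihilated f (fun t => g t * kuhn n (a + b * cosn 1 t)).
Proof.
rewrite /kuhn => hf; elim: (2 ^ n)%N g => [|N IH] g ag.
  by apply: annihilated_eq ag => t; rewrite expr0 mulr1.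
have := IH _ (annihilated_lin 1 (-1) hf ag (annihilated_poly a b n hf ag)).
by apply: annihilated_eq => t; rewrite [in RHS]exprS; ring.
Qed.

(* The indicator of ]x, 1[ is a bounded pointwise limit of the polynomials
   kuhn n (u t) in cosn 1 t. *)
Lemma cos_complete_tail f : intg f -> (forall n, cos_coef f n = 0) ->
  forall x, D x -> int01 (fun t => f t * (x < t)%R%:R) = 0.
Proof.
move=> hf h x Dx; have /andP[x0 x1] : 0 < x < 1 by move: Dx; rewrite /= in_itv.
have a1 : annihilated f (fun=> 1).
  split; [exact: measurable_cst|by exists 1 => t; rewrite normr1|].
  by move=> m; rewrite -[RHS](h m); apply: int01_eq => t _; rewrite mulr1.
(* As cos (pi t) decreases on ]0, 1[, u t < 1/2 exactly when t > x; the divisor 4 keeps [u] inside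
   [0, 1]. *)
pose u t := 1 / 2 + (cosn 1 t - cosn 1 x) / 4.
have uE t : u t = (1 / 2 - cosn 1 x / 4) + (1 / 4) * cosn 1 t by rewrite /u; field.
have u01 t : 0 <= u t <= 1.
  have := cosn_le1 1 t; have := cosn_le1 1 x; rewrite !ler_norml => /andP[? ?] /andP[? ?].
  by rewrite /u; apply/andP; split; lra.
have z n : int01 (fun t => f t * kuhn n (u t)) = 0.
  have [_ _ /(_ 0%N)] := annihilated_kuhn (1 / 2 - cosn 1 x / 4) (1 / 4) n hf a1.
  move=> <-; apply: int01_eq => t _.
  by rewrite {3}/cosn !mul0r cos0 mulr1 mul1r uE.
have mk n : measurable_fun D (fun t => f t * kuhn n (u t)).
  apply: measurable_funM; first exact: intg_measurable.
  have [m _ _] := annihilated_kuhn (1 / 2 - cosn 1 x / 4) (1 / 4) n hf a1.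
  by apply: eq_measurable_fun m => t _; rewrite mul1r uE.
have ml : measurable_fun D (fun t => f t * (x < t)%R%:R).
  apply: measurable_funM; first exact: intg_measurable.
  apply: (@measurable_funTS _ _ _ _ D).
  have -> : (fun t => (x < t)%R%:R : R) = \1_(`]x, +oo[).
    by apply/funext => t; rewrite indicE mem_setE in_itv /= andbT.
  by apply: measurable_indic; exact: measurable_itv.
have piI (t : R) : 0 < t < 1 -> 1%:R * pi * t \in `[0, pi].
  move=> /andP[t0 t1]; have p0 := pi_gt0 R; rewrite in_itv /= mul1r.
  by have := ltW p0; have := ltW t0; have := ltW t1 => a b c; apply/andP; split; [exact: mulr_ge0|exact: ler_piMr].
have cosmono (t s : R) : 0 < t < 1 -> 0 < s < 1 -> (cosn 1 t < cosn 1 s) = (s < t).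
  move=> ht hs; rewrite /cosn ltr_cos ?piI//.
  by rewrite mul1r ltr_pM2l// pi_gt0.
have Dx' : 0 < x < 1 by rewrite x0.
have cv t : D t -> t != x -> (fun n => f t * kuhn n (u t)) @ \oo --> f t * (x < t)%R%:R.
  move=> Dt tx; apply: cvgM; first exact: cvg_cst.
  have /andP[ua ub] := u01 t.
  have Dt' : 0 < t < 1 by move: Dt; rewrite /= in_itv.
  have [xt|xt] := ltP x t.
    apply: kuhn_cvg1; rewrite ua /=; have := cosmono t x Dt' Dx'.
    by rewrite xt => h1; rewrite /u; lra.
  apply: kuhn_cvg0; rewrite ub andbT; have := cosmono x t Dx' Dt'.
  have -> : t < x by rewrite lt_neqAle tx xt.
  by move=> h1; rewrite /u; lra.
have aecv : {ae mu, forall t, D t -> (fun n => f t * kuhn n (u t)) @ \oo --> f t * (x < t)%R%:R}.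
  exists [set x]; split; [exact: measurable_set1|exact: lebesgue_measure_set1|].
  move=> t /= H; apply: contrapT => /eqP tx; apply: H => Dt; exact: cv.
have [] := int01_dominated mk ml aecv (intg_norm hf).
  move=> n t Dt; rewrite normrM ler_piMr// ger0_norm.
    by have /andP[] := kuhn_01 n (u01 t).
  by have /andP[] := kuhn_01 n (u01 t).
move=> _; under eq_fun do rewrite z.
by move=> /(cvg_unique _ (cvg_cst 0)) <-.
Qed.

(** All primitives over ]0, y] vanish, as total integral minus tail, and by Lebesgue differentiation
    they determine f almost everywhere. *)
Lemma cos_complete f : intg f -> (forall n, cos_coef f n = 0) ->
  {ae mu, forall x, D x -> f x = 0}.
Proof.
move=> hf h; have tail := cos_complete_tail hf h.
have total : int01 f = 0.
  by rewrite -[RHS](h 0%N); apply: int01_eq => t _; rewrite /cosn !mul0r cos0 mulr1.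
pose g := f \_ D.
have ig : mu.-integrable setT (EFin \o g).
  by rewrite /g -restrict_EFin; exact: (iffLR (integrable_mkcond _ (@measurable_D R)) hf).
have lg : locally_integrable setT g.
  by apply: open_integrable_locally => //; exact: openT.
have iy y : mu.-integrable [set` Interval (BRight (0 : R)) (BRight y)] (EFin \o g).
  by apply: integrableS ig => //; exact: measurable_itv.
have F0 y : \int[mu]_(t in [set` Interval (BRight (0 : R)) (BRight y)]) g t = 0.
  rewrite /g -Rintegral_mkcondr.
  have [y1|y1] := leP 1 y.
    rewrite -[RHS]total; congr (Rintegral mu _ f).
    apply/seteqP; split=> t /=; rewrite !in_itv /=; first by case.
    by move=> /andP[t0 t1]; rewrite t0 t1 (le_trans (ltW t1) y1).
  have [y0|y0] := leP y 0.
    have -> : [set` Interval (BRight (0 : R)) (BRight y)] `&` D = set0.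
      by apply/seteqP; split=> t //=; rewrite !in_itv /= => -[/andP[a b] _]; lra.
    exact: Rintegral_set0.
  have Dy : D y by rewrite /= in_itv /= y0.
  transitivity (int01 (fun t => f t - f t * (y < t)%R%:R)).
    rewrite setIC Rintegral_mkcondr; apply: int01_eq => t Dt; rewrite patchE.
    move: Dt; rewrite /= in_itv /= => /andP[t0 t1].
    rewrite mem_setE in_itv /= t0 /=; case: ltP => ty; first by rewrite mulr1 subrr.
    by rewrite mulr0 subr0.
  rewrite int01B// ?total ?tail ?subrr//.
  apply: (@intgM _ _ _ 1) => //; last by move=> t _; case: (y < t); rewrite ?normr1 ?normr0.
  apply: (@measurable_funTS _ _ _ _ D).
  have -> : (fun t => (y < t)%R%:R : R) = \1_(`]y, +oo[).
    by apply/funext => t; rewrite indicE mem_setE in_itv /= andbT.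
  by apply: measurable_indic; exact: measurable_itv.
have := @FTC1 R g (BRight 0) iy lg.
apply: aeS => x H Dx; have /andP[x0 x1] : 0 < x < 1 by move: Dx; rewrite /= in_itv.
have [_] := H x0.
rewrite (_ : (fun y => _) = cst 0); last by apply/funext => y; rewrite F0.
rewrite derive1_cst /g patchE mem_set//.
Qed.

End CosineCompleteness.

Section FundamentalTheorem.
Variable R : realType.
Local Notation mu := (@lebesgue_measure R).
Local Notation D := (`]0, 1[%classic : set R).

Lemma int01_FTC (F f : R -> R) : (forall x, is_derive x (1 : R) F (f x)) -> continuous f ->
  int01 f = F 1 - F 0.
Proof.
move=> hF cf; have cF := is_derive_continuous hF.
have h : (\int[mu]_(x in `[0%R, 1%R]) (f x)%:E = (F 1)%:E - (F 0)%:E)%E.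
  apply: continuous_FTC2 => //.
  - exact: continuous_subspaceT.
  - split=> [x _||]; first by case: (hF x).
    + by apply: cvg_at_right_filter; exact: cF.
    + by apply: cvg_at_left_filter; exact: cF.
  - by move=> x _; rewrite derive1E; have [_ ->] := hF x.
have mf : measurable_fun (`]0, 1[%classic : set R) (EFin \o f).
  by apply/measurable_EFinP; exact: continuous_measurable_D.
have ic : mu.-integrable `[0, 1]%classic (EFin \o f).
  by apply: continuous_compact_integrable; [exact: segment_compact|exact: continuous_subspaceT].
have io : intg f.
  by apply: integrableS ic => //; exact: subset_itv_oo_cc.
apply: EFin_inj; rewrite int01_fin//.
by rewrite EFinB -h [RHS]integral_itv_bndoo.
Qed.

End FundamentalTheorem.

(** * The Riesz-Fischer theorem for cosine series *)

Section RieszFischer.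
Variable R : realType.
Local Notation mu := (@lebesgue_measure R).
Local Notation D := (`]0, 1[%classic : set R).
Implicit Types (c : nat -> R).

(** The squared L_2 norm of [cosn n] on ]0, 1[. *)
Definition cos_weight (n : nat) : R := if n == 0%N then 1 else 1 / 2.

Lemma int01_cosn n : int01 (cosn n) = (n == 0%N)%:R :> R.
Proof.
have [->|n0] := eqVneq n 0%N.
  rewrite -[RHS](int01_cst 1); apply: int01_eq => t _.
  by rewrite /cosn !mul0r cos0.
pose w : R := n%:R * pi; have w0 : w != 0 by rewrite mulf_neq0 ?pnatr_eq0// gt_eqF// pi_gt0.
have hF (x : R) : is_derive x (1 : R) (fun t => w^-1 * sin (w * t)) (cosn n x).
  apply: is_derive_eq; rewrite /GRing.scale /= /cosn -/w !mulr1.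
  by rewrite mulrCA; field.
rewrite (int01_FTC hF (@cosn_continuous R n)) mulr1 mulr0 sin0.
by rewrite /w sin_natpi !mulr0 subrr.
Qed.

Lemma cosn_prod m n t : cosn m t * cosn n t =
  (cosn (m + n) t + cosn (m - n + (n - m)) t) / 2 :> R.
Proof.
wlog nm : m n / (n <= m)%N => [H|].
  have [nm|/ltnW mn] := leqP n m; first exact: H.
  by rewrite mulrC H// addnC [(m - n + _)%N]addnC.
have -> : (n - m = 0)%N by apply/eqP; rewrite subn_eq0.
rewrite addn0 /cosn natrD natrB// !mulrDl !mulNr cosD cosB; by field.
Qed.

Lemma intg_cos n : intg (@cosn R n).
Proof. by apply: (intg_bounded (cosn_measurable n)) => x _; exact: cosn_le1. Qed.

Lemma cosn_orth m n : int01 (fun t => cosn m t * cosn n t) =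
  (if m == n then cos_weight n else 0) :> R.
Proof.
rewrite (@int01_eq R _ (fun t => 2^-1 * (cosn (m + n) t + cosn (m - n + (n - m)) t))); last first.
  by move=> t _; rewrite cosn_prod mulrC.
rewrite int01Z; last by apply: intgD; exact: intg_cos.
rewrite int01D ?int01_cosn; [|exact: intg_cos|exact: intg_cos].
rewrite addn_eq0 [(_ - _ + _ == _)%N]addn_eq0 !subn_eq0 -eqn_leq /cos_weight.
have [->|mn] := eqVneq m n.
  by rewrite andbb; rewrite ?eqxx; case: (n == 0%N) => /=; rewrite ?mulr1n ?mulr0n; field.
rewrite (_ : (m == 0%N) && (n == 0%N) = false) ?addr0 ?mulr0//.
by apply/negP => /andP[/eqP m0 /eqP n0]; rewrite m0 n0 eqxx in mn.
Qed.

Lemma intg_sum (I : Type) (r : seq I) (F : I -> R -> R) : (forall i, intg (F i)) ->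
  intg (fun t => \sum_(i <- r) F i t).
Proof.
move=> hF; elim: r => [|i r IH].
  by apply: (@intg_eq _ (fun=> 0)); [move=> t _; rewrite big_nil|exact: intg_cst].
apply: (@intg_eq _ (fun t => F i t + \sum_(j <- r) F j t)); last exact: intgD.
by move=> t _; rewrite big_cons.
Qed.

Lemma int01_sum (I : Type) (r : seq I) (F : I -> R -> R) : (forall i, intg (F i)) ->
  int01 (fun t => \sum_(i <- r) F i t) = \sum_(i <- r) int01 (F i).
Proof.
move=> hF; elim: r => [|i r IH].
  by rewrite big_nil -[RHS](int01_cst (0 : R)); apply: int01_eq => t _; rewrite big_nil.
rewrite big_cons -IH -int01D//; last exact: intg_sum.
by apply: int01_eq => t _; rewrite big_cons.
Qed.

Definition cos_poly c n m (t : R) := \sum_(n <= k < m) c k * cosn k t.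

Lemma intg_cos_poly c n m : intg (cos_poly c n m).
Proof. by apply: intg_sum => k; apply: intgZ; exact: intg_cos. Qed.

Lemma cos_poly_measurable c n m : measurable_fun D (cos_poly c n m).
Proof. by apply: intg_measurable; exact: intg_cos_poly. Qed.

Lemma cos_poly_le c n m t : `|cos_poly c n m t| <= \sum_(n <= k < m) `|c k|.
Proof.
apply: le_trans (ler_norm_sum _ _ _) _; apply: ler_sum => k _.
by rewrite normrM ler_piMr// cosn_le1.
Qed.

Lemma cos_coef_poly c n m j : cos_coef (cos_poly c n m) j =
  if (n <= j < m)%N then c j * cos_weight j else 0.
Proof.
rewrite /cos_coef (@int01_eq R _ (fun t => \sum_(n <= k < m) c k * (cosn k t * cosn j t))); last first.
  by move=> t _; rewrite /cos_poly mulr_suml; apply: eq_bigr => k _; rewrite mulrA.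
rewrite int01_sum; last first.
  by move=> k; apply: intgZ; apply: (intgM (intg_cos k) (cosn_measurable j)) => x _; exact: cosn_le1.
transitivity (\sum_(n <= k < m) if k == j then c j * cos_weight j else 0).
  apply: eq_bigr => k _; rewrite int01Z.
    by rewrite cosn_orth; case: eqP => [->|]; rewrite ?mulr0.
  by apply: (intgM (intg_cos k) (cosn_measurable j)) => x _; exact: cosn_le1.
by rewrite -big_mkcond /= big_nat1_eq.
Qed.

Lemma intg_cos_polyM c n m f : intg f -> intg (fun t => f t * cos_poly c n m t).
Proof.
move=> hf; apply: (intgM hf (cos_poly_measurable c n m)) => x _; exact: cos_poly_le.
Qed.

Lemma cos_poly_sq c n m : int01 (fun t => cos_poly c n m t ^+ 2) =
  \sum_(n <= k < m) c k ^+ 2 * cos_weight k.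
Proof.
rewrite (@int01_eq R _ (fun t => \sum_(n <= k < m) c k * (cos_poly c n m t * cosn k t))); last first.
  move=> t _; rewrite expr2 {2}/cos_poly mulr_sumr; apply: eq_bigr => k _.
  by rewrite mulrCA.
rewrite int01_sum; last by move=> k; apply: intgZ; apply: intg_cosn; exact: intg_cos_poly.
rewrite [LHS]big_nat [RHS]big_nat; apply: eq_bigr => k kmn.
rewrite int01Z; last by apply: intg_cosn; exact: intg_cos_poly.
by rewrite -/(cos_coef _ _) cos_coef_poly kmn mulrA expr2.
Qed.

Lemma cos_poly_sq_le c n m : int01 (fun t => cos_poly c n m t ^+ 2) <=
  \sum_(n <= k < m) c k ^+ 2.
Proof.
rewrite cos_poly_sq; apply: ler_sum => k _; rewrite ler_piMr ?sqr_ge0//.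
by rewrite /cos_weight; case: ifP => _ //; lra.
Qed.

(** In place of the Cauchy-Schwarz inequality: |f| <= f^2 / (2 e) + e / 2, integrated over an
    interval of length 1. *)
Lemma int01_abs_le f (e : R) : 0 < e -> intg f -> intg (fun t => f t ^+ 2) ->
  int01 (fun t => f t ^+ 2) <= e ^+ 2 -> int01 (fun t => `|f t|) <= e.
Proof.
move=> e0 hf hf2 fe.
have h : forall t, D t -> `|f t| <= (2 * e)^-1 * f t ^+ 2 + e / 2.
  move=> t _; have := sqr_ge0 (`|f t| - e); rewrite sqrrB real_normK ?num_real// => H.
  have E : (2 * e)^-1 * f t ^+ 2 + e / 2 = (f t ^+ 2 + e ^+ 2) / (2 * e).
    by field; rewrite gt_eqF.
  by rewrite E ler_pdivlMr ?mulr_gt0//; lra.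
have i2 : intg (fun t => (2 * e)^-1 * f t ^+ 2) by exact: intgZ.
apply: le_trans (int01_le (intg_norm hf) (intgD i2 (intg_cst _)) h) _.
rewrite int01D//; last exact: intg_cst.
rewrite int01_cst int01Z//.
apply: (@le_trans _ _ ((2 * e)^-1 * e ^+ 2 + e / 2)).
  by rewrite lerD2r ler_wpM2l// invr_ge0 mulr_ge0// ltW.
rewrite le_eqVlt; apply/orP; left; apply/eqP; field; by rewrite gt_eqF.
Qed.

Lemma half_sum (n : nat) : \sum_(j < n) (1 / 2) ^+ j <= 2 :> R.
Proof.
have -> : \sum_(j < n) (1 / 2) ^+ j = 2 - 2 * (1 / 2) ^+ n :> R.
  elim: n => [|n IH]; first by rewrite big_ord0 expr0 mulr1 subrr.
  by rewrite big_ord_recr /= IH exprSr; field.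
by rewrite gerBl mulr_ge0// exprn_ge0//; lra.
Qed.

(** Cut points chosen so that every block from [M j] on has L_2 norm at most 2^-j; [j <= M j] makes
    each index eventually covered. *)
Lemma fast_subsequence c (B : R) : (forall n, \sum_(k < n) c k ^+ 2 <= B) ->
  exists M : nat -> nat, (forall j, (j <= M j)%N) /\ (forall j, (M j <= M j.+1)%N) /\
  forall j m, \sum_(M j <= k < m) c k ^+ 2 <= ((1 / 2) ^+ j) ^+ 2.
Proof.
move=> cB; have c0 k : 0 <= c k ^+ 2 by exact: sqr_ge0.
have H j : exists N, forall n, \sum_(N <= k < n) c k ^+ 2 < ((1 / 2) ^+ j) ^+ 2.
  by apply: (bounded_sum_tail c0 cB); rewrite !exprn_gt0//; lra.
pose N j := projT1 (cid (H j)).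
have HN j : forall n, \sum_(N j <= k < n) c k ^+ 2 < ((1 / 2) ^+ j) ^+ 2 := projT2 (cid (H j)).
pose M := fix M j := if j is i.+1 then maxn (M i).+1 (N i.+1) else N 0%N.
have NM j : (N j <= M j)%N by case: j => //= j; rewrite leq_maxr.
have MS j : (M j < M j.+1)%N by rewrite /= leq_maxl.
exists M; split; last split.
- by elim=> // j IH; exact: leq_ltn_trans IH (MS j).
- by move=> j; exact: ltnW.
- move=> j m; have [mM|Mm] := leqP m (M j).
    by rewrite big_geq// !exprn_ge0//; lra.
  apply: ltW; apply: le_lt_trans (HN j m).
  by rewrite [leRHS](big_cat_nat (n := M j)) ?(ltnW Mm)//= lerDr sumr_ge0.
Qed.

Lemma riesz_fischer c (B : R) : (forall n, \sum_(k < n) c k ^+ 2 <= B) ->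
  exists q : R -> R, [/\ measurable_fun D q, (\int[mu]_(x in D) (q x ^+ 2)%:E < +oo)%E &
  forall n, cos_coef q n = c n * cos_weight n].
Proof.
move=> cB; have [M [jM [MS MT]]] := fast_subsequence cB.
pose s j := cos_poly c 0 (M j); pose d j := cos_poly c (M j) (M j.+1).
have sS j t : s j.+1 t = s j t + d j t.
  by rewrite /s /d /cos_poly (big_cat_nat (n := M j)).
have id2 j : intg (fun t => d j t ^+ 2).
  by apply: (@intg_eq _ (fun t => d j t * d j t)) => //; apply: intg_cos_polyM; exact: intg_cos_poly.
have h0 j : 0 < (1 / 2) ^+ j :> R by rewrite exprn_gt0//; lra.
have intd j : int01 (fun t => `|d j t|) <= (1 / 2) ^+ j.
  apply: int01_abs_le => //; first exact: intg_cos_poly.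
  by apply: le_trans (cos_poly_sq_le _ _ _) _; exact: MT.
(* The sum of the absolute values of the blocks has integral at most 2, so it is finite almost
   everywhere and dominates all partial sums. *)
pose G (t : R) := (\sum_(j <oo) `|d j t|%:E)%E.
have md j : measurable_fun D (fun t => `|d j t|%:E).
  apply/measurable_EFinP; apply: measurableT_comp => //; exact: cos_poly_measurable.
have d0 j t : D t -> (0 <= `|d j t|%:E)%E by rewrite lee_fin.
have mG : measurable_fun D G by exact: ge0_emeasurable_sum.
have intG : (\int[mu]_(t in D) G t <= 2%:E)%E.
  have := integral_nneseries mu (@measurable_D R) md d0.
  rewrite -/(G _) => ->.
  apply: lime_le; first by apply: is_cvg_nneseries => n _ _; exact: integral_ge0.
  apply: nearW => n; rewrite (eq_bigr (fun j => (int01 (fun t => `|d j t|))%:E)); last first.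
    by move=> j _; rewrite int01_fin//; apply: intg_norm; exact: intg_cos_poly.
  rewrite sumEFin lee_fin big_mkord; apply: le_trans (half_sum n).
  by apply: ler_sum => j _.
have G0 t : D t -> (0 <= G t)%E by move=> Dt; apply: nneseries_ge0 => n _ _; exact: d0.
have iG : mu.-integrable D G.
  apply/integrableP; split=> //; apply: le_lt_trans (ltry 2).
  apply: le_trans intG; rewrite le_eqVlt; apply/orP; left; apply/eqP.
  by apply: eq_integral => t /set_mem Dt; rewrite gee0_abs// G0.
have [N [mN N0 NG]] := integrable_ae (@measurable_D R) iG.
(* Cutting off the null set where [G] is infinite gives convergence at every point of ]0, 1[, hence
   a measurable limit. *)
pose f j t := s j t * \1_(~` N) t.
have i01 (t : R) : (\1_(~` N) t = 0 :> R) \/ (\1_(~` N) t = 1 :> R).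
  by rewrite indicE; case: in_mem; [right|left].
have fs t : ~ N t -> forall j, f j t = s j t.
  by move=> nN j; rewrite /f indicE mem_set// mulr1.
have fin t : D t -> ~ N t -> G t \is a fin_num.
  by move=> Dt; apply: contra_notP => H; apply: NG => /= /(_ Dt).
have s_series t j : s j t = s 0%N t + \sum_(i < j) d i t.
  elim: j => [|j IH]; first by rewrite big_ord0 addr0.
  by rewrite big_ord_recr /= sS IH addrA.
have partial t j : (\sum_(i < j) `|d i t|%:E <= G t)%E.
  rewrite -(big_mkord xpredT (fun i => `|d i t|%:E)).
  by apply: nneseries_lim_ge => i _ _; rewrite lee_fin.
have cvs t : D t -> cvgn (fun j => f j t).
  move=> Dt; have [Nt|nN] := pselect (N t).
    rewrite (_ : (fun j => f j t) = fun=> 0); first exact: is_cvg_cst.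
    by apply/funext => j; rewrite /f indicE memNset ?mulr0//= => /(_ Nt).
  rewrite (_ : (fun j => f j t) = (fun j => s 0%N t + series (d^~ t) j)); last first.
    by apply/funext => j; rewrite fs// s_series seriesEord.
  apply: is_cvgD; first exact: is_cvg_cst.
  apply: (@real_sum_cvg _ _ (fun i => `|d i t|) (fine (G t))) => // n.
  by rewrite -lee_fin fineK ?fin// -sumEFin.
pose q t := limn (fun j => f j t).
have mf j : measurable_fun D (f j).
  apply: measurable_funM; first exact: cos_poly_measurable.
  by apply: measurable_funTS; apply: measurable_indic; exact: measurableC.
have fq t : D t -> f ^~ t @ \oo --> q t by move=> Dt; exact: cvs.
have mq : measurable_fun D q by apply: (measurable_fun_cvg mf).
have notN : {ae mu, forall t, ~ N t}.
  by exists N; split=> // t /= /contrapT.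
exists q; split=> //.
- have ms j : measurable_fun D (fun t => (f j t ^+ 2)%:E).
    by apply/measurable_EFinP; exact: measurable_funX.
  have f20 j t : D t -> (0 <= (f j t ^+ 2)%:E)%E by rewrite lee_fin sqr_ge0.
  (* Fatou's lemma transfers the bound [B] on the squared norms of the partial sums to [q]. *)
  have := fatou mu (@measurable_D R) ms f20.
  rewrite [X in (X <= _)%E -> _](_ : _ = \int[mu]_(x in D) (q x ^+ 2)%:E)%E; last first.
    apply: eq_integral => t /set_mem Dt.
    have cq : (fun j => (f j t ^+ 2)%:E) @ \oo --> (q t ^+ 2)%:E.
      apply/cvg_EFin; first exact: nearW.
      by rewrite expr2; under eq_fun do rewrite /= expr2; apply: cvgM; exact: fq.
    by have [-> _] := cvg_limn_einf_sup cq.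
  move=> H; apply: le_lt_trans H _; apply: (@le_lt_trans _ _ B%:E); last exact: ltry.
  have sB j : (\int[mu]_(x in D) (f j x ^+ 2)%:E <= B%:E)%E.
    apply: (@le_trans _ _ (\int[mu]_(x in D) (s j x ^+ 2)%:E)%E).
      apply: ge0_le_integral => //.
      - by move=> t Dt; exact: f20.
      - exact: ms.
      - by apply/measurable_EFinP; apply: measurable_funX; exact: cos_poly_measurable.
      - move=> t Dt; rewrite lee_fin /f; have [->|->] := i01 t; first by rewrite mulr0 expr0n sqr_ge0.
        by rewrite mulr1.
    rewrite -int01_fin; last first.
      by apply: (@intg_eq _ (fun t => s j t * s j t)) => //; apply: intg_cos_polyM; exact: intg_cos_poly.
    rewrite lee_fin; apply: le_trans (cos_poly_sq_le _ _ _) _.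
    by rewrite big_mkord.
  rewrite limn_einf_lim; apply: lime_le; first exact: is_cvg_einfs.
  apply: nearW => n; apply: le_trans (sB n).
  by apply: ereal_inf_lbound; exists n => /=.
- move=> n.
  have fb j t : D t -> (`|f j t * cosn n t|%:E <= `|s 0%N t|%:E + G t)%E.
    move=> Dt; apply: (@le_trans _ _ (`|s j t|%:E)).
      rewrite lee_fin !normrM -[leRHS]mulr1 ler_pM ?mulr_ge0 ?cosn_le1//.
      by rewrite ler_piMr//; have [->|->] := i01 t; rewrite ?normr1 ?normr0.
    rewrite s_series; apply: (@le_trans _ _ (`|s 0%N t|%:E + `|\sum_(i < j) d i t|%:E)%E).
      by rewrite -EFinD lee_fin ler_normD.
    rewrite leeD2l//; apply: le_trans (partial t j); rewrite sumEFin lee_fin.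
    exact: ler_norm_sum.
  have ib : mu.-integrable D (fun t => `|s 0%N t|%:E + G t)%E.
    apply: integrableD => //.
    by apply: intg_norm; exact: intg_cos_poly.
  have mfc j : measurable_fun D (fun t => f j t * cosn n t).
    by apply: measurable_funM => //; exact: cosn_measurable.
  have mqc : measurable_fun D (fun t => q t * cosn n t).
    by apply: measurable_funM => //; exact: cosn_measurable.
  have cv : {ae mu, forall t, D t -> (fun j => f j t * cosn n t) @ \oo --> q t * cosn n t}.
    by apply: aeT => t Dt; apply: cvgM; [exact: fq|exact: cvg_cst].
  have [iq H] := int01_dominated_ereal mfc mqc cv ib fb.
  (* The n-th coefficients of the partial sums are constant from j > n on, and dominated convergence
     passes them to [q]. *)
  have E j : (n < j)%N -> int01 (fun t => f j t * cosn n t) = c n * cos_weight n.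
    move=> nj; have <- : cos_coef (s j) n = c n * cos_weight n.
      by rewrite cos_coef_poly leq0n (leq_trans nj (jM j)).
    apply: int01_ae_eq.
    + apply: (intgM _ (cosn_measurable n)) => [|x _]; last exact: cosn_le1.
      apply: (@intg_le _ _ (fun t => `|s j t|)) => //; last by apply: intg_norm; exact: intg_cos_poly.
      by move=> t _; rewrite normrM ler_piMr//; have [->|->] := i01 t; rewrite ?normr1 ?normr0.
    + by apply: intg_cosn; exact: intg_cos_poly.
    + by apply: aeS notN => t nN _; rewrite fs.
  apply: (cvg_unique _ H); first exact: Rhausdorff.
  apply: cvg_near_cst; exists n.+1 => // j /= nj; exact: E.
Qed.

End RieszFischer.

(** * The characteristic function *)

Section ConvolutionDerivative.
Variable R : realType.
Local Notation mu := (@lebesgue_measure R).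
Local Notation D := (`]0, 1[%classic : set R).

Lemma norm_bool_le1 (b : bool) : `|b%:R| <= 1 :> R.
Proof. by case: b; rewrite ?normr1 ?normr0 ?ler01. Qed.

(** Dominated convergence along the radii 1 / (n + 1): the intervals shrink to the point [x], which
    is a null set. *)
Lemma small_interval_int (f : R -> R) (x e : R) : intg f -> 0 < e ->
  exists2 d : R, 0 < d & forall h : R, `|h| < d ->
   int01 (fun t => `|f t| * (`|x - t| <= `|h|)%R%:R) < e.
Proof.
move=> hf e0.
have mi (r : R) : measurable_fun D (fun t : R => (`|x - t| <= r)%R%:R : R).
  apply: (@measurable_funTS _ _ _ _ D).
  have -> : (fun t => (`|x - t| <= r)%R%:R : R) = \1_(`[x - r, x + r]).
    apply/funext => t; rewrite indicE mem_setE in_itv /=.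
    by rewrite ler_distlC lerBlDr.
  by apply: measurable_indic; exact: measurable_itv.
have ib (r : R) : intg (fun t => `|f t| * (`|x - t| <= r)%R%:R).
  apply: (intgM (intg_norm hf) (mi r)) => t _; exact: norm_bool_le1.
have [_ cv] : intg (fun=> 0 : R) /\
    (fun n => int01 (fun t => `|f t| * (`|x - t| <= n.+1%:R^-1)%R%:R)) @ \oo --> int01 (fun=> 0 : R).
  apply: (@int01_dominated _ _ _ (fun t => `|f t|)).
  - by move=> n; apply: intg_measurable; exact: ib.
  - exact: measurable_cst.
  - exists [set x]; split; [exact: measurable_set1|exact: lebesgue_measure_set1|].
    move=> t /= H; apply: contrapT => /eqP tx; apply: H => Dt.
    have xt : 0 < `|x - t| by rewrite normr_gt0 subr_eq0 eq_sym.
    apply: cvg_near_cst; exists (Num.trunc (`|x - t|^-1)).+1 => // n /= nt.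
    suff -> : (`|x - t| <= n.+1%:R^-1) = false by rewrite mulr0.
    apply/negbTE; rewrite -ltNge -[ltRHS]invrK ltf_pV2 ?posrE ?invr_gt0//.
    apply: lt_trans (truncnS_gt _) _; by rewrite ltr_nat ltnS.
  - exact: intg_norm.
  - move=> n t _; by rewrite normrM normr_id ler_piMr// norm_bool_le1.
rewrite int01_cst in cv.
have /cvgrPdist_lt/(_ _ e0)[n _ /(_ n (leqnn n))/=] := cv.
rewrite sub0r normrN => /(le_lt_trans (ler_norm _)) H.
exists (n.+1%:R^-1) => // h hn; apply: le_lt_trans H.
apply: int01_le => // t _; rewrite ler_wpM2l//.
have [xh|//] := leP `|x - t| `|h|.
by rewrite (le_trans xh (ltW hn)).
Qed.

(* A kernel that is C^1 except for a jump of the derivative at 0. *)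
Definition kinked (k dk : R -> R) (C : R) := forall u h : R, `|u| <= 1 -> `|h| <= 1 ->
  `|k (u + h) - k u - h * dk u| <= C * (h ^+ 2 + `|h| * (`|u| <= `|h|)%R%:R).

(** The error of the difference quotient is C times |h| times the integral of |f|, plus C times the
    integral of |f| over |x - t| <= |h|; the kink matters only there, and both parts tend to 0. *)
Lemma is_derive_conv (k dk f : R -> R) (C x : R) : 0 <= C -> 0 <= x <= 1 -> intg f ->
  kinked k dk C ->
  (forall y, intg (fun t => k (y - t) * f t)) -> intg (fun t => dk (x - t) * f t) ->
  is_derive x (1 : R) (fun y => int01 (fun t => k (y - t) * f t))
    (int01 (fun t => dk (x - t) * f t)).
Proof.
move=> C0 /andP[x0 x1] hf kk ik idk.
set F := fun y => int01 _; set L := int01 _.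
have mi (r : R) : measurable_fun D (fun t : R => (`|x - t| <= r)%R%:R : R).
  apply: (@measurable_funTS _ _ _ _ D).
  have -> : (fun t => (`|x - t| <= r)%R%:R : R) = \1_(`[x - r, x + r]).
    apply/funext => t; rewrite indicE mem_setE in_itv /=.
    by rewrite ler_distlC lerBlDr.
  by apply: measurable_indic; exact: measurable_itv.
have ib (r : R) : intg (fun t => `|f t| * (`|x - t| <= r)%R%:R).
  apply: (intgM (intg_norm hf) (mi r)) => t _; exact: norm_bool_le1.
pose A := int01 (fun t => `|f t|).
have A0 : 0 <= A by apply: Rintegral_ge0.
have est h : `|h| <= 1 -> `|F (x + h) - F x - h * L| <=
    C * `|h| * (`|h| * A + int01 (fun t => `|f t| * (`|x - t| <= `|h|)%R%:R)).
  move=> h1; rewrite /F /L -int01Z// -int01B// -int01B; last exact: intgZ; last exact: intgB.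
  apply: le_trans (int01_norm _) _; first by apply: intgB; [exact: intgB|exact: intgZ].
  have -> : C * `|h| * (`|h| * A + int01 (fun t => `|f t| * (`|x - t| <= `|h|)%R%:R)) =
     int01 (fun t => C * `|h| * (`|h| * `|f t| + `|f t| * (`|x - t| <= `|h|)%R%:R)).
    rewrite int01Z; last by apply: intgD => //; apply: intgZ; exact: intg_norm.
    by rewrite int01D// ?int01Z//; [exact: intg_norm|apply: intgZ; exact: intg_norm].
  apply: int01_le.
  - by apply: intg_norm; apply: intgB; [exact: intgB|exact: intgZ].
  - by apply: intgZ; apply: intgD => //; apply: intgZ; exact: intg_norm.
  - move=> t; rewrite /= in_itv /= => /andP[t0 t1].
    have -> : k (x + h - t) * f t - k (x - t) * f t - h * (dk (x - t) * f t) =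
       (k ((x - t) + h) - k (x - t) - h * dk (x - t)) * f t.
      by rewrite (_ : x + h - t = (x - t) + h); [ring|ring].
    rewrite normrM; have := kk (x - t) h; move/(_ _ h1).
    have -> : `|x - t| <= 1 by rewrite ler_norml; lra.
    move=> /(_ isT) H; apply: le_trans (ler_wpM2r (normr_ge0 _) H) _.
    by rewrite le_eqVlt; apply/orP; left; apply/eqP; rewrite -(real_normK (num_real h)); ring.
suff cv : (fun h => h^-1 *: (F (h *: 1 + x) - F x)) @ 0^' --> L.
  split; first by apply/cvg_ex; exists L; exact: cv.
  by apply/cvg_lim => //; exact: cv.
apply/cvgrPdist_lt => e e0.
pose e' := e / (2 * (C + 1)).
have C1 : 0 < C + 1 by lra.
have e'0 : 0 < e' by rewrite divr_gt0// mulr_gt0.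
have [d d0 Hd] := small_interval_int x hf e'0.
have d2 : 0 < e' / (A + 1) by rewrite divr_gt0//; lra.
rewrite near_withinE; near=> h => h0.
have h1 : `|h| <= 1 by near: h; exists 1 => //= y; rewrite /= sub0r normrN => /ltW.
have hd : `|h| < d by near: h; exists d => //= y; rewrite /= sub0r normrN.
have hA : `|h| < e' / (A + 1) by near: h; exists (e' / (A + 1)) => //= y; rewrite /= sub0r normrN.
rewrite distrC /GRing.scale /= mulr1 [h + x]addrC.
have hp : 0 < `|h| by rewrite normr_gt0.
rewrite -(ltr_pM2l hp) -normrM.
have -> : h * (h^-1 * (F (x + h) - F x) - L) = F (x + h) - F x - h * L by field.
apply: le_lt_trans (est h h1) _.
rewrite -mulrA mulrCA ltr_pM2l//.
have := Hd h hd; set J := int01 _ => HJ.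
have hA' : `|h| * A <= e'.
  rewrite ltr_pdivlMr in hA; last lra.
  by apply: ltW; apply: le_lt_trans hA; rewrite ler_wpM2l//; lra.
have ee : e' * (2 * (C + 1)) = e by rewrite /e' divfK// gt_eqF// mulr_gt0.
have J0 : 0 <= J by apply: Rintegral_ge0 => t _; rewrite mulr_ge0.
have : C * (`|h| * A + J) <= C * (e' + e') by rewrite ler_wpM2l// lerD// ltW.
nra.
Unshelve. all: by end_near. Qed.

End ConvolutionDerivative.

Section FundamentalSolutions.
Variables (R : realType) (la : R[i]).
Implicit Types (x y t u h : R).

Local Notation rho := (sqrtC la).
Local Notation K := (sin_div la).
Definition cos_rho t : R[i] := ccos (rho * t%:C).

Lemma rho2 : rho * rho = la. Proof. by rewrite -expr2 sqrtCK. Qed.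

Lemma rhoK t : rho * csin (rho * t%:C) = la * K t.
Proof.
rewrite /sin_div; case: eqVneq => [->|l0]; first by rewrite sqrtC0 !mul0r.
by rewrite -{3}rho2 -mulrA [X in _ = _ * X]mulrC divfK// sqrtC_eq0.
Qed.

Lemma cos_rho0 : cos_rho 0 = 1. Proof. by rewrite /cos_rho mulr0 ccos0. Qed.

Lemma sin_div0 : K 0 = 0.
Proof. by rewrite /sin_div mulr0 csin0 mul0r; case: ifP. Qed.

Lemma cos_rhoN t : cos_rho (- t) = cos_rho t.
Proof. by rewrite /cos_rho rmorphN mulrN ccosN. Qed.

Lemma sin_divN t : K (- t) = - K t.
Proof.
rewrite /sin_div; case: ifP => _; first by rewrite rmorphN.
by rewrite rmorphN mulrN csinN mulNr.
Qed.

Lemma cos_rhoD x y : cos_rho (x + y) = cos_rho x * cos_rho y - la * K x * K y.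
Proof.
rewrite /cos_rho rmorphD mulrDr ccosD; congr (_ - _).
rewrite /sin_div; case: eqVneq => [->|l0]; first by rewrite sqrtC0 !mul0r csin0 mul0r.
by rewrite -{3}rho2; field; rewrite sqrtC_eq0.
Qed.

Lemma sin_divD x y : K (x + y) = K x * cos_rho y + cos_rho x * K y.
Proof.
rewrite /cos_rho /sin_div; case: eqVneq => [->|l0].
  by rewrite sqrtC0 !mul0r ccos0 mulr1 mul1r rmorphD.
by rewrite rmorphD mulrDr csinD mulrDl mulrAC mulrA.
Qed.

Lemma cos_rho_sqr t : cos_rho t ^+ 2 + la * K t ^+ 2 = 1.
Proof.
have := cos_rhoD t (- t); rewrite subrr cos_rho0 cos_rhoN sin_divN => ->.
by ring.
Qed.

Lemma cder_cos_rho t : cder cos_rho t (- la * K t).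
Proof. by rewrite mulNr -rhoK -mulNr; exact: cder_ccos. Qed.

Lemma cder_sin_div t : cder K t (cos_rho t).
Proof.
rewrite /cos_rho /sin_div; have [l0|l0] := eqVneq la 0.
  by rewrite l0 sqrtC0 mul0r ccos0; exact: cder_real.
have r0 : rho != 0 by rewrite sqrtC_eq0.
have := cderZ rho^-1 (cder_csin rho t); rewrite mulKf//.
by apply: cder_ext => s; rewrite mulrC.
Qed.

Definition rbound x : R := expR (normc rho * x).

Lemma rbound_le x y : x <= y -> rbound x <= rbound y.
Proof. by move=> xy; rewrite ler_expR ler_wpM2l// normc_ge0. Qed.

Lemma rbound_ge0 x : 0 <= rbound x. Proof. exact: expR_ge0. Qed.

Lemma cos_rho_le t x : `|t| <= x -> normc (cos_rho t) <= rbound x.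
Proof.
move=> tx; apply: le_trans (rbound_le tx); rewrite /cos_rho /ccos.
have e (z : R[i]) : normc z = normc rho * `|t| -> normc (cexp z) <= rbound `|t|.
  by move=> zE; rewrite normc_cexp ler_expR -zE (le_trans (ler_norm _))// Re_le_normc.
have ni (z : R[i]) : normc ('i%C * z) = normc z.
  rewrite normcM (_ : normc 'i%C = 1) ?mul1r//=.
  by rewrite expr0n expr1n add0r sqrtr1.
have n1 : normc (rho * t%:C) = normc rho * `|t| by rewrite normcM normc_real.
rewrite normcM normcV normc_nat ler_pdivrMr//.
apply: le_trans (normc_le_add _ _) _; rewrite mulr_natr mulr2n.
by apply: lerD; apply: e; rewrite ?normcN ni.
Qed.

Lemma between_norm x a b (c : R) : Num.min a b <= x <= Num.max a b ->
  `|a| <= c -> `|b| <= c -> `|x| <= c.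
Proof.
rewrite ge_min le_max => /andP[/orP[h1|h1] /orP[h2|h2]]; rewrite !ler_norml => /andP[? ?] /andP[? ?];
  by apply/andP; split; lra.
Qed.

Lemma sin_div_lip u v x : `|u| <= x -> `|v| <= x ->
  normc (K v - K u) <= 2 * rbound x * `|v - u|.
Proof.
move=> ux vx; apply: (cder_MVT cder_sin_div) => s su.
by apply: cos_rho_le; exact: between_norm su ux vx.
Qed.

Lemma sin_div_le t x : `|t| <= x -> normc (K t) <= 2 * rbound x * x.
Proof.
move=> tx; have := @sin_div_lip 0 t x; rewrite normr0 sin_div0 !subr0 => H.
apply: le_trans (H _ tx) _; first exact: le_trans tx.
by rewrite ler_wpM2l// mulr_ge0// rbound_ge0.
Qed.

Lemma cos_rho_lip u v x : `|u| <= x -> `|v| <= x ->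
  normc (cos_rho v - cos_rho u) <= 2 * (normc la * (2 * rbound x * x)) * `|v - u|.
Proof.
move=> ux vx; apply: (cder_MVT cder_cos_rho) => s su.
rewrite normcM normcN ler_wpM2l ?normc_ge0//.
by apply: sin_div_le; exact: between_norm su ux vx.
Qed.

(** All points met lie in [-2, 2], hence [rbound 2]; the two factors 2 come from the two mean value
    estimates. *)
Lemma sin_div_taylor u h : `|u| <= 1 -> `|h| <= 1 ->
  normc (K (u + h) - K u - h%:C * cos_rho u) <= 2 * (2 * (normc la * (2 * rbound 2 * 2))) * h ^+ 2.
Proof.
move=> u1 h1; set B := 2 * (normc la * _).
pose f s := K (u + s) - s%:C * cos_rho u.
have hf s : cder f s (cos_rho (u + s) - cos_rho u).
  apply: (@cder_ext _ (fun s => K u * cos_rho s + cos_rho u * K s - cos_rho u * s%:C)).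
    by move=> r; rewrite /f sin_divD [r%:C * _]mulrC.
  have := cderB (cderD (cderZ (K u) (cder_cos_rho s)) (cderZ (cos_rho u) (cder_sin_div s)))
    (cderZ (cos_rho u) (cder_real s)).
  by rewrite cos_rhoD mulr1; congr (cder _ _ _); ring.
have := @cder_MVT _ f _ 0 h (B * `|h|) hf.
rewrite /f mul0r addr0 !subr0 -(real_normK (num_real h)) => H.
have -> : K (u + h) - K u - h%:C * cos_rho u = K (u + h) - h%:C * cos_rho u - K u by ring.
have -> : 2 * B * `|h| ^+ 2 = 2 * (B * `|h|) * `|h| by ring.
apply: H => s sh.
have sh' : `|s| <= `|h| by apply: between_norm sh _ _; rewrite ?normr0.
have := @cos_rho_lip u (u + s) 2; rewrite -/B => L.
apply: le_trans (L _ _) _.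
- by lra.
- by rewrite (le_trans (ler_normD _ _))//; lra.
- rewrite addrAC subrr add0r ler_wpM2l// /B !mulr_ge0 ?normc_ge0 ?rbound_ge0//.
Qed.

(** Cutting the kernel at 0 turns an integral with moving endpoint into a convolution over all of
    ]0, 1[. The cut kernel is continuous, with a jump of the derivative at 0. *)
Definition sin_div_pos u : R[i] := if 0 < u then K u else 0.
Definition cos_rho_pos u : R[i] := if 0 < u then cos_rho u else 0.

(** If [u] and [u + h] are on the same side of 0, Taylor's formula applies. Otherwise |u| and |u +
    h| are O(|h|), hence so are the kernel values, and the kink term absorbs them. *)
Lemma sin_div_pos_kinked : exists2 C : R, 0 <= C & forall u h, `|u| <= 1 -> `|h| <= 1 ->
  normc (sin_div_pos (u + h) - sin_div_pos u - h%:C * cos_rho_pos u) <=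
  C * (h ^+ 2 + `|h| * (`|u| <= `|h|)%R%:R).
Proof.
set A := 2 * (2 * (normc la * (2 * rbound 2 * 2))).
have A0 : 0 <= A by rewrite /A !mulr_ge0 ?normc_ge0 ?rbound_ge0.
pose M := 2 * rbound 2; have M0 : 0 <= M by rewrite mulr_ge0// rbound_ge0.
exists (A + 2 * M) => [|u h u1 h1]; first by rewrite addr_ge0// mulr_ge0.
have h20 : 0 <= h ^+ 2 by exact: sqr_ge0.
have b0 : 0 <= `|h| * (`|u| <= `|h|)%R%:R by rewrite mulr_ge0.
have lip v : `|v| <= 2 -> normc (K v) <= M * `|v|.
  move=> v2; have := @sin_div_lip 0 v 2; rewrite normr0 sin_div0 !subr0 => H.
  exact: H.
rewrite /sin_div_pos /cos_rho_pos; case: (ltP 0 u) => u0; case: (ltP 0 (u + h)) => uh.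
- apply: le_trans (sin_div_taylor u1 h1) _.
  set b := `|h| * _ in b0 *.
  have H1 : 0 <= A * b by rewrite mulr_ge0.
  have H2 : 0 <= 2 * M * (h ^+ 2 + b) by apply: mulr_ge0; [exact: mulr_ge0|exact: addr_ge0].
  have -> : (A + 2 * M) * (h ^+ 2 + b) = A * h ^+ 2 + A * b + 2 * M * (h ^+ 2 + b) by ring.
  by move: H1 H2; move: (A * _) (A * _) (2 * M * _) => *; lra.
- have uh' : `|u| <= `|h| by rewrite gtr0_norm// ler_normr; apply/orP; right; lra.
  rewrite uh' mulr1 sub0r; apply: le_trans (normc_le_sub _ _) _.
  rewrite normcN normcM normc_real.
  have H1 := lip u ltac:(lra).
  have H2 := @cos_rho_le u 2 ltac:(lra).
  have H3 : normc (K u) <= M * `|h| by apply: le_trans H1 _; rewrite ler_wpM2l.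
  have H4 : `|h| * normc (cos_rho u) <= `|h| * rbound 2 by rewrite ler_wpM2l.
  have r0 := rbound_ge0 2.
  have H5 : 0 <= `|h| * rbound 2 by rewrite mulr_ge0.
  have H6 : 0 <= A * (h ^+ 2 + `|h|) by rewrite mulr_ge0// addr_ge0.
  have H7 : 0 <= M * h ^+ 2 by rewrite mulr_ge0.
  by rewrite mulrDl; move: H3 H4 H5 H6 H7; rewrite /M; lra.
- rewrite mulr0 !subr0.
  have hu : `|u + h| <= `|h| by rewrite gtr0_norm// ler_normr; apply/orP; left; lra.
  have uh' : `|u| <= `|h| by rewrite ler0_norm// ler_normr; apply/orP; left; lra.
  have H1 := lip (u + h) ltac:(lra).
  rewrite uh' mulr1.
  have H3 : normc (K (u + h)) <= M * `|h| by apply: le_trans H1 _; rewrite ler_wpM2l.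
  have H6 : 0 <= A * (h ^+ 2 + `|h|) by rewrite mulr_ge0// addr_ge0.
  have H7 : 0 <= M * h ^+ 2 by rewrite mulr_ge0.
  have H8 : 0 <= M * `|h| by rewrite mulr_ge0.
  by rewrite mulrDl; lra.
- rewrite mulr0 !subr0 normc0; apply: mulr_ge0; last exact: addr_ge0.
  by apply: addr_ge0 => //; exact: mulr_ge0.
Qed.

End FundamentalSolutions.

Section ComplexIntegral.
Variable R : realType.
Local Notation mu := (@lebesgue_measure R).
Local Notation D := (`]0, 1[%classic : set R).
Implicit Types (f g q k : R -> R[i]) (x y t : R).

Lemma cReM (z w : R[i]) : complex.Re (z * w) =
  complex.Re z * complex.Re w - complex.Im z * complex.Im w.
Proof. by case: z w => [? ?] []. Qed.

Lemma cImM (z w : R[i]) : complex.Im (z * w) =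
  complex.Re z * complex.Im w + complex.Im z * complex.Re w.
Proof. by case: z w => [? ?] []. Qed.

Lemma cReD (z w : R[i]) : complex.Re (z + w) = complex.Re z + complex.Re w.
Proof. by case: z w => [? ?] []. Qed.

Lemma cImD (z w : R[i]) : complex.Im (z + w) = complex.Im z + complex.Im w.
Proof. by case: z w => [? ?] []. Qed.

Lemma complex_ext (z w : R[i]) : complex.Re z = complex.Re w ->
  complex.Im z = complex.Im w -> z = w.
Proof. by case: z w => [? ?] [? ?] /= -> ->. Qed.

Definition cint f : R[i] := cintegral D f.

Lemma cintE f : cint f = int01 (fun t => complex.Re (f t)) +i* int01 (fun t => complex.Im (f t)).
Proof. by []. Qed.

Definition cintg f := intg (fun t => complex.Re (f t)) /\ intg (fun t => complex.Im (f t)).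

Definition cbm g := [/\ measurable_fun D (fun t => complex.Re (g t)),
  measurable_fun D (fun t => complex.Im (g t)) &
  exists M, forall t, D t -> normc (g t) <= M].

Lemma cint_eq f g : (forall t, D t -> f t = g t) -> cint f = cint g.
Proof.
by move=> fg; rewrite !cintE; congr (_ +i* _); apply: int01_eq => t Dt; rewrite fg.
Qed.

Lemma cintg_eq f g : (forall t, D t -> f t = g t) -> cintg f -> cintg g.
Proof. by move=> fg [h1 h2]; split; [apply: intg_eq h1|apply: intg_eq h2] => t Dt; rewrite fg. Qed.

Lemma cintD f g : cintg f -> cintg g -> cint (fun t => f t + g t) = cint f + cint g.
Proof.
move=> [f1 f2] [g1 g2]; rewrite !cintE; apply: complex_ext => /=.
  by rewrite -int01D//; apply: int01_eq => t _; rewrite cReD.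
by rewrite -int01D//; apply: int01_eq => t _; rewrite cImD.
Qed.

Lemma cintgM g f : cbm g -> cintg f -> cintg (fun t => g t * f t).
Proof.
move=> [m1 m2 [M gM]] [f1 f2].
have b1 t : D t -> `|complex.Re (g t)| <= M by move=> /gM; apply: le_trans; exact: Re_le_normc.
have b2 t : D t -> `|complex.Im (g t)| <= M by move=> /gM; apply: le_trans; exact: Im_le_normc.
split.
  apply: (intg_eq _ (intgB (intgM f1 m1 b1) (intgM f2 m2 b2))) => t _.
  by rewrite cReM [complex.Re (f t) * _]mulrC [complex.Im (f t) * _]mulrC.
apply: (intg_eq _ (intgD (intgM f2 m1 b1) (intgM f1 m2 b2))) => t _.
by rewrite cImM [complex.Re (f t) * _]mulrC [complex.Im (f t) * _]mulrC.
Qed.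

Lemma cbm_cst c : cbm (fun=> c).
Proof. by split; [exact: measurable_cst|exact: measurable_cst|exists (normc c)]. Qed.

Lemma cintgZ c f : cintg f -> cintg (fun t => c * f t).
Proof. exact: cintgM (cbm_cst c). Qed.

Lemma cintZ c f : cintg f -> cint (fun t => c * f t) = c * cint f.
Proof.
move=> [f1 f2]; rewrite !cintE; apply: complex_ext; rewrite ?cReM ?cImM /=.
  rewrite -!int01Z// -int01B; [|exact: intgZ|exact: intgZ].
  by apply: int01_eq => t _; rewrite cReM.
rewrite -!int01Z// -int01D; [|exact: intgZ|exact: intgZ].
by apply: int01_eq => t _; rewrite cImM.
Qed.

Lemma cbmD f g : cbm f -> cbm g -> cbm (fun t => f t + g t).
Proof.
move=> [f1 f2 [M fM]] [g1 g2 [N gN]]; split.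
- by apply: (eq_measurable_fun _ _ (measurable_funD f1 g1)) => t _; rewrite cReD.
- by apply: (eq_measurable_fun _ _ (measurable_funD f2 g2)) => t _; rewrite cImD.
- by exists (M + N) => t Dt; rewrite (le_trans (normc_le_add _ _))// lerD ?fM ?gN.
Qed.

Lemma cbmM f g : cbm f -> cbm g -> cbm (fun t => f t * g t).
Proof.
move=> [f1 f2 [M fM]] [g1 g2 [N gN]]; split.
- apply: (eq_measurable_fun _ _ (measurable_funB (measurable_funM f1 g1) (measurable_funM f2 g2))) => t _.
  by rewrite cReM.
- apply: (eq_measurable_fun _ _ (measurable_funD (measurable_funM f1 g2) (measurable_funM f2 g1))) => t _.
  by rewrite cImM.
- by exists (M * N) => t Dt; rewrite normcM ler_pM ?normc_ge0 ?fM ?gN.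
Qed.

Lemma cbm_eq f g : (forall t, f t = g t) -> cbm f -> cbm g.
Proof. by move=> /funext ->. Qed.

Lemma cbm_cder f df M : (forall t, cder f t (df t)) -> (forall t, D t -> normc (f t) <= M) -> cbm f.
Proof.
move=> hf fM; split; last by exists M.
  by apply: continuous_measurable_D; apply: is_derive_continuous => x; case: (hf x) => h _; exact: h.
by apply: continuous_measurable_D; apply: is_derive_continuous => x; case: (hf x) => _ h; exact: h.
Qed.

Lemma cbm_real (p : R -> R) (M : R) : measurable_fun D p -> (forall t, D t -> `|p t| <= M) ->
  cbm (fun t => (p t)%:C).
Proof.
move=> mp pM; split; [exact: mp|exact: measurable_cst|].
by exists M => t Dt; rewrite normc_real pM.
Qed.

Lemma measurable_lt_r y : measurable_fun D (fun t => (t < y)%R%:R : R).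
Proof.
apply: (@measurable_funTS _ _ _ _ D).
have -> : (fun t => (t < y)%R%:R : R) = \1_(`]-oo, y[).
  by apply/funext => t; rewrite indicE mem_setE in_itv /=.
by apply: measurable_indic; exact: measurable_itv.
Qed.

Lemma measurable_lt_l y : measurable_fun D (fun t => (y < t)%R%:R : R).
Proof.
apply: (@measurable_funTS _ _ _ _ D).
have -> : (fun t => (y < t)%R%:R : R) = \1_(`]y, +oo[).
  by apply/funext => t; rewrite indicE mem_setE in_itv /= andbT.
by apply: measurable_indic; exact: measurable_itv.
Qed.

Lemma cder_conv k dk q (C x : R) : 0 <= C -> 0 <= x <= 1 -> cintg q ->
  (forall u h, `|u| <= 1 -> `|h| <= 1 -> normc (k (u + h) - k u - h%:C * dk u) <=
     C * (h ^+ 2 + `|h| * (`|u| <= `|h|)%R%:R)) ->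
  (forall y, cbm (fun t => k (y - t))) -> cbm (fun t => dk (x - t)) ->
  cder (fun y => cint (fun t => k (y - t) * q t)) x (cint (fun t => dk (x - t) * q t)).
Proof.
move=> C0 x01 [q1 q2] kk mk mdk.
pose k1 u := complex.Re (k u); pose k2 u := complex.Im (k u).
pose d1 u := complex.Re (dk u); pose d2 u := complex.Im (dk u).
have h1 : kinked k1 d1 C.
  move=> u h u1 h1; apply: le_trans (kk u h u1 h1); apply: le_trans (Re_le_normc _).
  rewrite /k1 /d1; case: (k (u + h)) (k u) (dk u) => [a b] [c d] [e f] /=.
  by rewrite mul0r subr0.
have h2 : kinked k2 d2 C.
  move=> u h u1 h2; apply: le_trans (kk u h u1 h2); apply: le_trans (Im_le_normc _).
  rewrite /k2 /d2; case: (k (u + h)) (k u) (dk u) => [a b] [c d] [e f] /=.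
  by rewrite mul0r addr0.
have ii (p : R -> R) (r : R -> R) (M : R) : intg p -> measurable_fun D r ->
    (forall t, D t -> `|r t| <= M) -> intg (fun t => r t * p t).
  move=> hp hr rM; apply: (intg_eq _ (intgM hp hr rM)) => t _; exact: mulrC.
have i1 p y : intg p -> intg (fun t => k1 (y - t) * p t).
  move=> hp; have [m1 _ [M H]] := mk y; apply: ii hp m1 _ => t Dt.
  by apply: le_trans (Re_le_normc _) (H t Dt).
have i2 p y : intg p -> intg (fun t => k2 (y - t) * p t).
  move=> hp; have [_ m1 [M H]] := mk y; apply: ii hp m1 _ => t Dt.
  by apply: le_trans (Im_le_normc _) (H t Dt).
have j1 p : intg p -> intg (fun t => d1 (x - t) * p t).
  move=> hp; have [m1 _ [M H]] := mdk; apply: ii hp m1 _ => t Dt.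
  by apply: le_trans (Re_le_normc _) (H t Dt).
have j2 p : intg p -> intg (fun t => d2 (x - t) * p t).
  move=> hp; have [_ m1 [M H]] := mdk; apply: ii hp m1 _ => t Dt.
  by apply: le_trans (Im_le_normc _) (H t Dt).
have D1 p (hp : intg p) := is_derive_conv C0 x01 hp h1 (fun y => i1 p y hp) (j1 p hp).
have D2 p (hp : intg p) := is_derive_conv C0 x01 hp h2 (fun y => i2 p y hp) (j2 p hp).
split.
- have -> : (fun y => complex.Re (cint (fun t => k (y - t) * q t))) =
    (fun y => int01 (fun t => k1 (y - t) * complex.Re (q t))) \-
    (fun y => int01 (fun t => k2 (y - t) * complex.Im (q t))).
    apply/funext => y /=; rewrite -int01B; [|exact: i1|exact: i2].
    by apply: int01_eq => t _; rewrite cReM.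
  have -> : complex.Re (cint (fun t => dk (x - t) * q t)) =
    int01 (fun t => d1 (x - t) * complex.Re (q t)) - int01 (fun t => d2 (x - t) * complex.Im (q t)).
    rewrite -int01B; [|exact: j1|exact: j2].
    by apply: int01_eq => t _; rewrite cReM.
  by have := is_deriveB (D1 _ q1) (D2 _ q2).
- have -> : (fun y => complex.Im (cint (fun t => k (y - t) * q t))) =
    (fun y => int01 (fun t => k1 (y - t) * complex.Im (q t))) \+
    (fun y => int01 (fun t => k2 (y - t) * complex.Re (q t))).
    apply/funext => y /=; rewrite -int01D; [|exact: i1|exact: i2].
    by apply: int01_eq => t _; rewrite cImM.
  have -> : complex.Im (cint (fun t => dk (x - t) * q t)) =
    int01 (fun t => d1 (x - t) * complex.Im (q t)) + int01 (fun t => d2 (x - t) * complex.Re (q t)).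
    rewrite -int01D; [|exact: j1|exact: j2].
    by apply: int01_eq => t _; rewrite cImM.
  by have := is_deriveD (D1 _ q2) (D2 _ q1).
Qed.

Lemma cder_cderive f x l : cder f x l -> cderive f x = l.
Proof.
move=> [h1 h2]; apply: complex_ext; rewrite /cderive /= derive1E.
  by have [_ ->] := h1.
by have [_ ->] := h2.
Qed.

(** By |a| <= a^2 + 1 on an interval of finite measure. *)
Lemma in_L2_cintg q : in_L2 q -> cintg q.
Proof.
move=> [m1 m2 fin].
have E t : normc (q t) ^+ 2 = complex.Re (q t) ^+ 2 + complex.Im (q t) ^+ 2.
  by case: (q t) => a b /=; rewrite sqr_sqrtr// addr_ge0 ?sqr_ge0.
have mn : measurable_fun D (fun t => normc (q t) ^+ 2).
  apply: (eq_measurable_fun _ _ (measurable_funD (measurable_funX 2 m1) (measurable_funX 2 m2))) => t _.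
  by rewrite E.
have i2 : intg (fun t => normc (q t) ^+ 2).
  apply/integrableP; split; first exact/measurable_EFinP.
  under eq_integral do rewrite /= ger0_norm ?exprn_ge0 ?normc_ge0//.
  exact: fin.
have ib : intg (fun t => normc (q t) ^+ 2 + 1) by apply: intgD => //; exact: intg_cst.
have le (a b : R) : a ^+ 2 <= b -> `|a| <= b + 1.
  by move=> ab; have := sqr_ge0 (`|a| - 1); rewrite sqrrB real_normK ?num_real//; have := normr_ge0 a; lra.
split; apply: intg_le ib => // t _; apply: le; rewrite E.
  by rewrite lerDl sqr_ge0.
by rewrite lerDr sqr_ge0.
Qed.

End ComplexIntegral.

(** * Closed form of the characteristic determinant for a = 0 and a = 1 *)

Section CharacteristicFunction.
Variables (R : realType) (la : R[i]) (q : R -> R[i]).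
Local Notation mu := (@lebesgue_measure R).
Local Notation D := (`]0, 1[%classic : set R).
Local Notation K := (sin_div la).
Local Notation Kc := (cos_rho la).
Hypothesis hq : cintg q.

Lemma normr_D (t : R) : D t -> `|t| <= 1.
Proof. by rewrite /= in_itv /= ler_norml => /andP[? ?]; lra. Qed.

Lemma cbm_sin_div : cbm K.
Proof. by apply: (cbm_cder (cder_sin_div la)) => t /normr_D t1; exact: (sin_div_le la t1). Qed.

Lemma cbm_cos_rho : cbm Kc.
Proof. by apply: (cbm_cder (cder_cos_rho la)) => t /normr_D t1; exact: (cos_rho_le la t1). Qed.

Lemma cbm_sin_divB (y : R) : cbm (fun t => K (y - t)).
Proof.
apply: (@cbm_eq _ (fun t => K y * Kc t + - Kc y * K t)).
  by move=> t; rewrite sin_divD cos_rhoN sin_divN; ring.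
by apply: cbmD; apply: cbmM; [exact: cbm_cst|exact: cbm_cos_rho|exact: cbm_cst|exact: cbm_sin_div].
Qed.

Lemma cbm_cos_rhoB (y : R) : cbm (fun t => Kc (y - t)).
Proof.
apply: (@cbm_eq _ (fun t => Kc y * Kc t + la * K y * K t)).
  by move=> t; rewrite cos_rhoD cos_rhoN sin_divN; ring.
by apply: cbmD; apply: cbmM; [exact: cbm_cst|exact: cbm_cos_rho|exact: cbm_cst|exact: cbm_sin_div].
Qed.

Lemma cbm_indic_r (y : R) : cbm (fun t => ((t < y)%R%:R : R)%:C).
Proof. apply: (cbm_real (measurable_lt_r y)) => t _; exact: norm_bool_le1. Qed.

Lemma cbm_indic_l (y : R) : cbm (fun t => ((y < t)%R%:R : R)%:C).
Proof. apply: (cbm_real (measurable_lt_l y)) => t _; exact: norm_bool_le1. Qed.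

Lemma cbm_pos (g : R -> R[i]) (y : R) : cbm (fun t => g (y - t)) ->
  cbm (fun t => if 0 < y - t then g (y - t) else 0).
Proof.
move=> hg; apply: (cbm_eq _ (cbmM (cbm_indic_r y) hg)) => t.
by rewrite subr_gt0; case: ifP; rewrite ?mul1r ?mul0r.
Qed.

Lemma cbm_neg (g : R -> R[i]) (y : R) : cbm (fun t => g (- (y - t))) ->
  cbm (fun t => if 0 < - (y - t) then g (- (y - t)) else 0).
Proof.
move=> hg; apply: (cbm_eq _ (cbmM (cbm_indic_l y) hg)) => t.
by rewrite opprB subr_gt0; case: ifP; rewrite ?mul1r ?mul0r.
Qed.

Lemma cder_conv_left (x : R) : 0 <= x <= 1 ->
  cder (fun y => cint (fun t => sin_div_pos la (y - t) * q t)) x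
    (cint (fun t => cos_rho_pos la (x - t) * q t)).
Proof.
move=> x01; have [C C0 HC] := sin_div_pos_kinked la.
apply: (cder_conv C0 x01 hq HC) => [y|]; apply: cbm_pos; [exact: cbm_sin_divB|exact: cbm_cos_rhoB].
Qed.

Lemma cder_conv_right (x : R) : 0 <= x <= 1 ->
  cder (fun y => cint (fun t => sin_div_pos la (- (y - t)) * q t)) x
    (cint (fun t => - cos_rho_pos la (- (x - t)) * q t)).
Proof.
move=> x01; have [C C0 HC] := sin_div_pos_kinked la.
apply: (@cder_conv R (fun u => sin_div_pos la (- u)) (fun u => - cos_rho_pos la (- u)) q C x C0 x01 hq).
- move=> u h u1 h1; have := HC (- u) (- h); rewrite !normrN => /(_ u1 h1).
  by rewrite sqrrN opprD rmorphN mulrN mulNr opprK.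
- move=> y; apply: cbm_neg; apply: (cbm_eq _ (cbmM (cbm_cst (-1)) (cbm_sin_divB y))) => t.
  by rewrite sin_divN mulN1r.
- apply: (@cbm_eq _ (fun t => -1 * cos_rho_pos la (- (x - t)))); first by move=> t; rewrite mulN1r.
  apply: cbmM; first exact: cbm_cst.
  by apply: cbm_neg; apply: (cbm_eq _ (cbm_cos_rhoB x)) => t; rewrite cos_rhoN.
Qed.

Lemma cintegral_cond (P : set R) (g : R -> R[i]) :
  cintegral (P `&` D) g = cint (fun t => if t \in P then g t else 0).
Proof.
rewrite /cint /cintegral !Rintegral_mkcondl; apply: complex_ext => /=;
  by apply: int01_eq => t _; rewrite patchE; case: ifP.
Qed.

(** Valid for every real [x], also outside [0, 1], as the two-sided derivatives at the endpoints
    require. *)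
Lemma ointegral_left (x : R) :
  ointegral 0 x (fun t => K (x - t) * q t) = cint (fun t => sin_div_pos la (x - t) * q t).
Proof.
rewrite /ointegral; case: ifPn => x0; rewrite cintegral_cond.
  apply: cint_eq => t; rewrite /= in_itv /= => /andP[t0 t1].
  rewrite mem_setE in_itv /= (ltW t0) /= /sin_div_pos subr_gt0.
  case: (ltgtP t x) => [tx|tx|->] //; first by rewrite mul0r.
  by rewrite subrr sin_div0 mul0r.
rewrite -ltNge in x0.
have z : cint (fun=> 0 : R[i]) = 0 by rewrite cintE /= int01_cst.
rewrite (@cint_eq _ _ (fun=> 0)); last first.
  move=> t; rewrite /= in_itv /= => /andP[t0 t1].
  by rewrite mem_setE in_itv /= (lt_geF t0) andbF.
rewrite z oppr0 -z; apply: cint_eq => t; rewrite /= in_itv /= => /andP[t0 t1].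
by rewrite /sin_div_pos subr_gt0 ifF ?mul0r//; apply/negbTE; rewrite -leNgt ltW// (lt_trans x0).
Qed.

(** The orientation from 1 down to [x] gives a minus sign, which the oddness of the kernel absorbs
    by reversing its argument. *)
Lemma ointegral_right (x : R) :
  ointegral 1 x (fun t => K (x - t) * q t) = cint (fun t => sin_div_pos la (- (x - t)) * q t).
Proof.
have z : cint (fun=> 0 : R[i]) = 0 by rewrite cintE /= int01_cst.
rewrite /ointegral; case: ifPn => x1; rewrite cintegral_cond.
  rewrite (@cint_eq _ _ (fun=> 0)); last first.
    move=> t; rewrite /= in_itv /= => /andP[t0 t1].
    by rewrite mem_setE in_itv /= (lt_geF t1).
  rewrite (@cint_eq _ (fun t => sin_div_pos la _ * _) (fun=> 0))// => t.
  rewrite /= in_itv /= => /andP[t0 t1].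
  by rewrite /sin_div_pos opprB subr_gt0 ifF ?mul0r//; apply/negbTE; rewrite -leNgt ltW// (lt_le_trans t1).
set f := fun t => if t \in _ then _ else _.
have E t : D t -> sin_div_pos la (- (x - t)) * q t = -1 * f t.
  rewrite /= in_itv /= => /andP[t0 t1].
  rewrite /f mem_setE in_itv /= (ltW t1) andbT /sin_div_pos opprB subr_gt0.
  case: (ltgtP x t) => [xt|xt|->]; last by rewrite subrr sin_div0 !mul0r mulr0.
    by rewrite -opprB sin_divN mulN1r mulNr.
  by rewrite mul0r mulr0.
rewrite (cint_eq E) cintZ ?mulN1r//.
apply: (@cintg_eq _ (fun t => -1 * (sin_div_pos la (- (x - t)) * q t))).
  by move=> t Dt; rewrite E// mulN1r mulN1r opprK.
apply: cintgZ; apply: cintgM => //; apply: cbm_neg.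
apply: (cbm_eq _ (cbmM (cbm_cst (-1)) (cbm_sin_divB x))) => t.
by rewrite sin_divN mulN1r.
Qed.

(** The function against which the determinant integrates [q], up to a sign for a = 1. Under t -> 1
    - t it is multiplied by (-1)^al. *)
Definition boundary_kernel (al : nat) (t : R) : R[i] := K t + (-1) ^+ al * K (1 - t).

Lemma cbm_psi al : cbm (boundary_kernel al).
Proof.
apply: cbmD; first exact: cbm_sin_div.
by apply: cbmM; [exact: cbm_cst|exact: cbm_sin_divB].
Qed.

Lemma cderive_solS (a x : R) : cderive (solS a la) x = Kc (x - a).
Proof.
apply: cder_cderive; rewrite /solS.
apply: (@cder_ext _ (fun s => K (- a) * Kc s + Kc (- a) * K s)).
  by move=> s; rewrite sin_divD; ring.
have -> : Kc (x - a) = K (- a) * (- la * K x) + Kc (- a) * Kc x by rewrite cos_rhoD; ring.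
by apply: cderD; apply: cderZ; [exact: cder_cos_rho|exact: cder_sin_div].
Qed.

Lemma cderive_solC (a x : R) (phi : R -> R[i]) l :
  (forall y, ointegral a y (fun t => K (y - t) * q t) = phi y) -> cder phi x l ->
  cderive (solC q a la) x = - la * K (x - a) + l.
Proof.
move=> E hphi; apply: cder_cderive; rewrite /solC.
apply: (@cder_ext _ (fun s => (Kc (- a) * Kc s + - (la * K (- a)) * K s) + phi s)).
  move=> s; rewrite E; congr (_ + _); rewrite -/(cos_rho la (s - a)) cos_rhoD; ring.
apply: cderD => //.
have -> : - la * K (x - a) = Kc (- a) * (- la * K x) + - (la * K (- a)) * Kc x.
  by rewrite sin_divD; ring.
by apply: cderD; apply: cderZ; [exact: cder_cos_rho|exact: cder_sin_div].
Qed.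

Lemma Kc1 : Kc 1 = cos_sqrt la. Proof. by rewrite /cos_rho /cos_sqrt mulr1. Qed.

Lemma cint_psi al : cint (fun t => boundary_kernel al t * q t) =
  cint (fun t => K t * q t) + (-1) ^+ al * cint (fun t => K (1 - t) * q t).
Proof.
have i1 : cintg (fun t => K t * q t) by apply: cintgM => //; exact: cbm_sin_div.
have i2 : cintg (fun t => K (1 - t) * q t) by apply: cintgM => //; exact: cbm_sin_divB.
rewrite -cintZ// -cintD//; last exact: cintgZ.
by apply: cint_eq => t _; rewrite /boundary_kernel; ring.
Qed.

(** At x = 0 the integrals vanish, so [q] enters only through the solution at 1. The rest is the
    determinant, simplified by cos^2 + lambda (sin / rho)^2 = 1 and g^2 = 1. *)
Lemma char_fun_left al : char_fun q 0 ((-1) ^+ al) la =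
  2 - 2 * (-1) ^+ al * cos_sqrt la - cint (fun t => boundary_kernel al t * q t).
Proof.
rewrite cint_psi /char_fun !cderive_solS.
rewrite (cderive_solC ointegral_left (cder_conv_left (x := 0) _)) ?lexx ?ler01//.
rewrite (cderive_solC ointegral_left (cder_conv_left (x := 1) _)) ?lexx ?ler01//.
rewrite /solC /solS !ointegral_left !subr0.
have z (x : R) (g : R -> R[i]) : x <= 0 ->
   cint (fun t => (if 0 < x - t then g (x - t) else 0) * q t) = 0.
  move=> x0; rewrite (@cint_eq _ _ (fun=> 0)) ?cintE /= ?int01_cst// => t.
  rewrite /= in_itv /= => /andP[t0 t1].
  by rewrite subr_gt0 ifF ?mul0r//; apply/negbTE; rewrite -leNgt ltW// (le_lt_trans x0).
rewrite (z 0 (sin_div la))// (z 0 (cos_rho la))//.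
have p (g : R -> R[i]) : cint (fun t => (if 0 < 1 - t then g (1 - t) else 0) * q t) =
    cint (fun t => g (1 - t) * q t).
  by apply: cint_eq => t; rewrite /= in_itv /= => /andP[t0 t1]; rewrite subr_gt0 t1.
rewrite (p (sin_div la)) (p (cos_rho la)).
rewrite -!/(cos_rho la _) cos_rho0 sin_div0 !addr0 mulr0 -Kc1.
set X := cint (fun t => K (1 - t) * q t); set Y := cint (fun t => Kc (1 - t) * q t).
have i1 : cintg (fun t => K (1 - t) * q t) by apply: cintgM => //; exact: cbm_sin_divB.
have i2 : cintg (fun t => Kc (1 - t) * q t) by apply: cintgM => //; exact: cbm_cos_rhoB.
have -> : cint (fun t => K t * q t) = K 1 * Y - Kc 1 * X.
  rewrite -!cintZ// -mulN1r -cintZ; last exact: cintgZ.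
  rewrite -cintD; [|exact: cintgZ|by apply: cintgZ; exact: cintgZ].
  (* The addition formula for t = 1 - (1 - t) merges the two integrals from [C] and its derivative
     at 1 into that of [K t]. *)
  apply: cint_eq => t _; have -> : K t = K 1 * Kc (1 - t) - Kc 1 * K (1 - t).
    by rewrite -[LHS](congr1 K (subKr 1 t)) sin_divD cos_rhoN sin_divN mulrN.
  ring.
have g2 : (-1) ^+ al * (-1) ^+ al = 1 :> R[i] by rewrite -expr2 sqrr_sign.
move: g2 (cos_rho_sqr la 1); move: ((-1) ^+ al) (Kc 1) (K 1) => g kc k g2 s2.
have -> : 2 - 2 * g * kc - (k * Y - kc * X + g * X) =
  1 + g * g * (kc ^+ 2 + la * k ^+ 2) - 2 * g * kc - g * g * (k * Y - kc * X) - g * X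
   by rewrite g2 s2; ring.
by ring.
Qed.

Lemma char_fun_right al : char_fun q 1 ((-1) ^+ al) la =
  2 - 2 * (-1) ^+ al * cos_sqrt la - (-1) ^+ al * cint (fun t => boundary_kernel al t * q t).
Proof.
rewrite cint_psi /char_fun !cderive_solS.
rewrite (cderive_solC ointegral_right (cder_conv_right (x := 0) _)) ?lexx ?ler01//.
rewrite (cderive_solC ointegral_right (cder_conv_right (x := 1) _)) ?lexx ?ler01//.
rewrite /solC /solS !ointegral_right !subrr !sub0r.
have z (g : R -> R[i]) (e : R[i]) :
   cint (fun t => e * (if 0 < - (1 - t) then g (- (1 - t)) else 0) * q t) = 0.
  rewrite (@cint_eq _ _ (fun=> 0)) ?cintE /= ?int01_cst// => t.
  rewrite /= in_itv /= => /andP[t0 t1].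
  by rewrite opprB subr_gt0 ifF ?mulr0 ?mul0r//; apply/negbTE; rewrite -leNgt ltW.
have p (g : R -> R[i]) (e : R[i]) : cint (fun t => e * (if 0 < - (0 - t) then g (- (0 - t)) else 0) * q t) =
    cint (fun t => e * g t * q t).
  by apply: cint_eq => t; rewrite /= in_itv /= sub0r opprK => /andP[t0 t1]; rewrite t0.
have n1 (g : R -> R[i]) : cint (fun t => - g t * q t) = cint (fun t => -1 * g t * q t).
  by apply: cint_eq => t _; rewrite mulN1r.
have n2 (g : R -> R[i]) : cint (fun t => g t * q t) = cint (fun t => 1 * g t * q t).
  by apply: cint_eq => t _; rewrite mul1r.
rewrite (n1 (fun t => cos_rho_pos la (- (0 - t)))) (n1 (fun t => cos_rho_pos la (- (1 - t)))).
rewrite (n2 (fun t => sin_div_pos la (- (0 - t)))) (n2 (fun t => sin_div_pos la (- (1 - t)))).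
rewrite (z (sin_div la)) (z (cos_rho la)) (p (sin_div la)) (p (cos_rho la)).
rewrite -!/(cos_rho la _) cos_rho0 sin_div0 !addr0 mulr0 -Kc1 cos_rhoN sin_divN.
set X := cint (fun t => 1 * K t * q t); set Y := cint (fun t => -1 * Kc t * q t).
have -> : cint (fun t => K t * q t) = X by exact: n2.
have i1 : cintg (fun t => 1 * K t * q t).
  by apply: cintgM => //; apply: cbmM; [exact: cbm_cst|exact: cbm_sin_div].
have i2 : cintg (fun t => -1 * Kc t * q t).
  by apply: cintgM => //; apply: cbmM; [exact: cbm_cst|exact: cbm_cos_rho].
have -> : cint (fun t => K (1 - t) * q t) = - K 1 * Y - Kc 1 * X.
  rewrite -mulNr -!cintZ// -cintD; [|exact: cintgZ|exact: cintgZ].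
  apply: cint_eq => t _; rewrite sin_divD cos_rhoN sin_divN; ring.
have g2 : (-1) ^+ al * (-1) ^+ al = 1 :> R[i] by rewrite -expr2 sqrr_sign.
move: g2 (cos_rho_sqr la 1); move: ((-1) ^+ al) (Kc 1) (K 1) => g kc k g2 s2.
have -> : 2 - 2 * g * kc - g * (X + g * (- k * Y - kc * X)) =
  g * g + (kc ^+ 2 + la * k ^+ 2) - 2 * g * kc - g * X - (- k * Y - kc * X).
  by rewrite s2 mulrDr (mulrA g g) g2; ring.
ring.
Qed.

End CharacteristicFunction.

(** * Parseval's formula for cosine coefficients *)

Section CosineSeries.
Variable R : realType.
Local Notation mu := (@lebesgue_measure R).
Local Notation D := (`]0, 1[%classic : set R).

Lemma cos_weight_neq0 n : cos_weight R n != 0.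
Proof. by rewrite /cos_weight; case: ifP => _; rewrite ?oner_eq0// mul1r invr_eq0 pnatr_eq0. Qed.

(** The coefficients of [p] are summable, so the cosine series of [p] converges uniformly and may be
    integrated termwise against [f]. *)
Lemma cos_expansion (p f : R -> R) (v : nat -> R) (B M : R) :
  measurable_fun D p -> (forall t, D t -> `|p t| <= M) ->
  (forall n, `|cos_coef p n / cos_weight R n| <= v n) -> (forall n, \sum_(k < n) v k <= B) ->
  intg f ->
  (fun N => \sum_(k < N) cos_coef p k / cos_weight R k * cos_coef f k) @ \oo -->
    int01 (fun t => p t * f t).
Proof.
move=> mp pM cv vB hf.
pose c n := cos_coef p n / cos_weight R n.
pose s N (t : R) := \sum_(k < N) c k * cosn k t.
have cs (t : R) : cvgn (fun N => s N t).
  rewrite (_ : (fun N => s N t) = series (fun k => c k * cosn k t)); last first.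
    by apply/funext => N; rewrite seriesEord.
  apply: (@real_sum_cvg _ _ v B) => // k.
  by rewrite normrM; apply: le_trans (cv k); rewrite ler_piMr// cosn_le1.
pose g (t : R) := limn (fun N => s N t).
have sB N t : `|s N t| <= B.
  apply: le_trans (ler_norm_sum _ _ _) _; apply: le_trans (vB N).
  apply: ler_sum => k _; rewrite normrM; apply: le_trans (cv k).
  by rewrite ler_piMr// cosn_le1.
have ms N : measurable_fun D (s N).
  have -> : s N = cos_poly c 0 N by apply/funext => t; rewrite /cos_poly big_mkord.
  exact: cos_poly_measurable.
have mg : measurable_fun D g by apply: (measurable_fun_cvg ms) => t _; exact: cs.
have gB t : `|g t| <= B.
  have cn : (fun N => `|s N t|) @ \oo --> `|g t| by apply: cvg_norm; exact: cs.
  by apply: (cvgr_to_le cn); apply: nearW => N; exact: sB.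
have lim h : intg h -> (fun N => \sum_(k < N) c k * cos_coef h k) @ \oo --> int01 (fun t => h t * g t).
  move=> hh.
  have [_] : intg (fun t => h t * g t) /\
      (fun N => int01 (fun t => h t * s N t)) @ \oo --> int01 (fun t => h t * g t).
    apply: (@int01_dominated _ _ _ (fun t => B * `|h t|)).
    - by move=> N; apply: measurable_funM => //; exact: intg_measurable.
    - by apply: measurable_funM => //; exact: intg_measurable.
    - by apply: aeT => t _; apply: cvgM; [exact: cvg_cst|exact: cs].
    - by apply: intgZ; exact: intg_norm.
    - by move=> N t _; rewrite normrM mulrC ler_wpM2r.
  suff -> : (fun N => int01 (fun t => h t * s N t)) = (fun N => \sum_(k < N) c k * cos_coef h k) by [].
  apply/funext => N.
  rewrite (@int01_eq R _ (fun t => \sum_(k < N) c k * (h t * cosn k t))); last first.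
    by move=> t _; rewrite /s mulr_sumr; apply: eq_bigr => k _; rewrite mulrCA.
  rewrite int01_sum; last by move=> k; apply: intgZ; exact: intg_cosn.
  by apply: eq_bigr => k _; rewrite int01Z//; exact: intg_cosn.
have ip : intg p by exact: intg_bounded mp pM.
have ig : intg g by apply: (intg_bounded mg) => t _; exact: gB.
(* The sum [g] has the same cosine coefficients as [p], so completeness identifies them almost
   everywhere. *)
have pg : {ae mu, forall x, D x -> p x = g x}.
  have := cos_complete (intgB ip ig) _.
  move=> H; have {}H : {ae mu, forall x, D x -> p x - g x = 0}.
    apply: H => m; rewrite /cos_coef.
    rewrite (@int01_eq R _ (fun t => p t * cosn m t - g t * cosn m t)); last by move=> t _; ring.
    rewrite int01B; [|exact: intg_cosn|exact: intg_cosn].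
    apply/eqP; rewrite subr_eq0; apply/eqP.
    have E : (fun N => \sum_(k < N) c k * cos_coef (cosn m) k) @ \oo --> cos_coef p m.
      apply: cvg_near_cst; exists m.+1 => // N /= mN.
      rewrite (eq_bigr (fun k : 'I_N => if (k : nat) == m then cos_coef p m else 0)); last first.
        move=> k _; rewrite /cos_coef cosn_orth eq_sym; case: eqP => [->|_]; last by rewrite mulr0.
        by rewrite /c divfK// cos_weight_neq0.
      by rewrite -big_mkcond /= (big_ord1_eq _ (fun=> cos_coef p m)) mN.
    have := cvg_unique _ E (lim _ (intg_cos R m)) => /(_ (@Rhausdorff R)).
    by rewrite /cos_coef => ->; apply: int01_eq => t _; rewrite mulrC.
  by apply: aeS H => x H Dx; apply/eqP; rewrite -subr_eq0; apply/eqP; exact: H.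
rewrite (_ : int01 (fun t => p t * f t) = int01 (fun t => f t * g t)); first exact: lim.
apply: int01_ae_eq.
- by apply: (intg_eq _ (intgM hf mp pM)) => t _; exact: mulrC.
- by apply: (intgM hf mg) => t _; exact: gB.
- by apply: aeS pg => x pg Dx; rewrite pg// mulrC.
Qed.

Lemma ccvg_ReIm (u : nat -> R[i]) l :
  (fun n => complex.Re (u n)) @ \oo --> complex.Re l ->
  (fun n => complex.Im (u n)) @ \oo --> complex.Im l -> ccvg u l.
Proof.
move=> hr hi e e0; have e2 : 0 < e / 2 by rewrite divr_gt0.
have /cvgrPdist_lt/(_ _ e2)[N _ H] := hr.
have /cvgrPdist_lt/(_ _ e2)[M _ H'] := hi.
exists (maxn N M) => n; rewrite geq_max => /andP[/H /= Hn /H' /= Kn].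
rewrite normcB (le_lt_trans (normc_le_ReIm _))// [ltRHS]splitr.
have -> : complex.Re (l - u n) = complex.Re l - complex.Re (u n) by case: (l) (u n) => [? ?] [].
have -> : complex.Im (l - u n) = complex.Im l - complex.Im (u n) by case: (l) (u n) => [? ?] [].
exact: ltrD.
Qed.

Definition ccos_coef (q : R -> R[i]) n : R[i] :=
  cos_coef (fun t => complex.Re (q t)) n +i* cos_coef (fun t => complex.Im (q t)) n.

Lemma ccos_coefE q n : ccos_coef q n = cint (fun t => q t * (cosn n t)%:C).
Proof.
rewrite cintE /ccos_coef; congr (_ +i* _); apply: int01_eq => t _.
  by rewrite cReM /= mulr0 subr0.
by rewrite cImM /= mulr0 add0r.
Qed.

Lemma ccos_expansion (p q : R -> R[i]) (v : nat -> R) (B : R) : cbm p -> cintg q ->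
  (forall n, normc (ccos_coef p n / (cos_weight R n)%:C) <= v n) ->
  (forall n, \sum_(k < n) v k <= B) ->
  csum (fun k => ccos_coef p k / (cos_weight R k)%:C * ccos_coef q k)
    (cint (fun t => p t * q t)).
Proof.
move=> [m1 m2 [M pM]] [q1 q2] pv vB.
have divE n : ccos_coef p n / (cos_weight R n)%:C =
    (cos_coef (fun t => complex.Re (p t)) n / cos_weight R n) +i*
    (cos_coef (fun t => complex.Im (p t)) n / cos_weight R n).
  by rewrite -fmorphV; apply: complex_ext; rewrite ?cReM ?cImM /= mulr0 ?subr0 ?add0r.
have b1 t : D t -> `|complex.Re (p t)| <= M by move=> /pM; apply: le_trans; exact: Re_le_normc.
have b2 t : D t -> `|complex.Im (p t)| <= M by move=> /pM; apply: le_trans; exact: Im_le_normc.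
have v1 n : `|cos_coef (fun t => complex.Re (p t)) n / cos_weight R n| <= v n.
  by apply: le_trans (pv n); rewrite divE; exact: (Re_le_normc (_ +i* _)).
have v2 n : `|cos_coef (fun t => complex.Im (p t)) n / cos_weight R n| <= v n.
  by apply: le_trans (pv n); rewrite divE; exact: (Im_le_normc (_ +i* _)).
have E11 := cos_expansion m1 b1 v1 vB q1; have E12 := cos_expansion m1 b1 v1 vB q2.
have E21 := cos_expansion m2 b2 v2 vB q1; have E22 := cos_expansion m2 b2 v2 vB q2.
have ii (r h : R -> R) : intg h -> measurable_fun D r -> (forall t, D t -> `|r t| <= M) ->
    intg (fun t => r t * h t).
  by move=> hh hr rM; apply: (intg_eq _ (intgM hh hr rM)) => t _; exact: mulrC.
apply: ccvg_ReIm.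
- rewrite (_ : complex.Re _ = int01 (fun t => complex.Re (p t) * complex.Re (q t)) -
    int01 (fun t => complex.Im (p t) * complex.Im (q t))); last first.
    by rewrite -int01B; [apply: int01_eq => t _; rewrite cReM|exact: ii|exact: ii].
  rewrite (_ : (fun n => complex.Re _) = (fun N =>
    (\sum_(k < N) cos_coef (fun t => complex.Re (p t)) k / cos_weight R k *
      cos_coef (fun t => complex.Re (q t)) k) -
    (\sum_(k < N) cos_coef (fun t => complex.Im (p t)) k / cos_weight R k *
      cos_coef (fun t => complex.Im (q t)) k))).
    by apply: cvgB; [exact: E11|exact: E22].
  apply/funext => N; rewrite Re_sum.
  by rewrite -sumrB; apply: eq_bigr => k _; rewrite cReM divE.
- rewrite (_ : complex.Im _ = int01 (fun t => complex.Re (p t) * complex.Im (q t)) +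
    int01 (fun t => complex.Im (p t) * complex.Re (q t))); last first.
    by rewrite -int01D; [apply: int01_eq => t _; rewrite cImM|exact: ii|exact: ii].
  rewrite (_ : (fun n => complex.Im _) = (fun N =>
    (\sum_(k < N) cos_coef (fun t => complex.Re (p t)) k / cos_weight R k *
      cos_coef (fun t => complex.Im (q t)) k) +
    (\sum_(k < N) cos_coef (fun t => complex.Im (p t)) k / cos_weight R k *
      cos_coef (fun t => complex.Re (q t)) k))).
    by apply: cvgD; [exact: E12|exact: E21].
  apply/funext => N; rewrite Im_sum.
  by rewrite -big_split; apply: eq_bigr => k _; rewrite cImM divE.
Qed.

Lemma cint_FTC (F f df : R -> R[i]) : (forall t, cder F t (f t)) ->
  (forall t, cder f t (df t)) -> cint f = F 1 - F 0.
Proof.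
move=> hF hf; apply: complex_ext.
  rewrite (_ : complex.Re (F 1 - F 0) = complex.Re (F 1) - complex.Re (F 0)); last first.
    by case: (F 1) (F 0) => [? ?] [].
  apply: (int01_FTC (F := fun t => complex.Re (F t))) => [x|]; first by case: (hF x).
  by apply: is_derive_continuous => x; case: (hf x) => h _; exact: h.
rewrite (_ : complex.Im (F 1 - F 0) = complex.Im (F 1) - complex.Im (F 0)); last first.
  by case: (F 1) (F 0) => [? ?] [].
apply: (int01_FTC (F := fun t => complex.Im (F t))) => [x|]; first by case: (hF x).
by apply: is_derive_continuous => x; case: (hf x) => _ h; exact: h.
Qed.

End CosineSeries.

Section Nodes.
Variable R : realType.

Definition sqpi (n : nat) : R[i] := ((n%:R * pi) ^+ 2)%:C.

(** From k^2 - j^2 >= (k - j)^2 for j <= k, and pi^2 >= 1. *)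
Lemma sqpi_sep j k : ((j - k + (k - j)) ^ 2)%N%:R <= normc (sqpi j - sqpi k) :> R.
Proof.
wlog jk : j k / (j <= k)%N => [H|].
  have [jk|/ltnW kj] := leqP j k; first exact: H.
  by rewrite addnC normcB; exact: H.
have -> : (j - k = 0)%N by apply/eqP; rewrite subn_eq0.
rewrite add0n normcB /sqpi -rmorphB normc_real.
have jk' : j%:R <= k%:R :> R by rewrite ler_nat.
have j0 : 0 <= j%:R :> R by [].
have p1 : 1 <= pi :> R by have := @pi_ge2 R; lra.
have -> : (k%:R * pi) ^+ 2 - (j%:R * pi) ^+ 2 = (k%:R ^+ 2 - j%:R ^+ 2) * (pi * pi) :> R by ring.
have h0 : 0 <= k%:R ^+ 2 - j%:R ^+ 2 :> R by rewrite subr_ge0 lerXn2r// ?nnegrE//; lra.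
rewrite ger0_norm; last by rewrite mulr_ge0// mulr_ge0//; lra.
rewrite natrX natrB//.
apply: (@le_trans _ _ (k%:R ^+ 2 - j%:R ^+ 2)); first by nra.
by rewrite ler_peMr// -[1]mulr1 ler_pM.
Qed.

Definition node (al k : nat) : R[i] := sqpi (2 * k + al).

Lemma node_sep al j k : ((j - k + (k - j)) ^ 2)%N%:R <= normc (node al j - node al k) :> R.
Proof.
apply: le_trans (sqpi_sep (2 * j + al) (2 * k + al)); rewrite ler_nat leq_exp2r//.
by rewrite !subnDr -!mulnBr -mulnDr leq_pmull.
Qed.

Lemma cos_rho_sqpi n t : cos_rho (sqpi n) t = (cosn n t)%:C.
Proof.
rewrite /cos_rho (@cos_sqrtE _ _ (sqpi n * t%:C ^+ 2)); last by rewrite exprMn sqrtCK.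
rewrite -(@cos_sqrtE _ ((n%:R * pi)%:C * t%:C)); last by rewrite exprMn /sqpi rmorphXn.
by rewrite -rmorphM ccos_real.
Qed.

Lemma cos_rho_sqpi1 n : cos_rho (sqpi n) 1 = (-1) ^+ n.
Proof. by rewrite cos_rho_sqpi /cosn mulr1 cos_natpi rmorphXn rmorphN rmorph1. Qed.

(** The factor [sqpi n] covers n = 0, where [sin_div] at 1 is 1 and not 0. *)
Lemma sin_div_sqpi1 n : sqpi n * sin_div (sqpi n) 1 = 0.
Proof.
have := cos_rho_sqr (sqpi n) 1; rewrite cos_rho_sqpi1 sqrr_sign => /eqP.
by rewrite -subr_eq0 addrAC subrr add0r mulf_eq0 sqrf_eq0 -mulf_eq0 => /eqP.
Qed.

Lemma sqpi_neq0 n : (0 < n)%N -> sqpi n != 0.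
Proof.
move=> n0; rewrite -normc_eq0 normc_real normr_eq0 expf_neq0// mulf_neq0//.
  by rewrite pnatr_eq0 -lt0n.
by rewrite gt_eqF// pi_gt0.
Qed.

Lemma sqpi0 : sqpi 0 = 0. Proof. by rewrite /sqpi mul0r expr0n. Qed.

Lemma node_neq0 al k : (0 < 2 * k + al)%N -> node al k != 0.
Proof. exact: sqpi_neq0. Qed.

End Nodes.

(** * Cosine coefficients of the boundary kernel *)

Section PsiCoefficients.
Variables (R : realType) (la : R[i]) (al : nat).
Local Notation K := (sin_div la).
Local Notation Kc := (cos_rho la).
Local Notation g := ((-1) ^+ al : R[i]).
Local Notation psi := (boundary_kernel la al).

Lemma g2 : g * g = 1. Proof. by rewrite -expr2 sqrr_sign. Qed.

Definition dpsi (t : R) : R[i] := Kc t - g * Kc (1 - t).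

Lemma psiE t : psi t = (1 - g * Kc 1) * K t + g * K 1 * Kc t.
Proof. by rewrite /boundary_kernel sin_divD cos_rhoN sin_divN; ring. Qed.

Lemma dpsiE t : dpsi t = (1 - g * Kc 1) * Kc t - la * (g * K 1) * K t.
Proof. by rewrite /dpsi cos_rhoD cos_rhoN sin_divN; ring. Qed.

Lemma cder_psi t : cder psi t (dpsi t).
Proof.
apply: (@cder_ext _ (fun t => (1 - g * Kc 1) * K t + g * K 1 * Kc t)); first by move=> s; rewrite psiE.
have -> : dpsi t = (1 - g * Kc 1) * Kc t + g * K 1 * (- la * K t) by rewrite dpsiE; ring.
by apply: cderD; apply: cderZ; [exact: cder_sin_div|exact: cder_cos_rho].
Qed.

Lemma cder_dpsi t : cder dpsi t (- la * psi t).
Proof.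
apply: (@cder_ext _ (fun t => (1 - g * Kc 1) * Kc t + (- (la * (g * K 1))) * K t)).
  by move=> s; rewrite dpsiE mulNr.
have -> : - la * psi t = (1 - g * Kc 1) * (- la * K t) + (- (la * (g * K 1))) * Kc t.
  by rewrite psiE; ring.
by apply: cderD; apply: cderZ; [exact: cder_cos_rho|exact: cder_sin_div].
Qed.

(** Lagrange's identity: the kernel and cos (n pi t) solve y'' = - lambda y with different lambda,
    so their product times the difference of the two values is the derivative of a Wronskian. The
    right side is its boundary values. *)
Lemma psi_coef_eq n : (sqpi R n - la) * ccos_coef psi n =
  (-1) ^+ n * (Kc 1 - g) - (1 - g * Kc 1).
Proof.
rewrite ccos_coefE.
have i1 : cintg (fun t => psi t * (cosn n t)%:C).
  have i0 : cintg (fun=> 1 : R[i]) by split; exact: intg_cst.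
  apply: (@cintg_eq _ (fun t => (psi t * (cosn n t)%:C) * 1)); first by move=> t _; rewrite mulr1.
  apply: cintgM => //; apply: cbmM; first exact: cbm_psi.
  by apply: (cbm_real (cosn_measurable n)) => t _; exact: cosn_le1.
rewrite -cintZ//.
pose L := sin_div (sqpi R n); pose Lc := cos_rho (sqpi R n).
rewrite (@cint_eq _ _ (fun t => (sqpi R n - la) * (psi t * Lc t))); last first.
  by move=> t _; rewrite /Lc cos_rho_sqpi.
rewrite (@cint_FTC _ (fun t => dpsi t * Lc t + sqpi R n * (psi t * L t)) _
  (fun t => (sqpi R n - la) * (dpsi t * Lc t + psi t * (- sqpi R n * L t)))).
- rewrite /L /Lc [sqpi R n * (psi 1 * _)]mulrCA sin_div_sqpi1 mulr0 addr0.
  rewrite sin_div0 !mulr0 addr0 cos_rho0 mulr1 cos_rho_sqpi1 /dpsi.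
  by rewrite subrr subr0 cos_rho0; ring.
- move=> t.
  have := cderD (cderM (cder_dpsi t) (cder_cos_rho (sqpi R n) t))
    (cderZ (sqpi R n) (cderM (cder_psi t) (cder_sin_div (sqpi R n) t))).
  by congr (cder _ _ _); rewrite -/Lc -/L; ring.
- move=> t; apply: cderZ; apply: cderM; first exact: cder_psi.
  exact: cder_cos_rho.
Qed.

Lemma psi_coef_same n : odd n = odd al -> la != sqpi R n ->
  ccos_coef psi n = 2 * (1 - g * cos_sqrt la) / (la - sqpi R n).
Proof.
move=> nal ln; have := psi_coef_eq n.
have -> : (-1) ^+ n = g by rewrite -signr_odd nal signr_odd.
have l0 : la - sqpi R n != 0 by rewrite subr_eq0.
rewrite Kc1 mulrBr g2 => H.
have -> : 2 * (1 - g * cos_sqrt la) = - (g * cos_sqrt la - 1 - (1 - g * cos_sqrt la)) by ring.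
by rewrite -H -mulNr opprB mulrAC divff// mul1r.
Qed.

(** The symmetries of the kernel and of [cosn n] about 1/2 are opposite, so the integrand is odd
    about 1/2. The proof reads this off [psi_coef_eq], except for lambda = (n pi)^2. *)
Lemma psi_coef_other n : odd n != odd al -> ccos_coef psi n = 0.
Proof.
move=> nal; have gn : (-1) ^+ n = - g.
  rewrite -signr_odd -[in RHS]signr_odd; case: (odd n) (odd al) nal => [] [] //= _.
  by rewrite expr1 expr0 opprK.
have := psi_coef_eq n; rewrite gn => H.
have {}H : (sqpi R n - la) * ccos_coef psi n = 0.
  by rewrite H mulrBr !mulNr g2; ring.
(* At lambda = (n pi)^2 the identity is void and the coefficient is integrated explicitly. *)
have [E|E] := eqVneq la (sqpi R n); last first.
  by move/eqP: H; rewrite mulf_eq0 subr_eq0 eq_sym (negbTE E) => /eqP.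
have kc1 : Kc 1 = - g by rewrite E cos_rho_sqpi1.
rewrite ccos_coefE (@cint_eq _ _ (fun t => 2 * (K t * Kc t) + g * K 1 * (Kc t * Kc t))); last first.
  by move=> t _; rewrite -cos_rho_sqpi -E psiE kc1 mulrN g2; ring.
have FE t : cder (fun t => K t * K t + g * K 1 * ((t%:C + K t * Kc t) / 2)) t
    (2 * (K t * Kc t) + g * K 1 * (Kc t * Kc t)).
  have := cderD (cderM (cder_sin_div la t) (cder_sin_div la t)) (cderZ (g * K 1 / 2)
    (cderD (cder_real t) (cderM (cder_sin_div la t) (cder_cos_rho la t)))).
  have -> : Kc t * K t + K t * Kc t +
     g * K 1 / 2 * (1 + (Kc t * Kc t + K t * (- la * K t))) =
     2 * (K t * Kc t) + g * K 1 * (Kc t * Kc t).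
    have -> : 1 + (Kc t * Kc t + K t * (- la * K t)) = 2 * (Kc t * Kc t).
      by rewrite -{1}(cos_rho_sqr la t); ring.
    by field.
  by apply: cder_ext => s; rewrite [in RHS]mulrCA mulrA mulrC [in LHS]mulrC; ring.
rewrite (cint_FTC FE (df := fun t => 2 * (Kc t * Kc t + K t * (- la * K t)) +
   g * K 1 * ((- la * K t) * Kc t + Kc t * (- la * K t)))); last first.
  move=> t; apply: cderD; apply: cderZ; apply: cderM;
   [exact: cder_sin_div|exact: cder_cos_rho|exact: cder_cos_rho|exact: cder_cos_rho].
rewrite sin_div0 kc1; have lk := sin_div_sqpi1 R n; rewrite -E in lk.
have -> : K 1 * K 1 + g * K 1 * ((1%:C + K 1 * - g) / 2) - (0 * 0 + g * K 1 * ((0%:C + 0 * Kc 0) / 2)) =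
   K 1 * (K 1 + g) / 2.
  have -> : g * K 1 * ((1%:C + K 1 * - g) / 2) = g * K 1 / 2 - g * g * K 1 * K 1 / 2.
    by rewrite rmorph1; field.
  by rewrite g2 rmorph0; field.
(* The integral is K 1 (K 1 + g) / 2: either K 1 = 0, or lambda = 0 and then n = 0, g = -1 and K 1 =
   1. *)
have [l0|l0] := eqVneq la 0; last first.
  by move/eqP: lk; rewrite mulf_eq0 (negbTE l0) => /eqP ->; rewrite !mul0r.
have n0 : n = 0%N.
  by apply/eqP; apply: contraT; rewrite -lt0n => /(sqpi_neq0 R); rewrite -E l0 eqxx.
have -> : g = -1 by rewrite -[LHS]opprK -gn n0 expr0.
by rewrite l0 /sin_div eqxx rmorph1 subrr mulr0 mul0r.
Qed.

End PsiCoefficients.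

(** * The characteristic function as a product of two factors *)

Section CharacteristicFunctionSeries.
Variables (R : realType) (q : R -> R[i]) (al : nat).
Hypothesis hq : cintg q.
Hypothesis al2 : (al < 2)%N.
Local Notation g := ((-1) ^+ al : R[i]).

(** The Fourier coefficient of [q] along the cosine of index 2 k + al; division by the squared norm
    accounts for the factor 1 or 2. *)
Definition node_coef (k : nat) : R[i] :=
  ccos_coef q (2 * k + al) / (cos_weight R (2 * k + al))%:C.

Lemma cos_coef_le (f : R -> R) n : intg f -> `|cos_coef f n| <= int01 (fun t => `|f t|).
Proof.
move=> hf; apply: le_trans (int01_norm (intg_cosn n hf)) _.
apply: int01_le; [by apply: intg_norm; exact: intg_cosn|exact: intg_norm|].
by move=> t _; rewrite normrM ler_piMr// cosn_le1.
Qed.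

Lemma cos_weight_le n : normc (cos_weight R n)%:C^-1 <= 2.
Proof.
rewrite normcV normc_real /cos_weight; case: ifP => _.
  by rewrite normr1 invr1; lra.
by rewrite mul1r ger0_norm ?invrK// invr_ge0.
Qed.

Lemma bounded_node_coef : bounded_seq node_coef.
Proof.
have [h1 h2] := hq.
exists ((int01 (fun t => `|complex.Re (q t)|) + int01 (fun t => `|complex.Im (q t)|)) * 2) => k.
rewrite /node_coef normcM ler_pM ?normc_ge0 ?cos_weight_le//.
by apply: le_trans (normc_le_ReIm _) _; apply: lerD; exact: cos_coef_le.
Qed.

Lemma sum_even_odd (h : nat -> R[i]) N : (forall n, odd n != odd al -> h n = 0) ->
  \sum_(n < 2 * N) h n = \sum_(k < N) h (2 * k + al)%N.
Proof.
move=> h0; rewrite big_even_odd /=; case: al al2 h0 => [|[|]]// _ h0.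
  rewrite [X in _ + X]big1 ?addr0 => [|k _]; last by rewrite h0//= mul2n odd_double.
  by apply: eq_bigr => k _; rewrite addn0.
rewrite big1 ?add0r => [|k _]; last by rewrite h0//= mul2n odd_double.
by apply: eq_bigr => k _; rewrite addn1.
Qed.

(** Parseval's formula: the coefficients of the kernel vanish for one parity and share the numerator
    2 (1 - g cos sqrt(lambda)) for the other. *)
Lemma cint_psi_series la : (forall k, node R al k != la) ->
  cint (fun t => boundary_kernel la al t * q t) =
  2 * (1 - g * cos_sqrt la) * pf (node R al) node_coef la.
Proof.
move=> nla; have [c c0 H] := pole_distance (@sqpi_sep R) la.
have ll : normc (la - la) < c by rewrite subrr normc0.
pose A := 2 * (1 - g * cos_sqrt la).
have parity n : odd n = odd al -> la != sqpi R n.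
  move=> on; suff [k ->] : exists k, n = (2 * k + al)%N by rewrite eq_sym; exact: nla.
  exists (n./2); rewrite -[LHS]odd_double_half on mul2n addnC.
  by case: al al2 => [|[|]].
have cP n : ccos_coef (boundary_kernel la al) n = if odd n == odd al then A / (la - sqpi R n) else 0.
  by case: eqP => [e|/eqP e]; [apply: psi_coef_same => //; exact: parity|exact: psi_coef_other].
have vn n : normc (ccos_coef (boundary_kernel la al) n / (cos_weight R n)%:C) <=
    pf_weight (normc A * 2) c n.
  have w0 : 0 <= pf_weight (normc A * 2) c n.
    by rewrite /pf_weight mulr_ge0 ?inv_sq_ge0// divr_ge0 ?(ltW c0)// mulr_ge0// normc_ge0.
  rewrite cP; case: eqP => [e|_]; last by rewrite mul0r normc0.
  have ln : sqpi R n != la by rewrite eq_sym parity.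
  apply: le_trans (pf_term_le _ c0 (H n la ln ll)); last by rewrite mulr_ge0// normc_ge0.
  rewrite mulrAC normcM normcV normcM ler_wpM2r ?invr_ge0 ?normc_ge0//.
  by rewrite ler_wpM2l ?normc_ge0// cos_weight_le.
have B0 : 0 <= normc A * 2 by rewrite mulr_ge0// normc_ge0.
have S1 := ccos_expansion (cbm_psi la al) hq vn (pf_weight_sum B0 c0).
have S2 := csumZ A (pf_csum (node_sep R al) la bounded_node_coef).
apply: ccvg_unique S2 => e e0; have [N HN] := S1 e e0.
(* Among the first 2 n indices exactly n have the parity of [al]. *)
exists N => n Nn; have := HN (2 * n)%N (leq_trans Nn (leq_pmull n (isT : (0 < 2)%N))).
have hE := @sum_even_odd (fun k => ccos_coef (boundary_kernel la al) k / (cos_weight R k)%:C * ccos_coef q k) n.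
rewrite hE; last by move=> m om; rewrite cP (negbTE om) mul0r mul0r.
rewrite (eq_bigr (fun k : 'I_n => A * (node_coef k / (la - node R al k))))// => k _.
rewrite cP oddD oddM /= eqxx /node_coef /node.
by move: (_^-1) (_^-1) (ccos_coef _ _) => x y z; ring.
Qed.

(** The sign by which [char_fun_left] and [char_fun_right] differ. *)
Definition side_sign (a : R) : R[i] := if a == 0 then 1 else g.

Lemma char_funE a la : a = 0 \/ a = 1 -> char_fun q a g la =
  2 - 2 * g * cos_sqrt la - side_sign a * cint (fun t => boundary_kernel la al t * q t).
Proof.
rewrite /side_sign => -[->|->]; first by rewrite eqxx mul1r char_fun_left.
by rewrite oner_eq0 char_fun_right.
Qed.

Definition char_coef a k : R[i] := side_sign a * node_coef k.

Lemma bounded_char_coef a : bounded_seq (char_coef a).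
Proof. exact: bounded_seqZ bounded_node_coef. Qed.

Lemma char_fun_off_nodes a la : a = 0 \/ a = 1 -> (forall k, node R al k != la) ->
  char_fun q a g la = 2 * (1 - g * cos_sqrt la) * (1 - pf (node R al) (char_coef a) la).
Proof.
move=> ha nla; rewrite char_funE// cint_psi_series// /char_coef (pfZ (node_sep R al))//.
  by ring.
exact: bounded_node_coef.
Qed.

(** At a nonzero node cos rho = g and sin rho / rho = 0, so the boundary kernel vanishes
    identically: a node is an eigenvalue whatever [q] is. *)
Lemma char_fun_node a k : a = 0 \/ a = 1 -> (0 < 2 * k + al)%N ->
  char_fun q a g (node R al k) = 0.
Proof.
move=> ha n0; rewrite char_funE//.
have oe : (-1) ^+ (2 * k + al) = g.
  by rewrite -signr_odd oddD mul2n odd_double /= signr_odd.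
have kc : cos_rho (node R al k) 1 = g by rewrite cos_rho_sqpi1 oe.
have k1 : sin_div (node R al k) 1 = 0.
  have := sin_div_sqpi1 R (2 * k + al); move/eqP; rewrite mulf_eq0.
  by rewrite (negbTE (sqpi_neq0 R n0)) => /eqP.
rewrite (@cint_eq _ _ (fun=> 0)); last first.
  by move=> t _; rewrite psiE kc k1 g2 subrr mulr0 !mul0r addr0 mul0r.
rewrite cintE /= int01_cst -Kc1 kc -mulrA g2 mulr1 subrr sub0r.
by rewrite -[0 +i* 0]/(0 : R[i]) mulr0 oppr0.
Qed.

(** At lambda = 0 the periodic kernel is t + (1 - t) = 1, so only the mean of [q] enters. *)
Lemma char_fun_zero a : a = 0 \/ a = 1 -> al = 0%N -> char_fun q a g 0 = - char_coef a 0.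
Proof.
move=> ha al0; rewrite char_funE// /char_coef /node_coef al0 muln0 addn0 expr0.
rewrite /cos_weight /= rmorph1 divr1 /cos_sqrt sqrtC0 ccos0 !mulr1 subrr sub0r.
congr (- (_ * _)); rewrite ccos_coefE; apply: cint_eq => t _.
rewrite /boundary_kernel /sin_div eqxx expr0 mul1r -rmorphD addrCA subrr addr0 rmorph1 mul1r.
by rewrite /cosn !mul0r cos0 mulr1.
Qed.

End CharacteristicFunctionSeries.

(** * The spectra *)

Section CharacteristicZeros.
Variables (R : realType) (al : nat).
Hypothesis al2 : (al < 2)%N.
Local Notation g := ((-1) ^+ al : R[i]).
Local Notation mu := (node R al).
Local Notation m_sep := (@node_sep R al).

Lemma node_is_pole n : odd n = odd al -> is_pole mu (sqpi R n).
Proof.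
move=> on; apply/is_poleP; exists (n./2).
by rewrite /node -[in RHS](odd_double_half n) on mul2n addnC; case: al al2 => [|[|]].
Qed.

(* The number of k >= 1 with lambda_{2k-1} = z. *)
Definition fixed_mult z : bool := is_pole mu z && (z != 0).

(** The order is 0 off the nodes, 1 at the node 0 and 2 at the others: one order to cancel the pole
    of the second factor, one for the fixed eigenvalue. *)
Lemma vers_zeros z : exists H : R[i] -> R[i], [/\ H z != 0, cnear z (cdiff H) &
  cnear z (fun w => 2 * (1 - g * cos_sqrt w) = (w - z) ^+ (is_pole mu z + fixed_mult z) * H w)].
Proof.
have n2 : (2 : R[i]) != 0 by rewrite pnatr_eq0.
rewrite /fixed_mult; have [pz|np] := boolP (is_pole mu z); last first.
  exists (fun w => 2 * (1 - g * cos_sqrt w)); split.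
  - rewrite mulf_neq0//; apply/eqP => /cos_sqrt_eq[n [zn on]].
    by move/negP: np; apply; rewrite zn; exact: node_is_pole.
  - apply: cnearT => w; apply: cdiffM; first exact: cdiff_cst.
    apply: cdiffB; first exact: cdiff_cst.
    by apply: cdiffM; [exact: cdiff_cst|exact: cos_sqrt_cdiff].
  - by apply: cnearT => w; rewrite expr0 mul1r.
have /is_poleP[k zk] := pz; have [z0|z0] := eqVneq z 0.
  have al0 : al = 0%N.
    apply/eqP; apply: contraT; rewrite -lt0n => al0.
    by have := @node_neq0 R al k; rewrite addn_gt0 al0 orbT zk z0 eqxx => /(_ isT).
  exists (fun w => 2 * vers_div w); split.
  - by rewrite z0 vers_div0 mulf_neq0// mulf_neq0 ?invr_eq0 ?oner_eq0.
  - apply: cnearT => w; apply: cdiffM; [exact: cdiff_cst|exact: vers_div_cdiff].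
  - apply: cnearT => w; rewrite al0 expr0 mul1r vers_divE z0 subr0 addn0 expr1; ring.
have n0 : (0 < 2 * k + al)%N.
  rewrite lt0n; apply: contraNneq z0 => n0; rewrite -zk /node n0; apply/eqP; exact: sqpi0.
have [H [H0 dH EH]] := cos_sqrt_pole R n0; rewrite /node /sqpi in zk.
rewrite zk in H0 dH EH; exists (fun w => 2 * H w); split.
- by rewrite mulf_neq0.
- by apply: cnearS dH => w dH; apply: cdiffM => //; exact: cdiff_cst.
- apply: cnearS EH => w; rewrite -signr_odd oddD mul2n odd_double /= signr_odd => ->.
  by rewrite mulrCA.
Qed.

(** The orders from [vers_zeros] and [pf_zeros] add up, the pole cancelling. Away from [z] this is
    the product formula; the value at [z] itself needs an argument of its own. *)
Lemma char_fun_zeros q a ka z : a = 0 \/ a = 1 -> cintg q -> bounded_seq ka ->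
  (forall k, char_coef q al a k = residues mu ka k) ->
  exists N0, (forall j, (N0 <= j)%N -> mu j + ka j != z) /\ forall N, (N0 <= N)%N ->
  zero_mult (char_fun q a g) z (\sum_(j < N) ((mu j + ka j)%R == z) + fixed_mult z)%N.
Proof.
move=> ha hq hk bE; pose b := char_coef q al a; pose f := char_fun q a g.
have hb : bounded_seq b by exact: bounded_char_coef.
have [N0 [far HN]] := pf_zeros m_sep z hk; exists N0; split=> [j /far[]//|N N0N].
have [G [G0 dG EG]] := HN N N0N; have [H [H0 dH EH]] := vers_zeros z.
move: EG; have -> : (\sum_(j < N) (mu j == z) = is_pole mu z)%N.
  by apply: count_inj => [j k /(mu_inj m_sep)//|j Nj]; have [] := far j (leq_trans N0N Nj).
set E := (\sum_(j < N) _)%N => EG.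
have bpf w : pf mu (residues mu ka) w = pf mu b w.
  by congr (pf mu _ w); apply/funext => k; rewrite /b bE.
have cE : cnear z (fun w => w != z -> f w = (w - z) ^+ (E + fixed_mult z) * (H w * G w)).
  apply: cnearS (cnearI (cnearI EG EH) (pole_isolated m_sep z)) => w [[{}EG {}EH] nw] wz.
  rewrite /f char_fun_off_nodes//; last exact: nw.
  rewrite EH -/b !exprD.
  transitivity ((w - z) ^+ fixed_mult z * H w * ((w - z) ^+ is_pole mu z * (1 - pf mu b w))).
    by ring.
  by rewrite -bpf EG//; ring.
have cG := cdiff_cont (cnear_self dG); have cH := cdiff_cont (cnear_self dH).
have cr : ccont (fun w => (w - z) ^+ (E + fixed_mult z) * (H w * G w)) z.
  apply: ccontM; last exact: ccontM.
  by apply: ccontX; apply: ccontB; [exact: ccont_id|exact: ccont_cst].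
(* It suffices to find a function continuous at [z], with the right value at [z], that agrees with
   the characteristic function around [z]. *)
have fz f1 : ccont f1 z -> f1 z = f z -> cnear z (fun w => w != z -> f1 w = f w) ->
    f z = (z - z) ^+ (E + fixed_mult z) * (H z * G z).
  move=> c1 <- ff; apply: (ccont_unique c1 cr).
  by apply: cnearS (cnearI ff cE) => w [f1f {}cE] wz; rewrite f1f// cE.
have {}fz : f z = (z - z) ^+ (E + fixed_mult z) * (H z * G z).
  have [pz|np] := boolP (is_pole mu z); last first.
    have npz k : mu k != z by apply: contraNneq np => kz; apply/is_poleP; exists k.
    apply: (fz (fun w => 2 * (1 - g * cos_sqrt w) * (1 - pf mu b w))).
    - apply/cdiff_cont/cdiffM.
        apply: cdiffM; first exact: cdiff_cst.
        apply: cdiffB; first exact: cdiff_cst.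
        by apply: cdiffM; [exact: cdiff_cst|exact: cos_sqrt_cdiff].
      apply: cdiffB; first exact: cdiff_cst.
      by apply: (pf_cdiff m_sep hb) => k kz; have := npz k; rewrite kz eqxx.
    - by rewrite /f char_fun_off_nodes.
    - apply: cnearS (pole_isolated m_sep z) => w nw wz.
      by rewrite /f char_fun_off_nodes//; exact: nw.
  (* At a nonzero node both sides are 0, by [char_fun_node] and since the exponent is positive. *)
  have /is_poleP[k zk] := pz; have [z0|z0] := eqVneq z 0; last first.
    rewrite /fixed_mult pz z0 addn1 exprS subrr !mul0r -zk /f char_fun_node//.
    rewrite lt0n; apply: contraNneq z0 => n0; rewrite -zk /node n0; apply/eqP; exact: sqpi0.
  have al0 : al = 0%N.
    apply/eqP; apply: contraT; rewrite -lt0n => al0.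
    by have := @node_neq0 R al k; rewrite addn_gt0 al0 orbT zk z0 eqxx => /(_ isT).
  have m0 : mu 0%N = 0 by rewrite /node al0 sqpi0.
  (* At the node 0 the product formula has its factor w multiplied into the term of the pole, which
     removes the singularity. *)
  apply: (fz (fun w => 2 * vers_div w * (w - b 0%N - w * pf mu (drop_at b 0) w))).
  - apply/cdiff_cont/cdiffM; first by apply: cdiffM; [exact: cdiff_cst|exact: vers_div_cdiff].
    apply: cdiffB; first by apply: cdiffB; [exact: cdiff_id|exact: cdiff_cst].
    apply: cdiffM; first exact: cdiff_id.
    apply: (pf_cdiff m_sep); first exact: bounded_drop.
    by move=> j; rewrite z0 -m0 => /(mu_inj m_sep) ->; rewrite /drop_at eqxx.
  - rewrite z0 vers_div0 !mul0r !subr0 sub0r /f char_fun_zero// -/b.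
    by rewrite mulrCA mulfV// mulr1 mul1r.
  - apply: cnearS (pole_isolated m_sep z) => w nw wz.
    rewrite /f char_fun_off_nodes//; last exact: nw.
    rewrite -/b [in RHS](pf_drop m_sep 0 w hb) m0 subr0 al0 expr0 mul1r vers_divE.
    by have w0 : w != 0 by [rewrite -z0]; field.
exists (fun w => H w * G w); split.
- by rewrite mulf_neq0.
- apply/cnear_nbhs; apply: cnearS (cnearI dH dG) => w [{}dH {}dG].
  by apply: cdiff_derivable; exact: cdiffM.
- apply/cnear_nbhs; apply: cnearS cE => w {}cE.
  by have [->|wz] := eqVneq w z; [exact: fz|exact: cE].
Qed.

Lemma derivable_bounded (G : R[i]^o -> R[i]^o) z : derivable G z 1 ->
  exists C : R, cnear z (fun w => normc (G w) <= C).
Proof.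
move=> /derivable1_diffP/differentiable_continuous dG.
exists (normc (G z) + 1).
have /cvgrPdist_lt/(_ 1 ltr01)/cnear_nbhs := dG.
apply: cnearS => w H; have {}H : (normc (G z - G w))%:C < 1%:C := H.
have := normc_dist_add (G w) (G z) 0; rewrite !subr0 => /le_trans; apply.
by rewrite addrC lerD2l normcB -lecR ltW.
Qed.

(** The first factor has exactly the order of [vers_zeros], so dividing by it bounds |1 - pf| |w -
    z|^is_pole by a multiple of |w - z|^E. *)
Lemma char_fun_vanishes q a z E l : a = 0 \/ a = 1 -> cintg q ->
  zero_mult (char_fun q a g) z (E + fixed_mult z) -> (l <= E)%N ->
  vanishes mu (fun w => 1 - pf mu (char_coef q al a) w) z l.
Proof.
move=> ha hq [G [G0 /cnear_nbhs dG /cnear_nbhs EG]] lE.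
apply: vanishesW lE _; have [C HC] := derivable_bounded (cnear_self dG).
have [H [H0 dH EH]] := vers_zeros z.
have H2 : 0 < normc (H z) / 2 by rewrite divr_gt0// normc_gt0.
exists (C / (normc (H z) / 2)).
have cH := ccont_neq0 (cdiff_cont (cnear_self dH)) H0.
apply: cnearS (cnearI (cnearI EG EH) (cnearI (pole_isolated m_sep z) (cnearI HC cH))).
move=> w [[{}EG {}EH] [nw [{}HC {}cH]]] wz.
have wz0 : 0 < normc (w - z) by rewrite normc_gt0 subr_eq0.
have := congr1 (@normc R) EG.
rewrite char_fun_off_nodes//; last exact: nw.
rewrite EH !normcM !normcX !exprD.
have x0 := exprn_gt0 (fixed_mult z) wz0; have t0 := exprn_gt0 (is_pole mu z) wz0.
have y0 := exprn_gt0 E wz0.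
move: x0 t0 y0; set x := _ ^+ fixed_mult z; set t := _ ^+ is_pole mu z; set y := _ ^+ E.
move=> x0 t0 y0; set P := normc (1 - _) => EE.
have {}EE : normc (H w) * (P * t) = normc (G w) * y.
  apply: (mulfI (lt0r_neq0 x0)).
  by transitivity (t * x * normc (H w) * P); [ring|rewrite EE; ring].
rewrite mulrAC ler_pdivlMr// mulrC.
apply: (@le_trans _ _ (normc (G w) * y)); last by rewrite ler_wpM2r// ltW.
by rewrite -EE ler_wpM2r// mulr_ge0 ?normc_ge0// ltW.
Qed.

End CharacteristicZeros.

(** * From the prescribed sequence to the coefficients and back *)

Section Spectra.
Variables (R : realType) (al : nat).
Hypothesis al2 : (al < 2)%N.
Local Notation g := ((-1) ^+ al : R[i]).
Local Notation mu := (node R al).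
Local Notation m_sep := (@node_sep R al).
Variables (lam ka : nat -> R[i]).
Hypothesis lam_even : forall k, lam (2 * k)%N = mu k + ka k.
Hypothesis lam_odd : forall k, (0 < k)%N -> lam (2 * k - 1)%N = sqpi R (2 * k - al).

Lemma lam_odd_succ j : lam (2 * j).+1 = sqpi R (2 * j.+1 - al).
Proof. by rewrite -lam_odd//; congr lam; lia. Qed.

Lemma lam_odd_inj : injective (fun j => lam (2 * j).+1).
Proof. by move=> j k; rewrite !lam_odd_succ => /(mu_inj (@sqpi_sep R)); lia. Qed.

(** The terms of odd index run exactly once through the nonzero nodes. *)
Lemma lam_odd_range z : `[< exists j, lam (2 * j).+1 = z >] = fixed_mult al z.
Proof.
rewrite /fixed_mult; apply/asboolP/andP => [[j <-]|[/is_poleP[k <-] z0]].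
  rewrite lam_odd_succ; split; last by apply: sqpi_neq0; lia.
  apply: node_is_pole => //; rewrite oddB; last by lia.
  by rewrite oddM /=; case: al al2 => [|[|]].
have k0 : (0 < 2 * k + al)%N.
  by rewrite lt0n; apply: contraNneq z0 => n0; rewrite /node n0; apply/eqP; exact: sqpi0.
(* For al = 0 the node 2 k is term k - 1, for al = 1 the node 2 k + 1 is term k. *)
exists (k + al).-1; rewrite lam_odd_succ /node; congr sqpi.
by case: al al2 k0 => [|[|]]//; lia.
Qed.

(** Even indices give the occurrences of [z] among the shifted nodes, odd ones the fixed eigenvalue:
    the exponent found in [char_fun_zeros]. *)
Lemma spectrum_count z N0 : (forall j, (N0 <= j)%N -> mu j + ka j != z) ->
  exists2 N, (N0 <= N)%N & ([set n | lam n = z] #=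
    `I_(\sum_(j < N) ((mu j + ka j)%R == z) + fixed_mult al z)%N)%card.
Proof.
move=> far; have [N1 HN1] : exists N1, forall j, (N1 <= j)%N -> lam (2 * j).+1 != z.
  have [[m <-]|h] := pselect (exists m, lam (2 * m).+1 = z).
    by exists m.+1 => j mj; apply/eqP => /lam_odd_inj E; rewrite E ltnn in mj.
  by exists 0%N => j _; apply/eqP => E; apply: h; exists j.
exists (maxn N0 N1); first exact: leq_maxl.
set N := maxn _ _.
have lamN n : (2 * N <= n)%N -> lam n != z.
  move=> Nn; rewrite -(odd_double_half n) -mul2n.
  have N2 : (N <= n./2)%N by move: Nn; rewrite -{1}(odd_double_half n) -mul2n; lia.
  case: (odd n); last by rewrite lam_even; apply: far; exact: leq_trans (leq_maxl _ _) N2.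
  by apply: HN1; exact: leq_trans (leq_maxr _ _) N2.
have := @card_eq_count (fun n => lam n == z) (2 * N) lamN.
have -> : [set n | lam n == z] = [set n | lam n = z].
  by apply/seteqP; split=> n /eqP.
rewrite (big_even_odd _ (fun n => lam n == z : nat)) -lam_odd_range.
rewrite -(count_inj (M := N) lam_odd_inj); last first.
  by move=> j Nj; apply: HN1; exact: leq_trans (leq_maxr _ _) Nj.
by under eq_bigr do rewrite lam_even.
Qed.

Hypothesis hk : bounded_seq ka.

Lemma spectrum_exists q a : a = 0 \/ a = 1 -> cintg q ->
  (forall k, char_coef q al a k = residues mu ka k) -> is_spectrum q a g lam.
Proof.
move=> ha hq bE z; have [N0 [far HN]] := char_fun_zeros al2 z ha hq hk bE.
have [N N0N hc] := spectrum_count far.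
by exists (\sum_(j < N) ((mu j + ka j)%R == z) + fixed_mult al z)%N => //; exact: HN.
Qed.

Lemma spectrum_vanishes q a z (s : seq nat) : a = 0 \/ a = 1 -> cintg q ->
  is_spectrum q a g lam -> uniq s -> (forall j, j \in s -> mu j + ka j = z) ->
  vanishes mu (fun w => 1 - pf mu (char_coef q al a) w) z (size s).
Proof.
move=> ha hq /(_ z)[m mz hm] us hs; have [N0 [far _]] := pf_zeros m_sep z hk.
have far' j : (N0 <= j)%N -> mu j + ka j != z by move=> /far[].
have [N N0N hc] := spectrum_count far'.
(* The multiplicity is read off the cardinal of the set of indices. *)
have Em : m = (\sum_(j < N) ((mu j + ka j)%R == z) + fixed_mult al z)%N.
  by apply/card_eq_II; apply: card_eq_trans hc; rewrite card_eq_sym.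
rewrite Em in mz; apply: (char_fun_vanishes al2 ha hq mz).
apply: (uniq_size_count (f := fun j => mu j + ka j)) => // j Nj.
by apply: far'; exact: leq_trans Nj.
Qed.

Lemma spectrum_char_coef q q' a N : a = 0 \/ a = 1 -> cintg q -> cintg q' ->
  (forall k, (N <= k)%N -> normc (ka k) <= 16^-1) ->
  is_spectrum q a g lam -> is_spectrum q' a g lam ->
  forall k, char_coef q' al a k = char_coef q al a k.
Proof.
move=> ha hq hq' kaN sq sq' k; apply/eqP; rewrite -subr_eq0; apply/eqP.
pose b := char_coef q al a; pose b' := char_coef q' al a.
have hb : bounded_seq b by exact: bounded_char_coef.
have hb' : bounded_seq b' by exact: bounded_char_coef.
have hbZ : bounded_seq (fun k => -1 * b k) by exact: bounded_seqZ.
suff H j : b' j + -1 * b j = 0 by rewrite -(H k) mulN1r.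
apply: (@pf_unique _ _ m_sep (fun j => b' j + -1 * b j) (fun j => mu j + ka j) N).
- exact: bounded_seqD.
- by move=> i Ni; rewrite addrAC subrr add0r; exact: kaN.
- move=> z s us hs.
  have [B HB] := spectrum_vanishes ha hq sq us hs.
  have [B' HB'] := spectrum_vanishes ha hq' sq' us hs.
  exists (B + B'); apply: cnearS (cnearI HB HB') => w [{}HB {}HB'] wz.
  rewrite (pfD m_sep w hb' hbZ) (pfZ m_sep (-1) w hb) mulN1r.
  have -> : pf mu b' w - pf mu b w = (1 - pf mu b w) - (1 - pf mu b' w) by ring.
  rewrite mulrDl; apply: le_trans (lerD (HB wz) (HB' wz)).
  by rewrite -mulrDl ler_wpM2r ?exprn_ge0 ?normc_ge0// normc_le_sub.
Qed.

End Spectra.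

Section SquareSummable.
Variable R : realType.
Implicit Types (u : nat -> R[i]).

Lemma in_l2_sum_le u : in_l2 u -> exists B : R, forall n, \sum_(k < n) normc (u k) ^+ 2 <= B.
Proof.
rewrite /in_l2; set S := (\sum_(0 <= k <oo) _)%E => S_fin.
have S0 : (0 <= S)%E by apply: nneseries_ge0 => k _ _; rewrite lee_fin sqr_ge0.
exists (fine S) => n; rewrite -lee_fin fineK ?ge0_fin_numE// -sumEFin
  -(big_mkord xpredT (fun k => (normc (u k) ^+ 2)%:E)).
by apply: nneseries_lim_ge => k _ _; rewrite lee_fin sqr_ge0.
Qed.

Lemma in_l2_bounded u : in_l2 u -> bounded_seq u.
Proof.
move=> /in_l2_sum_le[B HB]; exists (1 + B) => k.
have := HB k.+1; rewrite big_ord_recr /=.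
have : 0 <= \sum_(j < k) normc (u j) ^+ 2 by apply: sumr_ge0 => j _; exact: sqr_ge0.
have := normc_ge0 (u k); nra.
Qed.

Lemma in_l2_tail u (e : R) : in_l2 u -> 0 < e -> exists N, forall k, (N <= k)%N -> normc (u k) <= e.
Proof.
move=> /in_l2_sum_le[B HB] e0.
have [N HN] := bounded_sum_tail (fun k => sqr_ge0 (normc (u k))) HB (exprn_gt0 2 e0).
exists N => k Nk; have := HN k.+1; rewrite big_nat_recr//= => H.
rewrite -(@ler_pXn2r _ 2)// ?nnegrE ?normc_ge0 ?(ltW e0)//; apply/ltW/(le_lt_trans _ H).
by rewrite lerDr sumr_ge0// => j _; exact: sqr_ge0.
Qed.

End SquareSummable.

Section ComplexCosineCoefficients.
Variable R : realType.
Local Notation mu := (@lebesgue_measure R).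
Local Notation D := (`]0, 1[%classic : set R).

Lemma complex_riesz_fischer (c : nat -> R[i]) (B : R) :
  (forall n, \sum_(k < n) normc (c k) ^+ 2 <= B) ->
  exists2 q, in_L2 q & forall n, ccos_coef q n = c n * (cos_weight R n)%:C.
Proof.
move=> cB.
have [|q1 [m1 s1 c1]] := @riesz_fischer R (fun n => complex.Re (c n)) B.
  move=> n; apply: le_trans (cB n); apply: ler_sum => k _.
  by rewrite -real_normK ?num_real// lerXn2r ?nnegrE ?normc_ge0// Re_le_normc.
have [|q2 [m2 s2 c2]] := @riesz_fischer R (fun n => complex.Im (c n)) B.
  move=> n; apply: le_trans (cB n); apply: ler_sum => k _.
  by rewrite -real_normK ?num_real// lerXn2r ?nnegrE ?normc_ge0// Im_le_normc.
exists (fun x => q1 x +i* q2 x).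
  split=> //=.
  under eq_integral do rewrite sqr_sqrtr ?addr_ge0 ?sqr_ge0// EFinD.
  have mX (f : R -> R) : measurable_fun D f -> measurable_fun D (fun x => (f x ^+ 2)%:E).
    by move=> mf; apply/measurable_EFinP; exact: measurable_funX.
  rewrite ge0_integralD//=.
  - exact: lte_add_pinfty.
  - by move=> x _; rewrite lee_fin sqr_ge0.
  - exact: mX.
  - by move=> x _; rewrite lee_fin sqr_ge0.
  - exact: mX.
move=> n; rewrite /ccos_coef /= c1 c2; apply: complex_ext; rewrite ?cReM ?cImM /=; ring.
Qed.

Lemma ccos_coef_inj q q' : cintg q -> cintg q' -> (forall n, ccos_coef q n = ccos_coef q' n) ->
  {ae mu, forall x, x \in `]0, 1[ -> q x = q' x}.
Proof.
move=> [i1 i2] [j1 j2] E.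
have H (f h : R -> R) : intg f -> intg h -> (forall n, cos_coef f n = cos_coef h n) ->
    {ae mu, forall x, D x -> f x - h x = 0}.
  move=> hf hh fh; apply: cos_complete; first exact: intgB.
  move=> n; rewrite /cos_coef.
  rewrite (@int01_eq _ _ (fun t => f t * cosn n t - h t * cosn n t)); last first.
    by move=> t _; rewrite mulrBl.
  by rewrite int01B ?intg_cosn//; apply/eqP; rewrite subr_eq0; apply/eqP; exact: fh.
have h1 := H _ _ i1 j1 (fun n => congr1 (@complex.Re R) (E n)).
have h2 := H _ _ i2 j2 (fun n => congr1 (@complex.Im R) (E n)).
apply: aeS (aeI h1 h2) => x [{}h1 {}h2] xD; have Dx : D x by rewrite /= in xD *.
by apply: complex_ext; apply/eqP; rewrite -subr_eq0; apply/eqP; [exact: h1|exact: h2].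
Qed.

End ComplexCosineCoefficients.

Theorem theorem5 (R : realType) (a : R) (ha : a = 0 \/ a = 1)
    (lam kappa : 'I_2 -> nat -> R[i])
    (hkappa : forall al : 'I_2, in_l2 (kappa al))
    (hlam_even : forall (al : 'I_2) (k : nat),
       lam al (2 * k)%N
       = ((2 * k + al)%N%:R ^+ 2 * pi ^+ 2)%:C + kappa al k)
    (hlam_odd : forall (al : 'I_2) (k : nat), (1 <= k)%N ->
       lam al (2 * k - 1)%N = ((2 * k - al)%N%:R ^+ 2 * pi ^+ 2)%:C) :
  exists q : R -> R[i],
    [/\ in_L2 q,
        forall al : 'I_2, is_spectrum q a ((-1) ^+ al) (lam al) &
        forall q' : R -> R[i], in_L2 q' ->
          (forall al : 'I_2, is_spectrum q' a ((-1) ^+ al) (lam al)) ->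
          {ae @lebesgue_measure R, forall x, x \in `]0, 1[ -> q' x = q x}].
Proof.
have lam_even al k : lam al (2 * k)%N = node R al k + kappa al k.
  by rewrite hlam_even /node /sqpi exprMn.
have lam_odd al k : (0 < k)%N -> lam al (2 * k - 1)%N = sqpi R (2 * k - al).
  by move=> k0; rewrite hlam_odd// /sqpi exprMn.
(* The sign is its own inverse, so multiplying by it passes between [char_coef] and the coefficients
   of [q]. *)
have ss al : side_sign al a * side_sign al a = 1.
  by rewrite /side_sign; case: ifP => _; rewrite ?mulr1 ?g2.
have ns al : normc (side_sign al a) = 1.
  by rewrite /side_sign; case: ifP => _; rewrite ?normcX ?normcN normc1 ?expr1n.
pose par n : 'I_2 := inord (odd n).
have parE (al : 'I_2) k : par (2 * k + al)%N = al.
  apply: val_inj; rewrite /= inordK ?ltnS ?leq_b1// oddD oddM /=.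
  by case: al => [[|[|]]].
have halfE (al : 'I_2) k : (2 * k + al)./2 = k.
  by case: al => [[|[|m]]]//= _; rewrite ?addn0 ?addn1 /= ?uphalf_double mul2n ?doubleK ?uphalf_double.
(* The two sequences of residues are interleaved: the parity of n selects the problem and n / 2 the
   index in it. *)
pose c n := side_sign (par n) a * residues (node R (par n)) (kappa (par n)) n./2.
have cE (al : 'I_2) k : c (2 * k + al)%N = side_sign al a * residues (node R al) (kappa al) k.
  by rewrite /c parE halfE.
have hk al := in_l2_bounded (hkappa al).
have c_sum (al : 'I_2) : exists B : R, forall n, \sum_(k < n) normc (c (2 * k + al)%N) ^+ 2 <= B.
  have [B kB] := hk al; have [S HS] := in_l2_sum_le (hkappa al).
  exists (expR (B * 4) ^+ 2 * S) => n.
  apply: (@le_trans _ _ (expR (B * 4) ^+ 2 * \sum_(k < n) normc (kappa al k) ^+ 2)).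
    rewrite mulr_sumr ler_sum// => k _; rewrite cE normcM ns mul1r -exprMn.
    rewrite lerXn2r ?nnegrE ?normc_ge0 ?mulr_ge0 ?expR_ge0 ?normc_ge0//.
    exact: (residues_le (@node_sep R al) kB).
  by rewrite ler_wpM2l// exprn_ge0// expR_ge0.
have [B0 HB0] := c_sum ord0; have [B1 HB1] := c_sum ord_max.
have cB n : \sum_(k < n) normc (c k) ^+ 2 <= B0 + B1.
  apply: le_trans (lerD (HB0 n) (HB1 n)).
  (* With 2 n terms, each parity contributes a full sum of length n. *)
  apply: (@le_trans _ _ (\sum_(k < 2 * n) normc (c k) ^+ 2)).
    rewrite -!(big_mkord xpredT (fun k => normc (c k) ^+ 2)).
    by rewrite [leRHS](big_cat_nat (n := n)) ?leq_pmull//= lerDl sumr_ge0// => k _; exact: sqr_ge0.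
  by rewrite (big_even_odd _ (fun k => normc (c k) ^+ 2)) /= lerD// ler_sum// => k _; rewrite ?addn0 ?addn1.
have [q hq qc] := complex_riesz_fischer cB; have iq := in_L2_cintg hq.
have w0 n : (cos_weight R n)%:C != 0 :> R[i].
  by rewrite -normc_eq0 normc_real normr_eq0 cos_weight_neq0.
have sq (al : 'I_2) : is_spectrum q a ((-1) ^+ al) (lam al).
  apply: (spectrum_exists (ltn_ord al) (lam_even al) (lam_odd al) (hk al) ha iq) => k.
  by rewrite /char_coef /node_coef qc mulfK// cE mulrA ss mul1r.
exists q; split=> // q' hq' sq'.
have iq' := in_L2_cintg hq'; apply: ccos_coef_inj => // n.
have [al [k ->]] : exists al : 'I_2, exists k, n = (2 * k + al)%N.
  by exists (par n), n./2; rewrite inordK ?ltnS ?leq_b1// -[LHS]odd_double_half mul2n addnC.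
(* The smallness of the shifts beyond some index that [pf_unique] asks for. *)
have e0 : 0 < 16^-1 :> R by rewrite invr_gt0.
have [N HN] := in_l2_tail (hkappa al) e0.
have := spectrum_char_coef (ltn_ord al) (lam_even al) (lam_odd al) (hk al) ha iq iq' HN (sq al) (sq' al) k.
rewrite /char_coef /node_coef => /(congr1 ( *%R (side_sign al a))).
by rewrite !mulrA ss !mul1r => /(mulIf (invr_neq0 (w0 _))).
Qed.
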